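(* Let $\mathcal{C}$ be a modular tensor category and let $A$ be a Frobenius algebra in $\mathcal C$. Then $R(A)$ is a Frobenius algebra in $\mathcal C^2_\pm$ and (i) $A$ is symmetric if and only if $R(A)$ is symmetric; (ii) $A$ is (normalised-)special if and only if $R(A)$ is (normalised-)special.
   Context: A modular tensor category is an abelian semisimple finite $\mathbb{C}$-linear ribbon category with simple tensor unit $\mathbf 1$, braiding $c_{U,V}:U\otimes V\to V\otimes U$ and twist $\theta$, such that, for representatives $\{U_i\}_{i\in\mathcal I}$ of the isomorphism classes of simple objects, the matrix $s_{i,j}=\mathrm{tr}(c_{U_j,U_i}\circ c_{U_i,U_j})$ is invertible. Associators and unit isomorphisms are suppressed. Dualities: $d_U:U^\vee\otimes U\to\mathbf 1$, $b_U:\mathbf 1\to U\otimes U^\vee$, $\tilde d_U:U\otimes U^\vee\to\mathbf 1$, $\tilde b_U:\mathbf 1\to U^\vee\otimes U$; $\dim U=d_U\circ\tilde b_U$; $\mathrm{Dim}\,\mathcal C=\sum_i(\dim U_i)^2$. $\mathcal C_+=\mathcal C$; $\mathcal C_-$ is $\mathcal C$ with inverse braiding and twist; $\mathcal C^2_\pm=\mathcal C_+\boxtimes\mathcal C_-$ has objects finite direct sums of pairs $V\times W$, $\mathrm{Hom}(V\times W,V'\times W')=\mathrm{Hom}_{\mathcal C}(V,V')\otimes_{\mathbb C}\mathrm{Hom}_{\mathcal C}(W,W')$, and componentwise tensor product. For $V\in\mathcal C$, $\{b_V^{(i;\alpha)}\}_\alpha$ is a basis of $\mathrm{Hom}(V,U_i)$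 and $\{b^V_{(i;\alpha)}\}_\alpha$ the dual basis of $\mathrm{Hom}(U_i,V)$, $b_V^{(i;\alpha)}\circ b^V_{(i;\beta)}=\delta_{\alpha\beta}\mathrm{id}_{U_i}$. A Frobenius algebra $(A,m,\eta,\Delta,\varepsilon)$ is an algebra and coalgebra with $(\mathrm{id}\otimes m)(\Delta\otimes\mathrm{id})=\Delta\circ m=(m\otimes\mathrm{id})(\mathrm{id}\otimes\Delta)$. Symmetric: $((\varepsilon m)\otimes\mathrm{id}_{A^\vee})(\mathrm{id}_A\otimes b_A)=(\mathrm{id}_{A^\vee}\otimes(\varepsilon m))(\tilde b_A\otimes\mathrm{id}_A)$. Special: $m\circ\Delta=\zeta\,\mathrm{id}_A$ and $\varepsilon\circ\eta=\xi\,\mathrm{id}_{\mathbf 1}$ with $\zeta,\xi\in\mathbb C^\times$; normalised-special: special with $\zeta=1$. $T:\mathcal C^2_\pm\to\mathcal C$, $T(\oplus_iV_i\times W_i)=\oplus_iV_i\otimes W_i$, is a tensor functor with $\phi^T_0=\mathrm{id}_{\mathbf 1}$ and $\phi^T_2=\mathrm{id}_U\otimes c^{-1}_{W,V}\otimes\mathrm{id}_X:T(U\times V)\otimes T(W\times X)\to T((U\times V)\otimes(W\times X))$; put $\psi^T_k=(\phi^T_k)^{-1}$. $R:\mathcal C\to\mathcal C^2_\pm$ is $R(A)=\oplus_{i\in\mathcal I}(A\otimes U_i^\vee)\times U_i$, $R(f)=\oplus_i(f\otimes\mathrm{id}_{U_i^\vee})\times\mathrm{id}_{U_i}$. For $M=\oplus_nM^l_n\times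 M^r_n$ there are natural isomorphisms $\hat\chi:\mathrm{Hom}(T(M),A)\to\mathrm{Hom}(M,R(A))$, $\oplus_nf_n\mapsto\oplus_{n,i}\sum_\alpha[(f_n\otimes\mathrm{id}_{U_i^\vee})(\mathrm{id}_{M^l_n}\otimes b^{M^r_n}_{(i;\alpha)}\otimes\mathrm{id}_{U_i^\vee})(\mathrm{id}_{M^l_n}\otimes b_{U_i})]\times b_{M^r_n}^{(i;\alpha)}$, and $\check\chi:\mathrm{Hom}(A,T(M))\to\mathrm{Hom}(R(A),M)$, $\oplus_ng_n\mapsto\oplus_{n,i}\sum_\alpha\frac{\mathrm{Dim}\,\mathcal C}{\dim U_i}[(\mathrm{id}_{M^l_n}\otimes\tilde d_{U_i})(\mathrm{id}_{M^l_n}\otimes b_{M^r_n}^{(i;\alpha)}\otimes\mathrm{id}_{U_i^\vee})(g_n\otimes\mathrm{id}_{U_i^\vee})]\times b^{M^r_n}_{(i;\alpha)}$. Put $\hat\delta_M=\hat\chi(\mathrm{id}_{T(M)})$, $\hat\rho_A=\hat\chi^{-1}(\mathrm{id}_{R(A)})$, $\check\rho_M=\check\chi(\mathrm{id}_{T(M)})$, $\check\delta_A=\check\chi^{-1}(\mathrm{id}_{R(A)})$, and $\phi^R_0=\hat\chi(\psi^T_0)$, $\phi^R_2=R(\hat\rho_A\otimes\hat\rho_B)\circ R(\psi^T_2)\circ\hat\delta:R(A)\otimes R(B)\to R(A\otimes B)$, $\psi^R_0=\check\chi(\phi^T_0)$, $\psi^R_2=\check\rho\circ R(\phi^T_2)\circ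 R(\check\delta_A\otimes\check\delta_B):R(A\otimes B)\to R(A)\otimes R(B)$. The structure on $R(A)$ is $m_{R(A)}=R(m)\phi^R_2$, $\eta_{R(A)}=R(\eta)\phi^R_0$, $\Delta_{R(A)}=\psi^R_2R(\Delta)$, $\varepsilon_{R(A)}=\psi^R_0R(\varepsilon)$. *)

(* Defs.v *)
From HB Require Import structures.
From mathcomp Require Import all_boot all_order all_algebra.

Set Implicit Arguments.
Unset Strict Implicit.
Unset Printing Implicit Defensive.

Import GRing.Theory.
Local Open Scope ring_scope.

Declare Scope ob_scope.
Delimit Scope ob_scope with ob.
Declare Scope mor_scope.
Delimit Scope mor_scope with mor.

Reserved Notation "g ∘ f" (at level 40, left associativity).
Reserved Notation "f ⊗ g" (at level 38, left associativity).
Reserved Notation "U ^∨" (at level 2, format "U ^∨").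

Section Tensor.
Variable k : fieldType.
Implicit Types U V W : vectType k.

(* U ⊗ V as matrices of coordinates on e_i ⊗ f_j, for the library's bases     *)
(* (e_i) of U and (f_j) of V; the universal property is tlift_pure and        *)
(* tlift_uniq.                                                                *)
Definition tensor U V : vectType k := 'M[k]_(\dim {:U}, \dim {:V}).

Definition pure U V (u : U) (v : V) : tensor U V :=
  \matrix_(i, j) (coord (vbasis {:U}) i u * coord (vbasis {:V}) j v).

Definition tlift U V W (b : U -> V -> W) (t : tensor U V) : W :=
  \sum_i \sum_j t i j *: b (vbasis {:U})`_i (vbasis {:V})`_j.

Definition bilinear_map U V W (b : U -> V -> W) :=
  (forall v a u u', b (a *: u + u') v = a *: b u v + b u' v) /\
  (forall u a v v', b u (a *: v + v') = a *: b u v + b u v').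

Lemma pure_bilinear U V : bilinear_map (@pure U V).
Proof.
split=> [v a u u'|u a v v']; apply/matrixP=> i j; rewrite !mxE linearP /=.
  by rewrite mulrDl mulrA.
by rewrite mulrDr mulrCA.
Qed.

Lemma bilin_suml U V W (b : U -> V -> W) : bilinear_map b ->
  forall n (c : 'I_n -> k) (e : 'I_n -> U) v,
    b (\sum_i c i *: e i) v = \sum_i c i *: b (e i) v.
Proof.
case=> bl _ n c e v.
have b0 : b 0 v = 0.
  by have := bl v (-1) 0 0; rewrite scaler0 addr0 scaleN1r addNr.
elim: n c e => [|n IHn] c e; first by rewrite !big_ord0.
by rewrite !big_ord_recl bl IHn.
Qed.

Lemma bilin_sumr U V W (b : U -> V -> W) : bilinear_map b ->
  forall n (c : 'I_n -> k) (e : 'I_n -> V) u,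
    b u (\sum_i c i *: e i) = \sum_i c i *: b u (e i).
Proof.
case=> bl br n c e u.
exact: (@bilin_suml V U W (fun v u => b u v) (conj br bl)).
Qed.

Lemma tlift_pure U V W (b : U -> V -> W) (u : U) (v : V) :
  bilinear_map b -> tlift b (pure u v) = b u v.
Proof.
move=> bb; rewrite [in RHS](coord_vbasis (memvf u)) (bilin_suml bb).
apply: eq_bigr => i _; rewrite [in RHS](coord_vbasis (memvf v)) (bilin_sumr bb).
by rewrite scaler_sumr; apply: eq_bigr => j _; rewrite mxE scalerA.
Qed.

Lemma tlift_linear U V W (b : U -> V -> W) : linear (tlift b).
Proof.
move=> a s t; rewrite /tlift scaler_sumr -big_split; apply: eq_bigr => i _ /=.
rewrite scaler_sumr -big_split; apply: eq_bigr => j _ /=.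
by rewrite !mxE scalerDl scalerA.
Qed.

Lemma tensor_expand U V (t : tensor U V) :
  t = \sum_i \sum_j t i j *: pure (vbasis {:U})`_i (vbasis {:V})`_j.
Proof.
have fU := basis_free (vbasisP {:U}); have fV := basis_free (vbasisP {:V}).
rewrite [LHS]matrix_sum_delta; apply: eq_bigr => i _; apply: eq_bigr => j _.
congr (_ *: _); apply/matrixP=> i' j'; rewrite !mxE !coord_free //.
by rewrite (eq_sym i) (eq_sym j) -natrM mulnb.
Qed.

Lemma tensor_ind U V (P : tensor U V -> Prop) :
  (forall a s t, P s -> P t -> P (a *: s + t)) ->
  (forall u v, P (pure u v)) -> forall t, P t.
Proof.
move=> Plin Ppure t.
have P0 : P 0 by have := Plin (-1) _ _ (Ppure 0 0) (Ppure 0 0);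
  rewrite scaleN1r addNr.
have Pz a s : P s -> P (a *: s) by move=> Ps; rewrite -[_ *: _]addr0; exact: Plin.
have Pa s r : P s -> P r -> P (s + r).
  by move=> Ps Pr; rewrite -[s]scale1r; exact: Plin.
rewrite [t]tensor_expand; apply: big_ind => // i _.
by apply: big_ind => // j _; exact: Pz.
Qed.

Lemma tlift_uniq U V W (b : U -> V -> W) (f : tensor U V -> W) :
  bilinear_map b -> linear f -> (forall u v, f (pure u v) = b u v) ->
  f =1 tlift b.
Proof.
move=> bb lf fb; apply: tensor_ind => [a s t es et|u v].
  by rewrite lf tlift_linear es et.
by rewrite fb tlift_pure.
Qed.

Section Map2.
Variables (U V U' V' U2 V2 : vectType k).
Variables (p : U -> U' -> U2) (q : V -> V' -> V2).
Hypotheses (pb : bilinear_map p) (qb : bilinear_map q).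

(* (u ⊗ v, u' ⊗ v') |-> p u u' ⊗ q v v', extended bilinearly *)
Definition tmap2 (s : tensor U V) (t : tensor U' V') : tensor U2 V2 :=
  tlift (fun u v => tlift (fun u' v' => pure (p u u') (q v v')) t) s.

Lemma tmap2_inner u v : bilinear_map (fun u' v' => pure (p u u') (q v v')).
Proof.
have [[pl pr] [ql qr]] := (pb, qb); have [ol or] := pure_bilinear U2 V2.
by split=> *; rewrite ?pr ?qr ?ol ?or.
Qed.

Lemma tmap2_outer t :
  bilinear_map (fun u v => tlift (fun u' v' => pure (p u u') (q v v')) t).
Proof.
have [[pl pr] [ql qr]] := (pb, qb); have [ol or] := pure_bilinear U2 V2.
split=> [v a u u'|u a v v']; elim/tensor_ind: t => [c s t es et|x y].
- rewrite !tlift_linear es et !scalerDr !scalerA (mulrC c).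
  by rewrite addrACA.
- by rewrite !tlift_pure ?pl ?ol //; exact: tmap2_inner.
- rewrite !tlift_linear es et !scalerDr !scalerA (mulrC c).
  by rewrite addrACA.
- by rewrite !tlift_pure ?ql ?or //; exact: tmap2_inner.
Qed.

Lemma tmap2_pure u v u' v' :
  tmap2 (pure u v) (pure u' v') = pure (p u u') (q v v').
Proof.
rewrite /tmap2 tlift_pure; last exact: tmap2_outer.
by rewrite tlift_pure //; exact: tmap2_inner.
Qed.

Lemma tmap2_bilinear : bilinear_map tmap2.
Proof.
split=> [t a s s'|s a t t']; first exact: tlift_linear.
elim/tensor_ind: s => [c s s' es es'|u v].
  rewrite /tmap2 !tlift_linear -!/(tmap2 _ _) es es' !scalerDr !scalerA (mulrC c).
  by rewrite addrACA.
by rewrite /tmap2 !(tlift_pure _ _ (tmap2_outer _)) tlift_linear.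
Qed.
End Map2.
End Tensor.

Section DependentProduct.
Variables (k : fieldType) (J : finType) (F : J -> vectType k).

Definition dprod := {dffun forall j, F j}.
HB.instance Definition _ := Choice.on dprod.
Implicit Types f g : dprod.

Definition dprod_zero : dprod := [ffun j => 0 : F j].
Definition dprod_opp f : dprod := [ffun j => - f j : F j].
Definition dprod_add f g : dprod := [ffun j => f j + g j : F j].
Definition dprod_scale a f : dprod := [ffun j => a *: f j : F j].

Fact dprod_addA : associative dprod_add.
Proof. by move=> f g h; apply/ffunP=> j; rewrite !ffunE addrA. Qed.
Fact dprod_addC : commutative dprod_add.
Proof. by move=> f g; apply/ffunP=> j; rewrite !ffunE addrC. Qed.
Fact dprod_add0 : left_id dprod_zero dprod_add.
Proof. by move=> f; apply/ffunP=> j; rewrite !ffunE add0r. Qed.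
Fact dprod_addN : left_inverse dprod_zero dprod_opp dprod_add.
Proof. by move=> f; apply/ffunP=> j; rewrite !ffunE addNr. Qed.
HB.instance Definition _ := GRing.isZmodule.Build dprod
  dprod_addA dprod_addC dprod_add0 dprod_addN.

Fact dprod_scaleA a b f : dprod_scale a (dprod_scale b f) = dprod_scale (a * b) f.
Proof. by apply/ffunP=> j; rewrite !ffunE scalerA. Qed.
Fact dprod_scale1 : left_id 1 dprod_scale.
Proof. by move=> f; apply/ffunP=> j; rewrite !ffunE scale1r. Qed.
Fact dprod_scaleDr : right_distributive dprod_scale +%R.
Proof. by move=> a f g; apply/ffunP=> j; rewrite !ffunE scalerDr. Qed.
Fact dprod_scaleDl f : {morph dprod_scale^~ f : a b / a + b}.
Proof. by move=> a b; apply/ffunP=> j; rewrite !ffunE scalerDl. Qed.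
HB.instance Definition _ := GRing.Zmodule_isLmodule.Build k dprod
  dprod_scaleA dprod_scale1 dprod_scaleDr dprod_scaleDl.

Lemma dprodD f g j : (f + g) j = f j + g j. Proof. by rewrite ffunE. Qed.
Lemma dprodZ a f j : (a *: f) j = a *: f j. Proof. by rewrite ffunE. Qed.

Let cell := {j : J & 'I_(\dim {:F j})}.
Fact dprod_vect_iso : Vector.axiom #|{: cell}| dprod.
Proof.
pose fr f : 'rV[k]_#|{: cell}| :=
  \row_s coord (vbasis {:F (tag (enum_val s))}) (tagged (enum_val s))
               (f (tag (enum_val s))).
exists fr => [a f g|].
  by apply/rowP=> s; rewrite !mxE dprodD dprodZ linearP.
pose gr (r : 'rV[k]_#|{: cell}|) : dprod :=
  [ffun j => \sum_(i < \dim {:F j})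
    r 0 (enum_rank (Tagged (fun j => 'I_(\dim {:F j})) i : cell))
      *: (vbasis {:F j})`_i : F j].
exists gr => [f|r].
  apply/ffunP=> j; rewrite ffunE [RHS](coord_vbasis (memvf _)).
  by apply: eq_bigr => i _; rewrite mxE enum_rankK.
apply/rowP=> s; rewrite mxE ffunE coord_sum_free ?(basis_free (vbasisP _)) //.
by rewrite -[in RHS](enum_valK s); case: (enum_val s).
Qed.
HB.instance Definition _ :=
  Lmodule_hasFinDim.Build k dprod dprod_vect_iso.
End DependentProduct.

Section Kronecker.
Variables (k : fieldType) (J : finType) (P : J -> vectType k).

(* x : P j placed in position j, and 0 in every other position *)
Definition kron j (x : P j) j' : P j' :=
  if j =P j' is ReflectT e then ecast i (P i) e x else 0.

Lemma kron_id j (x : P j) : kron x j = x.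
Proof. by rewrite /kron; case: eqP => // e; rewrite eq_axiomK. Qed.

Lemma kron_neq j (x : P j) j' : j != j' -> kron x j' = 0.
Proof. by rewrite /kron; case: eqP. Qed.

Lemma big_kron (W : vectType k) (G : forall j, P j -> W) j (x : P j) :
  (forall j, G j 0 = 0) -> \sum_j' G j' (kron x j') = G j x.
Proof.
move=> G0; rewrite (bigD1 j) //= kron_id big1 ?addr0 // => j' nj.
by rewrite kron_neq // eq_sym.
Qed.
End Kronecker.

Record linCat (k : fieldType) := LinCat {
  ob :> Type;
  hom : ob -> ob -> vectType k;
  idm : forall U, hom U U;
  mcomp : forall U V W, hom V W -> hom U V -> hom U W;
  mcomp1l : forall U V (f : hom U V), mcomp (idm V) f = f;
  mcomp1r : forall U V (f : hom U V), mcomp f (idm U) = f;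
  mcompA : forall U V W X (h : hom W X) (g : hom V W) (f : hom U V),
    mcomp h (mcomp g f) = mcomp (mcomp h g) f;
  mcomp_bilinear : forall U V W, bilinear_map (@mcomp U V W)
}.

Arguments hom {k C} U%_ob V%_ob : rename.
Arguments idm {k C} U%_ob : rename.
Arguments mcomp {k C U V W} g%_mor f%_mor : rename.
Notation "g ∘ f" := (mcomp g f) : mor_scope.
Bind Scope ob_scope with ob.
Local Open Scope mor_scope.

(* The associator and the unit isomorphisms are explicit here; they are the   *)
(* isomorphisms that are suppressed in formulas for strict categories.        *)
Record monCat (k : fieldType) := MonCat {
  mon_lin :> linCat k;
  one : mon_lin;
  tens : mon_lin -> mon_lin -> mon_lin
    where "U ⊗ V" := (tens U V) : ob_scope;
  tensm : forall U U' V V' : mon_lin,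
      hom U U' -> hom V V' -> hom (U ⊗ V) (U' ⊗ V')
    where "f ⊗ g" := (tensm f g) : mor_scope;
  tensm1 : forall U V : mon_lin, idm U ⊗ idm V = idm (U ⊗ V);
  tensmM : forall (U U' U2 V V' V2 : mon_lin) (f' : hom U' U2) (f : hom U U')
      (g' : hom V' V2) (g : hom V V'),
    (f' ∘ f) ⊗ (g' ∘ g) = (f' ⊗ g') ∘ (f ⊗ g);
  tensm_bilinear : forall U U' V V', bilinear_map (@tensm U U' V V');
  assoc : forall U V W, hom ((U ⊗ V) ⊗ W) (U ⊗ (V ⊗ W));
  associ : forall U V W, hom (U ⊗ (V ⊗ W)) ((U ⊗ V) ⊗ W);
  assocK : forall U V W, associ U V W ∘ assoc U V W = idm _;
  associK : forall U V W, assoc U V W ∘ associ U V W = idm _;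
  assoc_nat : forall (U U' V V' W W' : mon_lin)
      (f : hom U U') (g : hom V V') (h : hom W W'),
    assoc U' V' W' ∘ ((f ⊗ g) ⊗ h) = (f ⊗ (g ⊗ h)) ∘ assoc U V W;
  lun : forall U, hom (one ⊗ U) U;
  luni : forall U, hom U (one ⊗ U);
  lunK : forall U, luni U ∘ lun U = idm _;
  luniK : forall U, lun U ∘ luni U = idm _;
  lun_nat : forall (U V : mon_lin) (f : hom U V),
    lun V ∘ (idm one ⊗ f) = f ∘ lun U;
  run : forall U, hom (U ⊗ one) U;
  runi : forall U, hom U (U ⊗ one);
  runK : forall U, runi U ∘ run U = idm _;
  runiK : forall U, run U ∘ runi U = idm _;
  run_nat : forall (U V : mon_lin) (f : hom U V),
    run V ∘ (f ⊗ idm one) = f ∘ run U;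
  pentagon : forall U V W X,
    (idm U ⊗ assoc V W X) ∘ assoc U (V ⊗ W)%ob X ∘ (assoc U V W ⊗ idm X)
    = assoc U V (W ⊗ X)%ob ∘ assoc (U ⊗ V)%ob W X;
  triangle : forall U V,
    (idm U ⊗ lun V) ∘ assoc U one V = run U ⊗ idm V
}.

Arguments one {k C} : rename.
Arguments tens {k C} U%_ob V%_ob : rename.
Arguments tensm {k C U U' V V'} f%_mor g%_mor : rename.
Arguments assoc {k C} U%_ob V%_ob W%_ob : rename.
Arguments associ {k C} U%_ob V%_ob W%_ob : rename.
Arguments lun {k C} U%_ob : rename.
Arguments luni {k C} U%_ob : rename.
Arguments run {k C} U%_ob : rename.
Arguments runi {k C} U%_ob : rename.
Notation "U ⊗ V" := (tens U V) : ob_scope.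
Notation "f ⊗ g" := (tensm f g) : mor_scope.

Record ribCat (k : fieldType) := RibCat {
  rib_mon :> monCat k;
  braid : forall U V : rib_mon, hom (U ⊗ V) (V ⊗ U);
  braidi : forall U V : rib_mon, hom (V ⊗ U) (U ⊗ V);
  braidK : forall U V, braidi U V ∘ braid U V = idm _;
  braidiK : forall U V, braid U V ∘ braidi U V = idm _;
  braid_nat : forall (U U' V V' : rib_mon) (f : hom U U') (g : hom V V'),
    braid U' V' ∘ (f ⊗ g) = (g ⊗ f) ∘ braid U V;
  hexagon1 : forall U V W : rib_mon,
    assoc V W U ∘ braid U (V ⊗ W)%ob ∘ assoc U V W
    = (idm V ⊗ braid U W) ∘ assoc V U W ∘ (braid U V ⊗ idm W);
  hexagon2 : forall U V W : rib_mon,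
    associ W U V ∘ braid (U ⊗ V)%ob W ∘ associ U V W
    = (braid U W ⊗ idm V) ∘ associ U W V ∘ (idm U ⊗ braid V W);
  twist : forall U : rib_mon, hom U U;
  twisti : forall U : rib_mon, hom U U;
  twistK : forall U, twisti U ∘ twist U = idm U;
  twistiK : forall U, twist U ∘ twisti U = idm U;
  twist_nat : forall (U V : rib_mon) (f : hom U V),
    twist V ∘ f = f ∘ twist U;
  balancing : forall U V : rib_mon,
    twist (U ⊗ V)%ob = braid V U ∘ braid U V ∘ (twist U ⊗ twist V);
  dual : rib_mon -> rib_mon
    where "U ^∨" := (dual U) : ob_scope;
  ev : forall U : rib_mon, hom (U^∨ ⊗ U) one;
  coev : forall U : rib_mon, hom one (U ⊗ U^∨);
  zigzag1 : forall U : rib_mon,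
    run U ∘ (idm U ⊗ ev U) ∘ assoc U U^∨ U ∘ (coev U ⊗ idm U) ∘ luni U
    = idm U;
  zigzag2 : forall U : rib_mon,
    lun U^∨ ∘ (ev U ⊗ idm U^∨) ∘ associ U^∨ U U^∨
      ∘ (idm U^∨ ⊗ coev U) ∘ runi U^∨
    = idm U^∨;
  twist_dual : forall U : rib_mon,
    (twist U ⊗ idm U^∨) ∘ coev U = (idm U ⊗ twist U^∨) ∘ coev U
}.

Arguments braid {k C} U%_ob V%_ob : rename.
Arguments braidi {k C} U%_ob V%_ob : rename.
Arguments twist {k C} U%_ob : rename.
Arguments twisti {k C} U%_ob : rename.
Arguments dual {k C} U%_ob : rename.
Arguments ev {k C} U%_ob : rename.
Arguments coev {k C} U%_ob : rename.
Notation "U ^∨" := (dual U) : ob_scope.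

(* d̃_U and b̃_U *)
Definition ev' k (C : ribCat k) (U : C) : hom (U ⊗ U^∨) one :=
  ev U ∘ braid U U^∨ ∘ (twist U ⊗ idm U^∨).
Definition coev' k (C : ribCat k) (U : C) : hom one (U^∨ ⊗ U) :=
  (idm U^∨ ⊗ twist U) ∘ braid U U^∨ ∘ coev U.
Arguments ev' {k C} U%_ob.
Arguments coev' {k C} U%_ob.

Section LinTheory.
Variables (k : fieldType) (C : linCat k).
Implicit Types U V W : C.

Definition inverses U V (f : hom U V) (g : hom V U) :=
  g ∘ f = idm U /\ f ∘ g = idm V.

Lemma mcompDl U V W a (g g' : hom V W) (f : hom U V) :
  (a *: g + g')%R ∘ f = (a *: (g ∘ f) + g' ∘ f)%R.
Proof. exact: (mcomp_bilinear U V W).1. Qed.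

Lemma mcompDr U V W a (g : hom V W) (f f' : hom U V) :
  g ∘ (a *: f + f')%R = (a *: (g ∘ f) + g ∘ f')%R.
Proof. exact: (mcomp_bilinear U V W).2. Qed.

Lemma mcomp0l U V W (f : hom U V) : (0 : hom V W) ∘ f = 0.
Proof. by have := mcompDl (-1) 0 (0 : hom V W) f; rewrite scaler0 addr0 scaleN1r addNr. Qed.

Lemma mcomp0r U V W (g : hom V W) : g ∘ (0 : hom U V) = 0.
Proof. by have := mcompDr (-1) g (0 : hom U V) 0; rewrite scaler0 addr0 scaleN1r addNr. Qed.

Lemma mcomp_suml U V W (I : finType) (F : I -> hom V W) (f : hom U V) :
  (\sum_i F i)%R ∘ f = (\sum_i F i ∘ f)%R.
Proof.
elim/big_ind2: _ => [|g h g' h' eg eh|//]; first exact: mcomp0l.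
by have := mcompDl 1 h h' f; rewrite !scale1r eg eh.
Qed.

Lemma mcomp_sumr U V W (I : finType) (g : hom V W) (F : I -> hom U V) :
  g ∘ (\sum_i F i)%R = (\sum_i g ∘ F i)%R.
Proof.
elim/big_ind2: _ => [|f h f' h' ef eh|//]; first exact: mcomp0r.
by have := mcompDr 1 g h h'; rewrite !scale1r ef eh.
Qed.

Lemma inverses_comp U V W (f : hom U V) f' (g : hom V W) g' :
  inverses f f' -> inverses g g' -> inverses (g ∘ f) (f' ∘ g').
Proof.
case=> f1 f2 [g1 g2]; split.
  by rewrite -mcompA (mcompA g') g1 mcomp1l.
by rewrite -mcompA (mcompA f) f2 mcomp1l.
Qed.

Lemma inverses_comp3 U V W X (f : hom U V) f' (g : hom V W) g' (h : hom W X) h' :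
  inverses f f' -> inverses g g' -> inverses h h' ->
  inverses (h ∘ g ∘ f) (f' ∘ g' ∘ h').
Proof.
move=> If Ig Ih; rewrite -[f' ∘ _ ∘ _]mcompA.
by do 2!apply: inverses_comp => //.
Qed.

Lemma comp3K U V W X Y (f : hom U V) (g : hom V W) (h : hom W X)
    (h' : hom X W) (g' : hom W V) (f' : hom V Y) :
  h' ∘ h = idm W -> g' ∘ g = idm V ->
  (f' ∘ g' ∘ h') ∘ (h ∘ g ∘ f) = f' ∘ f.
Proof.
move=> hK gK; rewrite -[h ∘ _ ∘ _]mcompA -[_ ∘ h']mcompA -2!mcompA.
by rewrite (mcompA h') hK mcomp1l (mcompA g') gK mcomp1l.
Qed.

Lemma comp3_0 U V W X W' V' Y (f : hom U V) (g : hom V W) (h : hom W X)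
    (h' : hom X W') (g' : hom W' V') (f' : hom V' Y) :
  h' ∘ h = 0 -> (f' ∘ g' ∘ h') ∘ (h ∘ g ∘ f) = 0.
Proof.
move=> h0; rewrite -[h ∘ _ ∘ _]mcompA -mcompA (mcompA h') h0.
by rewrite mcomp0l mcomp0r.
Qed.

Lemma inverses_uniq U V (f f' : hom U V) g g' :
  inverses f g -> inverses f' g' -> f = f' -> g = g'.
Proof. by case=> gf _ [_ f'g'] e; rewrite -[g]mcomp1r -f'g' -e mcompA gf mcomp1l. Qed.
End LinTheory.

Section MonTheory.
Variables (k : fieldType) (C : monCat k).
Implicit Types U V W : C.

Lemma tensm0l U U' V V' (g : hom V V') : (0 : hom U U') ⊗ g = 0.
Proof.
have := (tensm_bilinear U U' V V').1 g (-1) 0 0.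
by rewrite scaler0 addr0 scaleN1r addNr.
Qed.

Lemma tensm0r U U' V V' (f : hom U U') : f ⊗ (0 : hom V V') = 0.
Proof.
have := (tensm_bilinear U U' V V').2 f (-1) 0 0.
by rewrite scaler0 addr0 scaleN1r addNr.
Qed.

Lemma tensm_suml U U' V V' (I : finType) (F : I -> hom U U') (g : hom V V') :
  (\sum_i F i)%R ⊗ g = (\sum_i F i ⊗ g)%R.
Proof.
elim/big_ind2: _ => [|f h f' h' ef eh|//]; first exact: tensm0l.
by have := (tensm_bilinear U U' V V').1 g 1 h h'; rewrite !scale1r ef eh.
Qed.

Lemma tensm_sumr U U' V V' (I : finType) (f : hom U U') (F : I -> hom V V') :
  f ⊗ (\sum_i F i)%R = (\sum_i f ⊗ F i)%R.
Proof.
elim/big_ind2: _ => [|g h g' h' eg eh|//]; first exact: tensm0r.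
by have := (tensm_bilinear U U' V V').2 f 1 h h'; rewrite !scale1r eg eh.
Qed.

Lemma inverses_tens U U' V V' (f : hom U U') f' (g : hom V V') g' :
  inverses f f' -> inverses g g' -> inverses (f ⊗ g) (f' ⊗ g').
Proof.
by case=> f1 f2 [g1 g2]; split; rewrite -tensmM ?f1 ?f2 ?g1 ?g2 tensm1.
Qed.

Lemma inverses_id U : inverses (idm U) (idm U).
Proof. by split; rewrite mcomp1l. Qed.
Lemma inverses_assoc U V W : inverses (assoc U V W) (associ U V W).
Proof. by split; rewrite ?assocK ?associK. Qed.
Lemma inverses_associ U V W : inverses (associ U V W) (assoc U V W).
Proof. by split; rewrite ?assocK ?associK. Qed.
End MonTheory.

(* C_- : the same monoidal category and duality, inverse braiding and twist *)
Section Reverse.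
Variables (k : fieldType) (C : ribCat k).
Implicit Types U V W : C.

Lemma inverses_braid U V : inverses (braid U V) (braidi U V).
Proof. by split; rewrite ?braidK ?braidiK. Qed.
Lemma inverses_twist U : inverses (twist U) (twisti U).
Proof. by split; rewrite ?twistK ?twistiK. Qed.

Fact rev_nat U U' V V' (f : hom U U') (g : hom V V') :
  braidi V' U' ∘ (f ⊗ g) = (g ⊗ f) ∘ braidi V U.
Proof.
rewrite -[LHS]mcomp1r -(braidiK V U) mcompA -(mcompA (braidi V' U')) -braid_nat.
by rewrite (mcompA (braidi V' U')) braidK mcomp1l.
Qed.

Fact rev_hexagon1 U V W :
  assoc V W U ∘ braidi (V ⊗ W) U ∘ assoc U V W
  = (idm V ⊗ braidi W U) ∘ assoc V U W ∘ (braidi V U ⊗ idm W).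
Proof.
apply: (inverses_uniq _ _ (hexagon2 V W U)); apply: inverses_comp3;
  by [exact: inverses_associ | exact: inverses_braid
     | apply: inverses_tens; [exact: inverses_id | exact: inverses_braid]
     | apply: inverses_tens; [exact: inverses_braid | exact: inverses_id]].
Qed.

Fact rev_hexagon2 U V W :
  associ W U V ∘ braidi W (U ⊗ V) ∘ associ U V W
  = (braidi W U ⊗ idm V) ∘ associ U W V ∘ (idm U ⊗ braidi W V).
Proof.
apply: (inverses_uniq _ _ (hexagon1 W U V)); apply: inverses_comp3;
  by [exact: inverses_assoc | exact: inverses_braid
     | apply: inverses_tens; [exact: inverses_id | exact: inverses_braid]
     | apply: inverses_tens; [exact: inverses_braid | exact: inverses_id]].
Qed.

Fact rev_twist_nat U V (f : hom U V) : twisti V ∘ f = f ∘ twisti U.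
Proof.
rewrite -[LHS]mcomp1r -(twistiK U) mcompA -(mcompA (twisti V)) -twist_nat.
by rewrite (mcompA (twisti V)) twistK mcomp1l.
Qed.

Fact rev_balancing U V :
  twisti (U ⊗ V) = braidi U V ∘ braidi V U ∘ (twisti U ⊗ twisti V).
Proof.
rewrite -mcompA rev_nat mcompA rev_nat.
apply: (inverses_uniq _ _ (balancing U V)); first exact: inverses_twist.
rewrite -[_ ∘ braidi V U]mcompA; apply: inverses_comp.
  by apply: inverses_tens; exact: inverses_twist.
by apply: inverses_comp; exact: inverses_braid.
Qed.

Fact rev_twist_dual U :
  (twisti U ⊗ idm U^∨) ∘ coev U = (idm U ⊗ twisti U^∨) ∘ coev U.
Proof.
have := congr1 (mcomp (twisti U ⊗ twisti U^∨)) (twist_dual U).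
by rewrite !mcompA -!tensmM !twistK !mcomp1r => ->.
Qed.

Definition rev : ribCat k := @RibCat k C
  (fun U V => braidi V U) (fun U V => braid V U)
  (fun U V => braidiK V U) (fun U V => braidK V U) rev_nat
  rev_hexagon1 rev_hexagon2
  (@twisti k C) (@twist k C) (@twistiK k C) (@twistK k C) rev_twist_nat
  rev_balancing (@dual k C) (@ev k C) (@coev k C)
  (@zigzag1 k C) (@zigzag2 k C) rev_twist_dual.
End Reverse.

(* The category of pairs V × W, with Hom(V × W, V' × W') =                    *)
(* Hom(V, V') ⊗ Hom(W, W') and componentwise structure.                       *)
Section Pairs.
Variables (k : fieldType) (C D : ribCat k).
Local Notation pob := (C * D)%type.
Implicit Types U V W X : pob.

Definition pair_hom U V : vectType k := tensor (hom U.1 V.1) (hom U.2 V.2).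

Definition pair_comp U V W : pair_hom V W -> pair_hom U V -> pair_hom U W :=
  tmap2 (@mcomp k C U.1 V.1 W.1) (@mcomp k D U.2 V.2 W.2).

Lemma pair_comp_pure U V W (f : hom V.1 W.1) (g : hom V.2 W.2)
    (f' : hom U.1 V.1) (g' : hom U.2 V.2) :
  @pair_comp U V W (pure f g) (pure f' g') = pure (f ∘ f') (g ∘ g').
Proof. by rewrite /pair_comp tmap2_pure //; exact: mcomp_bilinear. Qed.

Lemma pair_comp_bilinear U V W : bilinear_map (@pair_comp U V W).
Proof. by apply: tmap2_bilinear; exact: mcomp_bilinear. Qed.

Let cDl U V W a s s' t :
  @pair_comp U V W (a *: s + s')%R t
  = (a *: pair_comp s t + pair_comp s' t)%R.
Proof. exact: (pair_comp_bilinear U V W).1. Qed.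
Let cDr U V W a s t t' :
  @pair_comp U V W s (a *: t + t')%R
  = (a *: pair_comp s t + pair_comp s t')%R.
Proof. exact: (pair_comp_bilinear U V W).2. Qed.

Definition pair_id U : pair_hom U U := pure (idm U.1) (idm U.2).

Fact pair_comp1l U V (f : pair_hom U V) : pair_comp (pair_id V) f = f.
Proof.
elim/tensor_ind: f => [a s t es et|f g]; first by rewrite cDr es et.
by rewrite pair_comp_pure !mcomp1l.
Qed.

Fact pair_comp1r U V (f : pair_hom U V) : pair_comp f (pair_id U) = f.
Proof.
elim/tensor_ind: f => [a s t es et|f g]; first by rewrite cDl es et.
by rewrite pair_comp_pure !mcomp1r.
Qed.

Fact pair_compA U V W X (h : pair_hom W X) (g : pair_hom V W)
    (f : pair_hom U V) :
  pair_comp h (pair_comp g f) = pair_comp (pair_comp h g) f.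
Proof.
elim/tensor_ind: h => [a s t es et|h1 h2]; first by rewrite !cDl es et.
elim/tensor_ind: g => [a s t es et|g1 g2]; first by rewrite cDl !cDr cDl es et.
elim/tensor_ind: f => [a s t es et|f1 f2]; first by rewrite !cDr es et.
by rewrite !pair_comp_pure !mcompA.
Qed.

Definition pair_lin : linCat k :=
  LinCat pair_comp1l pair_comp1r pair_compA pair_comp_bilinear.

Definition pair_one : pob := (one, one).
Definition pair_tens U V : pob := (U.1 ⊗ V.1, U.2 ⊗ V.2)%ob.

Definition pair_tensm U U' V V' :
    pair_hom U U' -> pair_hom V V' -> pair_hom (pair_tens U V) (pair_tens U' V') :=
  tmap2 (@tensm k C U.1 U'.1 V.1 V'.1) (@tensm k D U.2 U'.2 V.2 V'.2).

Lemma pair_tensm_pure U U' V V' (f : hom U.1 U'.1) (g : hom U.2 U'.2)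
    (f' : hom V.1 V'.1) (g' : hom V.2 V'.2) :
  @pair_tensm U U' V V' (pure f g) (pure f' g') = pure (f ⊗ f') (g ⊗ g').
Proof. by rewrite /pair_tensm tmap2_pure //; exact: tensm_bilinear. Qed.

Lemma pair_tensm_bilinear U U' V V' : bilinear_map (@pair_tensm U U' V V').
Proof. by apply: tmap2_bilinear; exact: tensm_bilinear. Qed.

Let tDl U U' V V' a s s' t :
  @pair_tensm U U' V V' (a *: s + s')%R t
  = (a *: pair_tensm s t + pair_tensm s' t)%R.
Proof. exact: (pair_tensm_bilinear U U' V V').1. Qed.
Let tDr U U' V V' a s t t' :
  @pair_tensm U U' V V' s (a *: t + t')%R
  = (a *: pair_tensm s t + pair_tensm s t')%R.
Proof. exact: (pair_tensm_bilinear U U' V V').2. Qed.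

Let ppE := (pair_comp_pure, pair_tensm_pure).

Fact pair_tensm1 U V :
  pair_tensm (pair_id U) (pair_id V) = pair_id (pair_tens U V).
Proof. by rewrite ppE !tensm1. Qed.

Fact pair_tensmM U U' U2 V V' V2 (f' : pair_hom U' U2) (f : pair_hom U U')
    (g' : pair_hom V' V2) (g : pair_hom V V') :
  pair_tensm (pair_comp f' f) (pair_comp g' g)
  = pair_comp (pair_tensm f' g') (pair_tensm f g).
Proof.
elim/tensor_ind: f' => [a s t es et|f1' f2'].
  by rewrite cDl !tDl cDl es et.
elim/tensor_ind: f => [a s t es et|f1 f2].
  by rewrite cDr !tDl cDr es et.
elim/tensor_ind: g' => [a s t es et|g1' g2'].
  by rewrite cDl !tDr cDl es et.
elim/tensor_ind: g => [a s t es et|g1 g2].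
  by rewrite cDr !tDr cDr es et.
by rewrite !ppE !tensmM.
Qed.

Definition pair_assoc U V W :
    pair_hom (pair_tens (pair_tens U V) W) (pair_tens U (pair_tens V W)) :=
  pure (assoc U.1 V.1 W.1) (assoc U.2 V.2 W.2).
Definition pair_associ U V W :
    pair_hom (pair_tens U (pair_tens V W)) (pair_tens (pair_tens U V) W) :=
  pure (associ U.1 V.1 W.1) (associ U.2 V.2 W.2).
Definition pair_lun U : pair_hom (pair_tens pair_one U) U :=
  pure (lun U.1) (lun U.2).
Definition pair_luni U : pair_hom U (pair_tens pair_one U) :=
  pure (luni U.1) (luni U.2).
Definition pair_run U : pair_hom (pair_tens U pair_one) U :=
  pure (run U.1) (run U.2).
Definition pair_runi U : pair_hom U (pair_tens U pair_one) :=
  pure (runi U.1) (runi U.2).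

Fact pair_assocK U V W :
  pair_comp (pair_associ U V W) (pair_assoc U V W) = pair_id _.
Proof. by rewrite ppE !assocK. Qed.
Fact pair_associK U V W :
  pair_comp (pair_assoc U V W) (pair_associ U V W) = pair_id _.
Proof. by rewrite ppE !associK. Qed.
Fact pair_assoc_nat U U' V V' W W'
    (f : pair_hom U U') (g : pair_hom V V') (h : pair_hom W W') :
  pair_comp (pair_assoc U' V' W') (pair_tensm (pair_tensm f g) h)
  = pair_comp (pair_tensm f (pair_tensm g h)) (pair_assoc U V W).
Proof.
elim/tensor_ind: f => [a s t es et|f1 f2].
  by rewrite !tDl cDl cDr es et.
elim/tensor_ind: g => [a s t es et|g1 g2].
  by rewrite !(tDl, tDr) cDl cDr es et.
elim/tensor_ind: h => [a s t es et|h1 h2].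
  by rewrite !tDr cDl cDr es et.
by rewrite !ppE !assoc_nat.
Qed.
Fact pair_lunK U : pair_comp (pair_luni U) (pair_lun U) = pair_id _.
Proof. by rewrite ppE !lunK. Qed.
Fact pair_luniK U : pair_comp (pair_lun U) (pair_luni U) = pair_id _.
Proof. by rewrite ppE !luniK. Qed.
Fact pair_lun_nat U V (f : pair_hom U V) :
  pair_comp (pair_lun V) (pair_tensm (pair_id pair_one) f)
  = pair_comp f (pair_lun U).
Proof.
elim/tensor_ind: f => [a s t es et|f1 f2]; first by rewrite tDr cDr cDl es et.
by rewrite !ppE !lun_nat.
Qed.
Fact pair_runK U : pair_comp (pair_runi U) (pair_run U) = pair_id _.
Proof. by rewrite ppE !runK. Qed.
Fact pair_runiK U : pair_comp (pair_run U) (pair_runi U) = pair_id _.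
Proof. by rewrite ppE !runiK. Qed.
Fact pair_run_nat U V (f : pair_hom U V) :
  pair_comp (pair_run V) (pair_tensm f (pair_id pair_one))
  = pair_comp f (pair_run U).
Proof.
elim/tensor_ind: f => [a s t es et|f1 f2]; first by rewrite tDl cDr cDl es et.
by rewrite !ppE !run_nat.
Qed.
Fact pair_pentagon U V W X :
  pair_comp (pair_comp (pair_tensm (pair_id U) (pair_assoc V W X))
                       (pair_assoc U (pair_tens V W) X))
            (pair_tensm (pair_assoc U V W) (pair_id X))
  = pair_comp (pair_assoc U V (pair_tens W X))
              (pair_assoc (pair_tens U V) W X).
Proof. by rewrite !ppE !pentagon. Qed.
Fact pair_triangle U V :
  pair_comp (pair_tensm (pair_id U) (pair_lun V)) (pair_assoc U pair_one V)
  = pair_tensm (pair_run U) (pair_id V).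
Proof. by rewrite !ppE !triangle. Qed.

Definition pair_mon : monCat k := @MonCat k pair_lin
  pair_one pair_tens pair_tensm pair_tensm1 pair_tensmM pair_tensm_bilinear
  pair_assoc pair_associ pair_assocK pair_associK pair_assoc_nat
  pair_lun pair_luni pair_lunK pair_luniK pair_lun_nat
  pair_run pair_runi pair_runK pair_runiK pair_run_nat
  pair_pentagon pair_triangle.

Definition pair_braid U V : pair_hom (pair_tens U V) (pair_tens V U) :=
  pure (braid U.1 V.1) (braid U.2 V.2).
Definition pair_braidi U V : pair_hom (pair_tens V U) (pair_tens U V) :=
  pure (braidi U.1 V.1) (braidi U.2 V.2).
Definition pair_twist U : pair_hom U U := pure (twist U.1) (twist U.2).
Definition pair_twisti U : pair_hom U U := pure (twisti U.1) (twisti U.2).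
Definition pair_dual U : pob := (U.1^∨, U.2^∨)%ob.
Definition pair_ev U : pair_hom (pair_tens (pair_dual U) U) pair_one :=
  pure (ev U.1) (ev U.2).
Definition pair_coev U : pair_hom pair_one (pair_tens U (pair_dual U)) :=
  pure (coev U.1) (coev U.2).

Fact pair_braidK U V : pair_comp (pair_braidi U V) (pair_braid U V) = pair_id _.
Proof. by rewrite ppE !braidK. Qed.
Fact pair_braidiK U V : pair_comp (pair_braid U V) (pair_braidi U V) = pair_id _.
Proof. by rewrite ppE !braidiK. Qed.
Fact pair_braid_nat U U' V V' (f : pair_hom U U') (g : pair_hom V V') :
  pair_comp (pair_braid U' V') (pair_tensm f g)
  = pair_comp (pair_tensm g f) (pair_braid U V).
Proof.
elim/tensor_ind: f => [a s t es et|f1 f2].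
  by rewrite tDl tDr cDl cDr es et.
elim/tensor_ind: g => [a s t es et|g1 g2].
  by rewrite tDl tDr cDl cDr es et.
by rewrite !ppE !braid_nat.
Qed.
Fact pair_hexagon1 U V W :
  pair_comp (pair_comp (pair_assoc V W U) (pair_braid U (pair_tens V W)))
            (pair_assoc U V W)
  = pair_comp (pair_comp (pair_tensm (pair_id V) (pair_braid U W))
                         (pair_assoc V U W))
              (pair_tensm (pair_braid U V) (pair_id W)).
Proof. by rewrite !ppE !hexagon1. Qed.
Fact pair_hexagon2 U V W :
  pair_comp (pair_comp (pair_associ W U V) (pair_braid (pair_tens U V) W))
            (pair_associ U V W)
  = pair_comp (pair_comp (pair_tensm (pair_braid U W) (pair_id V))
                         (pair_associ U W V))
              (pair_tensm (pair_id U) (pair_braid V W)).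
Proof. by rewrite !ppE !hexagon2. Qed.
Fact pair_twistK U : pair_comp (pair_twisti U) (pair_twist U) = pair_id U.
Proof. by rewrite ppE !twistK. Qed.
Fact pair_twistiK U : pair_comp (pair_twist U) (pair_twisti U) = pair_id U.
Proof. by rewrite ppE !twistiK. Qed.
Fact pair_twist_nat U V (f : pair_hom U V) :
  pair_comp (pair_twist V) f = pair_comp f (pair_twist U).
Proof.
elim/tensor_ind: f => [a s t es et|f1 f2]; first by rewrite cDl cDr es et.
by rewrite !ppE !twist_nat.
Qed.
Fact pair_balancing U V :
  pair_twist (pair_tens U V)
  = pair_comp (pair_comp (pair_braid V U) (pair_braid U V))
              (pair_tensm (pair_twist U) (pair_twist V)).
Proof. by rewrite !ppE -!balancing. Qed.
Fact pair_zigzag1 U :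
  pair_comp (pair_comp (pair_comp (pair_comp (pair_run U)
    (pair_tensm (pair_id U) (pair_ev U))) (pair_assoc U (pair_dual U) U))
    (pair_tensm (pair_coev U) (pair_id U))) (pair_luni U)
  = pair_id U.
Proof. by rewrite !ppE !zigzag1. Qed.
Fact pair_zigzag2 U :
  pair_comp (pair_comp (pair_comp (pair_comp (pair_lun (pair_dual U))
    (pair_tensm (pair_ev U) (pair_id (pair_dual U))))
    (pair_associ (pair_dual U) U (pair_dual U)))
    (pair_tensm (pair_id (pair_dual U)) (pair_coev U)))
    (pair_runi (pair_dual U))
  = pair_id (pair_dual U).
Proof. by rewrite !ppE !zigzag2. Qed.
Fact pair_twist_dual U :
  pair_comp (pair_tensm (pair_twist U) (pair_id (pair_dual U))) (pair_coev U)
  = pair_comp (pair_tensm (pair_id U) (pair_twist (pair_dual U))) (pair_coev U).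
Proof. by rewrite !ppE !twist_dual. Qed.

Definition pairs : ribCat k := @RibCat k pair_mon
  pair_braid pair_braidi pair_braidK pair_braidiK pair_braid_nat
  pair_hexagon1 pair_hexagon2
  pair_twist pair_twisti pair_twistK pair_twistiK pair_twist_nat
  pair_balancing pair_dual pair_ev pair_coev
  pair_zigzag1 pair_zigzag2 pair_twist_dual.
End Pairs.

(* The category of formal finite direct sums of objects of a ribbon category, *)
(* with matrices of morphisms, F (j, k) being the component from the j-th     *)
(* summand of the source to the k-th summand of the target.                   *)
Record family (T : Type) := Family { fidx : finType; fob :> fidx -> T }.

Section Kron2.
Variables (k : fieldType) (J : finType) (P Q : J -> vectType k).

Lemma kron_map (L : forall j, P j -> Q j) j (x : P j) j' :
  L j' 0 = 0 -> L j' (kron x j') = kron (L j x) j'.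
Proof.
have [<-|nj] := eqVneq j j'; first by rewrite !kron_id.
by rewrite !kron_neq.
Qed.
End Kron2.

Section Sums.
Variables (k : fieldType) (E : ribCat k).
Local Notation sob := (family E).
Implicit Types X Y Z : sob.

Definition sum_hom X Y : vectType k :=
  dprod (fun p : fidx X * fidx Y => hom (X p.1) (Y p.2)).

Definition sum_of X Y (f : forall j l, hom (X j) (Y l)) : sum_hom X Y :=
  [ffun p : fidx X * fidx Y => f p.1 p.2].
Definition entry X Y (F : sum_hom X Y) j l : hom (X j) (Y l) := F (j, l).

Lemma entryE X Y (f : forall j l, hom (X j) (Y l)) j l :
  entry (sum_of f) j l = f j l.
Proof. by rewrite /entry ffunE. Qed.

Lemma entryP X Y (F G : sum_hom X Y) :
  (forall j l, entry F j l = entry G j l) -> F = G.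
Proof. by move=> eFG; apply/ffunP=> -[j l]; exact: eFG. Qed.

Lemma entry_lin X Y a (F G : sum_hom X Y) j l :
  entry (a *: F + G)%R j l = (a *: entry F j l + entry G j l)%R.
Proof. by rewrite /entry dprodD dprodZ. Qed.

Definition sum_comp X Y Z (G : sum_hom Y Z) (F : sum_hom X Y) : sum_hom X Z :=
  sum_of (fun j l => \sum_i entry G i l ∘ entry F j i)%R.

(* The morphism sending the j-th summand to the (s j)-th one via h j. *)
Definition along X Y (s : fidx X -> fidx Y) (h : forall j, hom (X j) (Y (s j))) :
    sum_hom X Y :=
  sum_of (fun j => kron (P := fun l => hom (X j) (Y l)) (h j)).

Definition sum_id X : sum_hom X X := along (fun j => idm (X j)).

Lemma comp_along X Y Z (G : sum_hom Y Z) s (h : forall j, hom (X j) (Y (s j))) j l :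
  entry (sum_comp G (along h)) j l = entry G (s j) l ∘ h j.
Proof.
rewrite entryE; under eq_bigr do rewrite entryE.
rewrite (big_kron (P := fun l => hom (X j) (Y l)) (h j)
  (G := fun i x => entry G i l ∘ x)) // => i; exact: mcomp0r.
Qed.

Lemma along_comp X Y Z s (h : forall j, hom (Y j) (Z (s j))) (F : sum_hom X Y) j l :
  injective s -> entry (sum_comp (along h) F) j (s l) = h l ∘ entry F j l.
Proof.
move=> s_inj; rewrite entryE (bigD1 l) //= entryE kron_id big1 ?addr0 //.
move=> i nil; rewrite entryE kron_neq ?mcomp0l //.
by apply: contraNneq nil => /= /s_inj->.
Qed.

Lemma along_along X Y Z s (h : forall j, hom (X j) (Y (s j)))
    s' (h' : forall j, hom (Y j) (Z (s' j))) :
  sum_comp (along h') (along h) =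
  along (s := fun j => s' (s j)) (fun j => h' (s j) ∘ h j).
Proof.
apply/entryP=> j l; rewrite comp_along !entryE.
refine (kron_map (P := fun l => hom (Y (s j)) (Z l))
  (Q := fun l => hom (X j) (Z l)) (L := fun _ x => x ∘ h j) _ _).
exact: mcomp0l.
Qed.

Lemma along_eq X Y s (h h' : forall j, hom (X j) (Y (s j))) :
  (forall j, h j = h' j) -> along h = along h'.
Proof. by move=> eh; apply/entryP=> j l; rewrite !entryE eh. Qed.

Fact sum_comp1l X Y (F : sum_hom X Y) : sum_comp (sum_id Y) F = F.
Proof.
apply/entryP=> j l.
by rewrite (along_comp (fun j => idm (Y j))) ?mcomp1l.
Qed.

Fact sum_comp1r X Y (F : sum_hom X Y) : sum_comp F (sum_id X) = F.
Proof. by apply/entryP=> j l; rewrite comp_along mcomp1r. Qed.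

Fact sum_compA X Y Z W (H : sum_hom Z W) (G : sum_hom Y Z) (F : sum_hom X Y) :
  sum_comp H (sum_comp G F) = sum_comp (sum_comp H G) F.
Proof.
apply/entryP=> j l; rewrite !entryE.
under eq_bigr do rewrite entryE mcomp_sumr.
rewrite exchange_big; apply: eq_bigr => i _ /=.
by rewrite entryE mcomp_suml; apply: eq_bigr => m _; rewrite mcompA.
Qed.

Fact sum_comp_bilinear X Y Z : bilinear_map (@sum_comp X Y Z).
Proof.
split=> [F a G G'|G a F F']; apply/entryP=> j l; rewrite entry_lin !entryE.
  rewrite scaler_sumr -big_split; apply: eq_bigr => i _.
  by rewrite entry_lin mcompDl.
rewrite scaler_sumr -big_split; apply: eq_bigr => i _.
by rewrite entry_lin mcompDr.
Qed.

Definition sum_lin : linCat k :=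
  LinCat sum_comp1l sum_comp1r sum_compA sum_comp_bilinear.

Definition sum_one : sob := Family (fun _ : unit => one : E).
Definition sum_tens X Y : sob :=
  Family (fun p : (fidx X * fidx Y)%type => X p.1 ⊗ Y p.2)%ob.

Definition sum_tensm X X' Y Y' (F : sum_hom X X') (G : sum_hom Y Y') :
    sum_hom (sum_tens X Y) (sum_tens X' Y') :=
  @sum_of (sum_tens X Y) (sum_tens X' Y')
    (fun p q => entry F p.1 q.1 ⊗ entry G p.2 q.2).

Lemma kron_tens X X' Y Y' j j' l l'
    (f : hom (X j) (X' j')) (g : hom (Y l) (Y' l')) i i' :
  kron (P := fun j' => hom (X j) (X' j')) f i
    ⊗ kron (P := fun l' => hom (Y l) (Y' l')) g i'
  = kron (P := fun p : fidx (sum_tens X' Y') => hom (X j ⊗ Y l) (X' p.1 ⊗ Y' p.2))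
      (j := (j', l')) (f ⊗ g) (i, i').
Proof.
have [<-|nj] := eqVneq j' i; last first.
  by rewrite kron_neq // tensm0l kron_neq // xpair_eqE (negPf nj).
have [<-|nl] := eqVneq l' i'; last first.
  by rewrite (kron_neq _ nl) tensm0r kron_neq // xpair_eqE (negPf nl) andbF.
by rewrite !kron_id.
Qed.

Lemma along_tens X X' Y Y' s s' (h : forall j, hom (X j) (X' (s j)))
    (h' : forall j, hom (Y j) (Y' (s' j))) :
  sum_tensm (along h) (along h') =
  @along (sum_tens X Y) (sum_tens X' Y') (fun p => (s p.1, s' p.2))
    (fun p => h p.1 ⊗ h' p.2).
Proof.
by apply/entryP=> -[a b] [c d]; rewrite !entryE /= kron_tens.
Qed.

Fact sum_tensm1 X Y : sum_tensm (sum_id X) (sum_id Y) = sum_id (sum_tens X Y).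
Proof.
rewrite along_tens; apply/entryP=> -[a b] [c d].
by rewrite !entryE /= tensm1.
Qed.

Fact sum_tensmM X X' X2 Y Y' Y2 (F' : sum_hom X' X2) (F : sum_hom X X')
    (G' : sum_hom Y' Y2) (G : sum_hom Y Y') :
  sum_tensm (sum_comp F' F) (sum_comp G' G)
  = sum_comp (sum_tensm F' G') (sum_tensm F G).
Proof.
apply/entryP=> -[a b] [c d]; rewrite !entryE /=.
rewrite tensm_suml. rewrite (eq_bigr _ (fun i _ => tensm_sumr _ _)).
rewrite pair_bigA; apply: eq_bigr => -[i j] _ /=.
by rewrite !entryE tensmM.
Qed.

Fact sum_tensm_bilinear X X' Y Y' : bilinear_map (@sum_tensm X X' Y Y').
Proof.
split=> [G a F F'|F a G G']; apply/entryP=> j l; rewrite entry_lin !entryE.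
  by rewrite entry_lin (tensm_bilinear _ _ _ _).1.
by rewrite entry_lin (tensm_bilinear _ _ _ _).2.
Qed.

Definition sum_assoc X Y Z :
    sum_hom (sum_tens (sum_tens X Y) Z) (sum_tens X (sum_tens Y Z)) :=
  along (Y := sum_tens X (sum_tens Y Z)) (X := sum_tens (sum_tens X Y) Z)
    (s := fun p => (p.1.1, (p.1.2, p.2)))
    (fun p => assoc (X p.1.1) (Y p.1.2) (Z p.2)).
Definition sum_associ X Y Z :
    sum_hom (sum_tens X (sum_tens Y Z)) (sum_tens (sum_tens X Y) Z) :=
  along (X := sum_tens X (sum_tens Y Z)) (Y := sum_tens (sum_tens X Y) Z)
    (s := fun p => ((p.1, p.2.1), p.2.2))
    (fun p => associ (X p.1) (Y p.2.1) (Z p.2.2)).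
Definition sum_lun X : sum_hom (sum_tens sum_one X) X :=
  along (X := sum_tens sum_one X) (s := snd) (fun p => lun (X p.2)).
Definition sum_luni X : sum_hom X (sum_tens sum_one X) :=
  along (Y := sum_tens sum_one X) (s := pair tt) (fun j => luni (X j)).
Definition sum_run X : sum_hom (sum_tens X sum_one) X :=
  along (X := sum_tens X sum_one) (s := fst) (fun p => run (X p.1)).
Definition sum_runi X : sum_hom X (sum_tens X sum_one) :=
  along (Y := sum_tens X sum_one) (s := fun j => (j, tt)) (fun j => runi (X j)).

Let snd_inj X : injective (@snd (fidx sum_one) (fidx X)).
Proof. by move=> [[] a] [[] b] /= ->. Qed.
Let fst_inj X : injective (@fst (fidx X) (fidx sum_one)).
Proof. by move=> [a []] [b []] /= ->. Qed.

Fact sum_assocK X Y Z : sum_comp (sum_associ X Y Z) (sum_assoc X Y Z) = sum_id _.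
Proof.
by rewrite along_along; apply/entryP=> -[[a b] c] d; rewrite !entryE /= assocK.
Qed.
Fact sum_associK X Y Z : sum_comp (sum_assoc X Y Z) (sum_associ X Y Z) = sum_id _.
Proof.
by rewrite along_along; apply/entryP=> -[a [b c]] d; rewrite !entryE /= associK.
Qed.
Fact sum_assoc_nat X X' Y Y' Z Z'
    (F : sum_hom X X') (G : sum_hom Y Y') (H : sum_hom Z Z') :
  sum_comp (sum_assoc X' Y' Z') (sum_tensm (sum_tensm F G) H)
  = sum_comp (sum_tensm F (sum_tensm G H)) (sum_assoc X Y Z).
Proof.
apply/entryP=> -[[a b] c] [a' [b' c']]; rewrite comp_along.
rewrite (along_comp (Y := sum_tens (sum_tens X' Y') Z')
  (Z := sum_tens X' (sum_tens Y' Z')) (s := fun p => (p.1.1, (p.1.2, p.2)))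
  (fun p => assoc (X' p.1.1) (Y' p.1.2) (Z' p.2)) _ _ (a', b', c')).
  by rewrite !entryE /= assoc_nat.
by move=> [[u v] w] [[u' v'] w'] /= [-> -> ->].
Qed.
Fact sum_lunK X : sum_comp (sum_luni X) (sum_lun X) = sum_id _.
Proof.
by rewrite along_along; apply/entryP=> -[[] a] b; rewrite !entryE /= lunK.
Qed.
Fact sum_luniK X : sum_comp (sum_lun X) (sum_luni X) = sum_id _.
Proof. by rewrite along_along; apply: along_eq => j; rewrite luniK. Qed.
Fact sum_lun_nat X Y (F : sum_hom X Y) :
  sum_comp (sum_lun Y) (sum_tensm (sum_id sum_one) F) = sum_comp F (sum_lun X).
Proof.
apply/entryP=> -[[] a] b; rewrite comp_along.
rewrite (along_comp (Y := sum_tens sum_one Y) (Z := Y) (s := snd)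
  (fun p => lun (Y p.2)) _ _ (tt, b)); last exact: snd_inj.
by rewrite !entryE /= kron_id lun_nat.
Qed.
Fact sum_runK X : sum_comp (sum_runi X) (sum_run X) = sum_id _.
Proof.
by rewrite along_along; apply/entryP=> -[a []] b; rewrite !entryE /= runK.
Qed.
Fact sum_runiK X : sum_comp (sum_run X) (sum_runi X) = sum_id _.
Proof. by rewrite along_along; apply: along_eq => j; rewrite runiK. Qed.
Fact sum_run_nat X Y (F : sum_hom X Y) :
  sum_comp (sum_run Y) (sum_tensm F (sum_id sum_one)) = sum_comp F (sum_run X).
Proof.
apply/entryP=> -[a []] b; rewrite comp_along.
rewrite (along_comp (Y := sum_tens Y sum_one) (Z := Y) (s := fst)
  (fun p => run (Y p.1)) _ _ (b, tt)); last exact: fst_inj.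
by rewrite !entryE /= kron_id run_nat.
Qed.
Fact sum_pentagon X Y Z W :
  sum_comp (sum_comp (sum_tensm (sum_id X) (sum_assoc Y Z W))
                     (sum_assoc X (sum_tens Y Z) W))
           (sum_tensm (sum_assoc X Y Z) (sum_id W))
  = sum_comp (sum_assoc X Y (sum_tens Z W)) (sum_assoc (sum_tens X Y) Z W).
Proof.
rewrite !along_tens !along_along; apply/entryP=> -[[[a b] c] d] e.
by rewrite !entryE /= pentagon.
Qed.
Fact sum_triangle X Y :
  sum_comp (sum_tensm (sum_id X) (sum_lun Y)) (sum_assoc X sum_one Y)
  = sum_tensm (sum_run X) (sum_id Y).
Proof.
rewrite !along_tens !along_along; apply/entryP=> -[[a []] b] c.
by rewrite !entryE /= triangle.
Qed.

Definition sum_mon : monCat k := @MonCat k sum_lin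
  sum_one sum_tens sum_tensm sum_tensm1 sum_tensmM sum_tensm_bilinear
  sum_assoc sum_associ sum_assocK sum_associK sum_assoc_nat
  sum_lun sum_luni sum_lunK sum_luniK sum_lun_nat
  sum_run sum_runi sum_runK sum_runiK sum_run_nat
  sum_pentagon sum_triangle.

Definition sum_braid X Y : sum_hom (sum_tens X Y) (sum_tens Y X) :=
  along (X := sum_tens X Y) (Y := sum_tens Y X) (s := fun p => (p.2, p.1))
    (fun p => braid (X p.1) (Y p.2)).
Definition sum_braidi X Y : sum_hom (sum_tens Y X) (sum_tens X Y) :=
  along (X := sum_tens Y X) (Y := sum_tens X Y) (s := fun p => (p.2, p.1))
    (fun p => braidi (X p.2) (Y p.1)).
Definition sum_twist X : sum_hom X X := along (fun j => twist (X j)).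
Definition sum_twisti X : sum_hom X X := along (fun j => twisti (X j)).
Definition sum_dual X : sob := Family (fun j => (X j)^∨)%ob.
Definition sum_ev X : sum_hom (sum_tens (sum_dual X) X) sum_one :=
  @sum_of (sum_tens (sum_dual X) X) sum_one
    (fun p _ => kron (P := fun l => hom ((X p.1)^∨ ⊗ X l) one) (ev (X p.1)) p.2).
Definition sum_coev X : sum_hom sum_one (sum_tens X (sum_dual X)) :=
  @sum_of sum_one (sum_tens X (sum_dual X))
    (fun _ p => kron (P := fun l => hom one (X p.1 ⊗ (X l)^∨)) (coev (X p.1)) p.2).

Fact sum_braidK X Y : sum_comp (sum_braidi X Y) (sum_braid X Y) = sum_id _.
Proof.
by rewrite along_along; apply/entryP=> -[a b] c; rewrite !entryE /= braidK.
Qed.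
Fact sum_braidiK X Y : sum_comp (sum_braid X Y) (sum_braidi X Y) = sum_id _.
Proof.
by rewrite along_along; apply/entryP=> -[a b] c; rewrite !entryE /= braidiK.
Qed.
Fact sum_braid_nat X X' Y Y' (F : sum_hom X X') (G : sum_hom Y Y') :
  sum_comp (sum_braid X' Y') (sum_tensm F G)
  = sum_comp (sum_tensm G F) (sum_braid X Y).
Proof.
apply/entryP=> -[a b] [d c]; rewrite comp_along.
rewrite (along_comp (Y := sum_tens X' Y') (Z := sum_tens Y' X')
  (s := fun p => (p.2, p.1)) (fun p => braid (X' p.1) (Y' p.2)) _ _ (c, d)).
  by rewrite !entryE /= braid_nat.
by move=> [u v] [u' v'] /= [-> ->].
Qed.
Fact sum_hexagon1 X Y Z :
  sum_comp (sum_comp (sum_assoc Y Z X) (sum_braid X (sum_tens Y Z)))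
           (sum_assoc X Y Z)
  = sum_comp (sum_comp (sum_tensm (sum_id Y) (sum_braid X Z)) (sum_assoc Y X Z))
             (sum_tensm (sum_braid X Y) (sum_id Z)).
Proof.
rewrite !along_tens !along_along; apply/entryP=> -[[a b] c] d.
by rewrite !entryE /= hexagon1.
Qed.
Fact sum_hexagon2 X Y Z :
  sum_comp (sum_comp (sum_associ Z X Y) (sum_braid (sum_tens X Y) Z))
           (sum_associ X Y Z)
  = sum_comp (sum_comp (sum_tensm (sum_braid X Z) (sum_id Y)) (sum_associ X Z Y))
             (sum_tensm (sum_id X) (sum_braid Y Z)).
Proof.
rewrite !along_tens !along_along; apply/entryP=> -[a [b c]] d.
by rewrite !entryE /= hexagon2.
Qed.
Fact sum_twistK X : sum_comp (sum_twisti X) (sum_twist X) = sum_id X.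
Proof. by rewrite along_along; apply: along_eq => j; rewrite twistK. Qed.
Fact sum_twistiK X : sum_comp (sum_twist X) (sum_twisti X) = sum_id X.
Proof. by rewrite along_along; apply: along_eq => j; rewrite twistiK. Qed.
Fact sum_twist_nat X Y (F : sum_hom X Y) :
  sum_comp (sum_twist Y) F = sum_comp F (sum_twist X).
Proof.
apply/entryP=> a b; rewrite comp_along.
by rewrite (along_comp (fun j => twist (Y j))) ?twist_nat.
Qed.
Fact sum_balancing X Y :
  sum_twist (sum_tens X Y)
  = sum_comp (sum_comp (sum_braid Y X) (sum_braid X Y))
             (sum_tensm (sum_twist X) (sum_twist Y)).
Proof.
rewrite !along_tens !along_along; apply/entryP=> -[a b] c.
by rewrite !entryE /= balancing.
Qed.

Fact sum_zigzag1 X :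
  sum_comp (sum_comp (sum_comp (sum_comp (sum_run X)
    (sum_tensm (sum_id X) (sum_ev X))) (sum_assoc X (sum_dual X) X))
    (sum_tensm (sum_coev X) (sum_id X))) (sum_luni X)
  = sum_id X.
Proof.
apply/entryP=> j j'; rewrite comp_along entryE.
have M a b c : entry (sum_comp (sum_comp (sum_run X)
      (sum_tensm (sum_id X) (sum_ev X))) (sum_assoc X (sum_dual X) X)) (a, b, c) j'
    = run (X j') ∘ (kron (P := fun l => hom (X a) (X l)) (idm (X a)) j'
        ⊗ kron (P := fun l => hom ((X b)^∨ ⊗ X l) one) (ev (X b)) c)
      ∘ assoc (X a) (X b)^∨ (X c).
  rewrite comp_along (along_comp (Y := sum_tens X sum_one) (Z := X) (s := fst)
    (fun p => run (X p.1)) _ _ (j', tt)); last exact: fst_inj.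
  by rewrite !entryE.
rewrite (bigD1 (j, j, j)) //= big1 => [|[[a b] c] nj].
  rewrite addr0 M !entryE /= !kron_id.
  have [<-|nj] := eqVneq j j'; first by rewrite !kron_id zigzag1.
  by rewrite !(kron_neq _ nj) tensm0l mcomp0r !mcomp0l.
rewrite M !entryE /=.
have [ejc|njc] := eqVneq j c; last by rewrite (kron_neq _ njc) tensm0r mcomp0r.
have [eab|nab] := eqVneq a b; last by rewrite (kron_neq _ nab) tensm0l mcomp0r.
subst c b; have [eaj|naj] := eqVneq a j; first by rewrite eaj eqxx in nj.
by rewrite (kron_neq _ naj) tensm0r mcomp0r !mcomp0l.
Qed.

Fact sum_zigzag2 X :
  sum_comp (sum_comp (sum_comp (sum_comp (sum_lun (sum_dual X))
    (sum_tensm (sum_ev X) (sum_id (sum_dual X))))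
    (sum_associ (sum_dual X) X (sum_dual X)))
    (sum_tensm (sum_id (sum_dual X)) (sum_coev X)))
    (sum_runi (sum_dual X))
  = sum_id (sum_dual X).
Proof.
apply/entryP=> j j'; rewrite comp_along entryE.
have M a b c : entry (sum_comp (sum_comp (sum_lun (sum_dual X))
      (sum_tensm (sum_ev X) (sum_id (sum_dual X))))
      (sum_associ (sum_dual X) X (sum_dual X))) (a, (b, c)) j'
    = lun (X j')^∨ ∘ (kron (P := fun l => hom ((X a)^∨ ⊗ X l) one) (ev (X a)) b
        ⊗ kron (P := fun l => hom (X c)^∨ (X l)^∨) (idm (X c)^∨) j')
      ∘ associ (X a)^∨ (X b) (X c)^∨.
  rewrite comp_along (along_comp (Y := sum_tens sum_one (sum_dual X))
    (Z := sum_dual X) (s := snd) (fun p => lun (sum_dual X p.2)) _ _ (tt, j'));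
    last exact: snd_inj.
  by rewrite !entryE.
rewrite (bigD1 (j, (j, j))) //= big1 => [|[a [b c]] nj].
  rewrite addr0 M !entryE /= !kron_id.
  have [<-|nj] := eqVneq j j'; first by rewrite !kron_id zigzag2.
  by rewrite !(kron_neq _ nj) tensm0r mcomp0r !mcomp0l.
rewrite M !entryE /=.
have [eja|nja] := eqVneq j a; last by rewrite (kron_neq _ nja) tensm0l mcomp0r.
have [ebc|nbc] := eqVneq b c; last by rewrite (kron_neq _ nbc) tensm0r mcomp0r.
subst a c; have [ejb|njb] := eqVneq j b; first by rewrite ejb eqxx in nj.
by rewrite (kron_neq _ njb) tensm0l mcomp0r !mcomp0l.
Qed.

Fact sum_twist_dual X :
  sum_comp (sum_tensm (sum_twist X) (sum_id (sum_dual X))) (sum_coev X)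
  = sum_comp (sum_tensm (sum_id X) (sum_twist (sum_dual X))) (sum_coev X).
Proof.
rewrite !along_tens; apply/entryP=> -[] [a b].
have sinj : injective (fun p : fidx X * fidx X => (p.1, p.2)).
  by move=> [u v] [u' v'] /= [-> ->].
rewrite (along_comp (Y := sum_tens X (sum_dual X)) (Z := sum_tens X (sum_dual X))
  (s := fun p => (p.1, p.2)) (fun p => twist (X p.1) ⊗ idm (X p.2)^∨)
  (sum_coev X) tt (a, b) sinj).
rewrite (along_comp (Y := sum_tens X (sum_dual X)) (Z := sum_tens X (sum_dual X))
  (s := fun p => (p.1, p.2)) (fun p => idm (X p.1) ⊗ twist (X p.2)^∨)
  (sum_coev X) tt (a, b) sinj).
rewrite !entryE /=; have [<-|nab] := eqVneq a b.
  by rewrite !kron_id twist_dual.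
by rewrite !(kron_neq _ nab) !mcomp0r.
Qed.

Definition sums : ribCat k := @RibCat k sum_mon
  sum_braid sum_braidi sum_braidK sum_braidiK sum_braid_nat
  sum_hexagon1 sum_hexagon2
  sum_twist sum_twisti sum_twistK sum_twistiK sum_twist_nat
  sum_balancing sum_dual sum_ev sum_coev
  sum_zigzag1 sum_zigzag2 sum_twist_dual.
End Sums.

Definition deligne k (C D : ribCat k) : ribCat k := sums (pairs C D).

Section Abelian.
Variables (k : fieldType) (C : linCat k).
Implicit Types U V W K : C.

Definition is_iso U V (f : hom U V) := exists g, inverses f g.
Definition isomorphic U V := exists f : hom U V, is_iso f.

Definition is_mono U V (f : hom U V) :=
  forall W (g h : hom W U), f ∘ g = f ∘ h -> g = h.
Definition is_epi U V (f : hom U V) :=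
  forall W (g h : hom V W), g ∘ f = h ∘ f -> g = h.

Definition is_kernel K U V (i : hom K U) (f : hom U V) :=
  f ∘ i = 0 /\
  forall W (g : hom W U), f ∘ g = 0 -> exists! h : hom W K, i ∘ h = g.
Definition is_cokernel U V K (p : hom V K) (f : hom U V) :=
  p ∘ f = 0 /\
  forall W (g : hom V W), g ∘ f = 0 -> exists! h : hom K W, h ∘ p = g.

(* chosen direct sums of finite families, the empty family included *)
Record directSums := DirectSums {
  dsum : forall J : finType, (J -> C) -> C;
  dinj : forall (J : finType) (X : J -> C) j, hom (X j) (dsum X);
  dprj : forall (J : finType) (X : J -> C) j, hom (dsum X) (X j);
  dprj_inj : forall (J : finType) (X : J -> C) j, dprj X j ∘ dinj X j = idm (X j);
  dprj_inj0 : forall (J : finType) (X : J -> C) i j,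
    i != j -> dprj X i ∘ dinj X j = 0;
  dsum_id : forall (J : finType) (X : J -> C),
    (\sum_j dinj X j ∘ dprj X j)%R = idm (dsum X)
}.

(* to be used together with directSums, which gives the zero object and the   *)
(* biproducts of an abelian category                                          *)
Record abelian : Prop := Abelian {
  has_kernels : forall U V (f : hom U V), exists K (i : hom K U), is_kernel i f;
  has_cokernels : forall U V (f : hom U V),
    exists K (p : hom V K), is_cokernel p f;
  mono_is_kernel : forall U V (i : hom U V), is_mono i ->
    exists W (f : hom V W), is_kernel i f;
  epi_is_cokernel : forall U V (p : hom U V), is_epi p ->
    exists W (f : hom W U), is_cokernel p f
}.

Definition is_simple U :=
  idm U <> 0 /\ forall V (f : hom V U), is_mono f -> f = 0 \/ is_iso f.

Definition semisimple (S : directSums) :=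
  forall U, exists (J : finType) (X : J -> C),
    (forall j, is_simple (X j)) /\ isomorphic U (dsum S X).
End Abelian.

Section Trace.
Variables (k : fieldType) (C : ribCat k).

(* the scalar c such that f = c *: idm one, when there is one *)
Definition scalar_of (f : hom (one : C) one) : k := coord [tuple idm one] ord0 f.

Definition trace (U : C) (f : hom U U) : k :=
  scalar_of (ev U ∘ (idm U^∨ ⊗ f) ∘ coev' U).
Definition qdim (U : C) : k := scalar_of (ev U ∘ coev' U).
End Trace.

Record modularCat (k : fieldType) := ModularCat {
  mod_rib :> ribCat k;
  mod_sums : directSums mod_rib;
  mod_abelian : abelian mod_rib;
  mod_semisimple : semisimple mod_sums;
  mod_one_simple : is_simple (one : mod_rib);
  nsimple : nat;
  smp : 'I_nsimple -> mod_rib;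
  smp_simple : forall i, is_simple (smp i);
  smp_inj : forall i j, isomorphic (smp i) (smp j) -> i = j;
  smp_surj : forall U : mod_rib, is_simple U -> exists i, isomorphic U (smp i);
  smat_unit :
    \matrix_(i < nsimple, j < nsimple)
      trace (braid (smp j) (smp i) ∘ braid (smp i) (smp j)) \in unitmx
}.
Arguments smp {k C} i : rename.
Arguments dinj {k C} _ {J} X j.
Arguments dprj {k C} _ {J} X j.

(* For all V and i: a basis of Hom(V, U_i) and the dual one of Hom(U_i, V). *)
Record dualBases (k : fieldType) (C : modularCat k) := DualBases {
  bup : forall (V : C) i, (\dim {:hom V (smp i)}).-tuple (hom V (smp i));
  blo : forall (V : C) i, (\dim {:hom V (smp i)}).-tuple (hom (smp i) V);
  bup_basis : forall V i, basis_of fullv (bup V i);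
  blo_basis : forall V i, basis_of fullv (blo V i);
  bup_blo : forall V i a b,
    tnth (bup V i) a ∘ tnth (blo V i) b = ((a == b)%:R *: idm (smp i))%R
}.

Record frobData (k : fieldType) (C : monCat k) := FrobData {
  fob_ :> C;
  fmul : hom (fob_ ⊗ fob_) fob_;
  funit : hom one fob_;
  fcomul : hom fob_ (fob_ ⊗ fob_);
  fcounit : hom fob_ one
}.

Record is_frobenius (k : fieldType) (C : monCat k) (A : frobData C) : Prop :=
  IsFrobenius {
  fmulA : fmul A ∘ (fmul A ⊗ idm A)
          = fmul A ∘ (idm A ⊗ fmul A) ∘ assoc A A A;
  fmul1l : fmul A ∘ (funit A ⊗ idm A) = lun A;
  fmul1r : fmul A ∘ (idm A ⊗ funit A) = run A;
  fcomulA : assoc A A A ∘ (fcomul A ⊗ idm A) ∘ fcomul A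
            = (idm A ⊗ fcomul A) ∘ fcomul A;
  fcomul1l : (fcounit A ⊗ idm A) ∘ fcomul A = luni A;
  fcomul1r : (idm A ⊗ fcounit A) ∘ fcomul A = runi A;
  frobenius_l : (idm A ⊗ fmul A) ∘ assoc A A A ∘ (fcomul A ⊗ idm A)
                = fcomul A ∘ fmul A;
  frobenius_r : fcomul A ∘ fmul A
                = (fmul A ⊗ idm A) ∘ associ A A A ∘ (idm A ⊗ fcomul A)
}.

Definition symmetric_frob k (C : ribCat k) (A : frobData C) : Prop :=
  lun A^∨ ∘ ((fcounit A ∘ fmul A) ⊗ idm A^∨)
    ∘ associ A A A^∨ ∘ (idm A ⊗ coev A) ∘ runi A
  = run A^∨ ∘ (idm A^∨ ⊗ (fcounit A ∘ fmul A))
    ∘ assoc A^∨ A A ∘ (coev' A ⊗ idm A) ∘ luni A.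

Definition special_with k (C : monCat k) (A : frobData C) (z : k) : Prop :=
  [/\ z != 0, fmul A ∘ fcomul A = (z *: idm A)%R
    & exists2 x : k, x != 0 & fcounit A ∘ funit A = (x *: idm one)%R].
Definition special k (C : monCat k) (A : frobData C) : Prop :=
  exists z, special_with A z.
Definition normalised_special k (C : monCat k) (A : frobData C) : Prop :=
  special_with A 1.

Section TR.
Variables (k : fieldType) (C : modularCat k) (B : dualBases C).
Local Notation P := (pairs C (rev C)).

Definition C2 : ribCat k := deligne C (rev C).

(* the objects of C2, so that (M n).1 × (M n).2 is the n-th summand of M *)
Definition ob2 := family (C * C).
Implicit Types (A X : C) (M N : ob2).

(* the unit and the tensor product of C2, as families of pairs *)
Definition one2 : ob2 := (one : C2).
Definition tens2 M N : ob2 := ((M : C2) ⊗ (N : C2))%ob.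

Local Notation inj := (dinj (mod_sums C)).
Local Notation prj := (dprj (mod_sums C)).

Definition T_fam M (n : fidx M) : C := ((M n).1 ⊗ (M n).2)%ob.
Definition T_ob M : C := dsum (mod_sums C) (@T_fam M).

(* id_U ⊗ t ⊗ id_X *)
Definition mid4 (U V W X : C) (t : hom (V ⊗ W) (W ⊗ V)) :
    hom ((U ⊗ V) ⊗ (W ⊗ X)) ((U ⊗ W) ⊗ (V ⊗ X)) :=
  associ U W (V ⊗ X) ∘ (idm U ⊗ (assoc W V X ∘ (t ⊗ idm X) ∘ associ V W X))
    ∘ assoc U V (W ⊗ X).

Definition phiT0 : hom one (T_ob one2) :=
  inj (@T_fam one2) tt ∘ luni one.
Definition psiT0 : hom (T_ob one2) one :=
  lun one ∘ prj (@T_fam one2) tt.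

Definition phiT2 M N : hom (T_ob M ⊗ T_ob N) (T_ob (tens2 M N)) :=
  (\sum_m \sum_n inj (@T_fam (tens2 M N)) (m, n)
     ∘ mid4 (M m).1 (N n).2 (braidi (N n).1 (M m).2)
     ∘ (prj (@T_fam M) m ⊗ prj (@T_fam N) n))%R.
Definition psiT2 M N : hom (T_ob (tens2 M N)) (T_ob M ⊗ T_ob N) :=
  (\sum_m \sum_n (inj (@T_fam M) m ⊗ inj (@T_fam N) n)
     ∘ mid4 (M m).1 (N n).2 (braid (N n).1 (M m).2)
     ∘ prj (@T_fam (tens2 M N)) (m, n))%R.

Lemma inverses_mid4 (U V W X : C) (t : hom (V ⊗ W) (W ⊗ V)) t' :
  inverses t t' -> inverses (mid4 U X t) (mid4 U X t').
Proof.
move=> It; have I1 := inverses_id (C := C).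
apply: inverses_comp3; [exact: inverses_assoc | | exact: inverses_associ].
apply: inverses_tens (I1 _) _.
apply: inverses_comp3; [exact: inverses_associ | | exact: inverses_assoc].
exact: inverses_tens It (I1 _).
Qed.

Lemma inverses_phiT0 : inverses phiT0 psiT0.
Proof.
split; rewrite /psiT0 /phiT0.
  by rewrite -mcompA (mcompA (prj _ _)) dprj_inj mcomp1l luniK.
rewrite -mcompA (mcompA (luni _)) lunK mcomp1l -dsum_id.
by rewrite (bigD1 tt) //= big1 ?addr0 // => -[].
Qed.

Lemma inverses_phiT2 M N : inverses (phiT2 M N) (psiT2 M N).
Proof.
have midK m n := inverses_mid4 (M m).1 (N n).2
  (inverses_braid (N n).1 (M m).2).
pose Q (p : fidx M * fidx N) := prj (@T_fam M) p.1 ⊗ prj (@T_fam N) p.2.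
pose J (p : fidx M * fidx N) := inj (@T_fam M) p.1 ⊗ inj (@T_fam N) p.2.
have QJ p : Q p ∘ J p = idm _ by rewrite -tensmM !dprj_inj tensm1.
have QJ0 p q : p != q -> Q p ∘ J q = 0.
  case: p q => [m n] [m' n']; rewrite xpair_eqE negb_and -tensmM.
  by case/orP=> ne; rewrite (dprj_inj0 _ _ ne) ?tensm0l ?tensm0r.
have sJQ : (\sum_p J p ∘ Q p)%R = idm _.
  rewrite -tensm1 -!dsum_id tensm_suml.
  rewrite (eq_bigr _ (fun i _ => tensm_sumr _ _)) pair_bigA.
  by apply: eq_bigr => p _; rewrite -tensmM.
rewrite /phiT2 /psiT2 !pair_bigA /=; split.
  rewrite mcomp_suml -sJQ; apply: eq_bigr => -[m n] _ /=.
  rewrite mcomp_sumr (bigD1 (m, n)) //= big1 => [|[m' n'] nqp].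
    rewrite addr0. refine (comp3K _ _ (dprj_inj (mod_sums C) (@T_fam (tens2 M N)) (m, n)) (midK m n).2).
  have Z : prj (@T_fam (tens2 M N)) (m, n)
      ∘ inj (@T_fam (tens2 M N)) (m', n') = 0.
    by apply: dprj_inj0; rewrite eq_sym.
  exact: comp3_0 Z.
rewrite mcomp_suml -dsum_id; apply: eq_bigr => -[m n] _ /=.
rewrite mcomp_sumr (bigD1 (m, n)) //= big1 => [|[m' n'] nqp].
  by rewrite addr0; exact: comp3K (QJ (m, n)) (midK m n).1.
by apply: comp3_0; apply: (QJ0 (m, n)); rewrite eq_sym.
Qed.

Definition R_ob A : ob2 := Family (fun i => (A ⊗ (smp i)^∨, smp i)%ob).
Definition R_mor A A' (f : hom A A') : hom (R_ob A : C2) (R_ob A') :=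
  along (E := P) (X := R_ob A) (Y := R_ob A')
    (fun i => pure (f ⊗ idm (smp i)^∨) (idm (smp i))).

Definition chi_hat M A (f : hom (T_ob M) A) : hom (M : C2) (R_ob A) :=
  sum_of (E := P) (X := M) (Y := R_ob A) (fun n i =>
    \sum_a pure
      (((f ∘ inj (@T_fam M) n) ⊗ idm (smp i)^∨)
        ∘ ((idm (M n).1 ⊗ tnth (blo B (M n).2 i) a) ⊗ idm (smp i)^∨)
        ∘ associ (M n).1 (smp i) (smp i)^∨
        ∘ (idm (M n).1 ⊗ coev (smp i)) ∘ runi (M n).1)
      (tnth (bup B (M n).2 i) a))%R.

Definition Dim : k := \sum_i qdim (smp i : C) ^+ 2.

Definition chi_check M A (g : hom A (T_ob M)) : hom (R_ob A : C2) M :=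
  sum_of (E := P) (X := R_ob A) (Y := M) (fun i n =>
    \sum_a (Dim / qdim (smp i : C)) *: pure
      (run (M n).1 ∘ (idm (M n).1 ⊗ ev' (smp i))
        ∘ assoc (M n).1 (smp i) (smp i)^∨
        ∘ ((idm (M n).1 ⊗ tnth (bup B (M n).2 i) a) ⊗ idm (smp i)^∨)
        ∘ ((prj (@T_fam M) n ∘ g) ⊗ idm (smp i)^∨))
      (tnth (blo B (M n).2 i) a))%R.

Lemma chi_hat_linear M A : linear (@chi_hat M A).
Proof.
move=> c f f'; apply/entryP=> n i; rewrite entry_lin !entryE scaler_sumr.
rewrite -big_split; apply: eq_bigr => a _ /=.
rewrite -(pure_bilinear _ _).1; congr (pure _ _).
by rewrite mcompDl (tensm_bilinear _ _ _ _).1 !mcompDl.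
Qed.

Lemma chi_check_linear M A : linear (@chi_check M A).
Proof.
move=> c g g'; apply/entryP=> i n; rewrite entry_lin !entryE scaler_sumr.
rewrite -big_split; apply: eq_bigr => a _ /=.
set x := (Dim / _)%R.
rewrite scalerA (mulrC c) -(scalerA x c).
apply: etrans (scalerDr _ _ _); congr (_ *: _).
rewrite -(pure_bilinear _ _).1; congr (pure _ _).
by rewrite mcompDr (tensm_bilinear _ _ _ _).1 !mcompDr.
Qed.

(* Since chi_hat and chi_check are linear, linfun does not change them; ^-1 is *)
(* the inverse of a linear map on its image.                                   *)
Definition chi_hat_inv M A : hom (M : C2) (R_ob A) -> hom (T_ob M) A :=
  (linfun (@chi_hat M A))^-1%VF.
Definition chi_check_inv M A : hom (R_ob A : C2) M -> hom A (T_ob M) :=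
  (linfun (@chi_check M A))^-1%VF.

Definition delta_hat M : hom (M : C2) (R_ob (T_ob M)) := chi_hat (idm (T_ob M)).
Definition rho_hat A : hom (T_ob (R_ob A)) A := chi_hat_inv (idm (R_ob A : C2)).
Definition rho_check M : hom (R_ob (T_ob M) : C2) M := chi_check (idm (T_ob M)).
Definition delta_check A : hom A (T_ob (R_ob A)) :=
  chi_check_inv (idm (R_ob A : C2)).

Definition phiR0 : hom (one2 : C2) (R_ob one) := chi_hat psiT0.
Definition psiR0 : hom (R_ob one : C2) one2 := chi_check phiT0.

Definition phiR2 A A' : hom (tens2 (R_ob A) (R_ob A') : C2) (R_ob (A ⊗ A')%ob) :=
  R_mor (rho_hat A ⊗ rho_hat A') ∘ R_mor (psiT2 (R_ob A) (R_ob A'))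
    ∘ delta_hat (tens2 (R_ob A) (R_ob A')).
Definition psiR2 A A' : hom (R_ob (A ⊗ A')%ob : C2) (tens2 (R_ob A) (R_ob A') : C2) :=
  rho_check (tens2 (R_ob A) (R_ob A'))
    ∘ R_mor (phiT2 (R_ob A) (R_ob A')) ∘ R_mor (delta_check A ⊗ delta_check A').

Definition R_frob (A : frobData C) : frobData C2 := @FrobData k C2 (R_ob A)
  (R_mor (fmul A) ∘ phiR2 A A)
  (R_mor (funit A) ∘ phiR0)
  (psiR2 A A ∘ R_mor (fcomul A))
  (psiR0 ∘ R_mor (fcounit A)).
End TR.

(* Main.v *)
From HB Require Import structures.
From mathcomp Require Import all_boot all_order all_algebra.
From mathcomp Require Import complex reals.
Require Import Defs.

Set Implicit Arguments.
Unset Strict Implicit.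
Unset Printing Implicit Defensive.

Import GRing.Theory.
Local Open Scope ring_scope.
Local Open Scope mor_scope.

(** The functor T is strong monoidal, and the universal property of R(A) is
    carried by one morphism rho : T (R A) -> A: every T M -> A is rho ∘ T h for
    exactly one h : M -> R A (rho0_surj, rho0_faithful). Under this bijection
    the product and the unit of R(A) correspond to m ∘ (rho ⊗ rho) and η
    (rho0_mul, rho0_unit), so associativity and the unit laws descend from A.

    The coproduct is defined through the other transpose, chi_check, and the
    link between the two is a trace identity (chi_check_star): for
    g : A -> T M, an invariant y : 1 -> R A ⊗ N and a form c : M ⊗ N -> 1,
    chi_check g and g ∘ rho pair to the same scalar with y and c up to the
    factor Dim C,
      T c ∘ (T (chi_check g) ⊗ 1) ∘ T y = Dim C · T c ∘ (g rho ⊗ 1) ∘ T y.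
    To see this, slide the second components of y and c off the first ones
    (star_slide): they close up to a map to the unit from b ⊗ U^∨ with U simple,
    and such a map is a combination of evaluations following the basis of
    Hom(b, U) (cap_expand). The weights 1 / dim U that appear are those in the
    definition of chi_check.

    Maps to the unit are determined by their values on invariants, in C by
    semisimplicity and hence in the product category (one_separating,
    family_separating), and every invariant of A ⊗ T N is (rho ⊗ 1) ∘ T y for
    some y (rho_surj_l). Thus all identities between forms on R(A) can be
    tested in C, where chi_check_star makes them identities for A. The form
    ε m of R(A) turns into Dim C times that of A, so it is nondegenerate; the
    coproduct of R(A) turns out to be the adjoint of its product for that form.
    An algebra with a nondegenerate invariant form whose coproduct is given by
    the copairing is Frobenius (frobenius_of_copairing).

    For (ii), rho carries m Δ η of R(A) to m Δ η of A because the morphism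
    delta_check is a section of rho, so the constant ζ is the same, whereas
    ε η is multiplied by Dim C. For (i), a form is symmetric exactly when it
    does not change under the cyclic rotation rot of invariants
    (symmetric_frobE), and T commutes with rot (T_rot).

    Finally Dim C is not zero: the dimensions d_i are eigenvalues of the fusion
    matrices, whose transposes are the fusion matrices of the dual objects and
    have the same eigenvector for the same eigenvalue. Hence the d_i are real,
    and they do not vanish (Dim_neq0).

    Associators and unit isomorphisms are handled by a translation into strict
    diagrams: an equation holds once it holds with all objects flattened to
    right nested products (den_inj). *)

(** * Unit constraints *)

Section MonUnits.
Variables (k : fieldType) (C : monCat k).
Implicit Types U V W : C.

Lemma tensl_inj U V (f g : hom U V) : idm one ⊗ f = idm one ⊗ g -> f = g.
Proof.
move=> e; rewrite -[f]mcomp1r -[g]mcomp1r -(luniK U) !mcompA -!lun_nat.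
by rewrite e.
Qed.

Lemma tensr_inj U V (f g : hom U V) : f ⊗ idm one = g ⊗ idm one -> f = g.
Proof.
move=> e; rewrite -[f]mcomp1r -[g]mcomp1r -(runiK U) !mcompA -!run_nat.
by rewrite e.
Qed.

Lemma tenslM U V W X (g : hom W X) (f : hom V W) :
  idm U ⊗ (g ∘ f) = (idm U ⊗ g) ∘ (idm U ⊗ f).
Proof. by rewrite -tensmM mcomp1l. Qed.

Lemma tensrM U V W X (g : hom W X) (f : hom V W) :
  (g ∘ f) ⊗ idm U = (g ⊗ idm U) ∘ (f ⊗ idm U).
Proof. by rewrite -tensmM mcomp1l. Qed.

Lemma tensm_lr U V W X (f : hom U V) (g : hom W X) :
  (f ⊗ idm X) ∘ (idm U ⊗ g) = f ⊗ g.
Proof. by rewrite -tensmM mcomp1l mcomp1r. Qed.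

Lemma tensm_rl U V W X (f : hom U V) (g : hom W X) :
  (idm V ⊗ g) ∘ (f ⊗ idm W) = f ⊗ g.
Proof. by rewrite -tensmM mcomp1l mcomp1r. Qed.

Lemma compIl U V W (f : hom U V) (f' : hom V U) (g g' : hom W U) :
  f' ∘ f = idm U -> f ∘ g = f ∘ g' -> g = g'.
Proof. by move=> fK e; rewrite -[g]mcomp1l -[g']mcomp1l -fK -!mcompA e. Qed.

Lemma compIr U V W (f : hom U V) (f' : hom V U) (g g' : hom V W) :
  f ∘ f' = idm V -> g ∘ f = g' ∘ f -> g = g'.
Proof. by move=> fK e; rewrite -[g]mcomp1r -[g']mcomp1r -fK !mcompA e. Qed.

(** Kelly's argument: both sides agree after tensoring with the unit on the
    left, where the pentagon and the triangle apply. *)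
Lemma lun_tens U V : lun (U ⊗ V) ∘ assoc one U V = lun U ⊗ idm V.
Proof.
apply: tensl_inj.
have pent := pentagon one one U V.
apply: (compIr (associK one (one ⊗ U)%ob V)).
apply: (compIr (f := assoc one one U ⊗ idm V) (f' := associ one one U ⊗ idm V)).
  by rewrite -tensmM associK mcomp1l tensm1.
rewrite tenslM -!mcompA (mcompA (idm one ⊗ assoc _ _ _)) pent mcompA triangle.
rewrite [RHS]mcompA -assoc_nat -mcompA -tensmM triangle mcomp1l.
by rewrite assoc_nat tensm1.
Qed.

Lemma lun_one : lun (one : C) = run one.
Proof.
apply: tensr_inj; rewrite -triangle -lun_tens; congr (_ ∘ _).
by apply: (compIl (lunK (one : C))); rewrite lun_nat.
Qed.
End MonUnits.

(** * Strict forms of morphisms *)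

Section Flat.
Variables (k : fieldType) (C : monCat k).

(** Bracketed products. Two bracketings of the same factors are different words
    with the same flattening, which is what lets associators become identities. *)
Inductive word (T : Type) :=
  Leaf of T | Unit | Node of word T & word T.
Arguments Unit {T}.

Fixpoint wmap T T' (F : T -> T') (s : word T) : word T' :=
  match s with
  | Leaf X => Leaf (F X)
  | Unit => Unit
  | Node s t => Node (wmap F s) (wmap F t)
  end.

Implicit Types s t u : word C.

Fixpoint val s : C :=
  match s with
  | Leaf X => X
  | Unit => one
  | Node s t => (val s ⊗ val t)%ob
  end.

(** The tail W makes f ⊗ id another instance of the strict form of f, with a
    longer tail; only tensoring on the left remains visible. *)
Fixpoint flat s (W : C) : C :=
  match s with
  | Leaf X => (X ⊗ W)%ob
  | Unit => W
  | Node s t => flat s (flat t W)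
  end.

Fixpoint whisk s {W W' : C} : hom W W' -> hom (flat s W) (flat s W') :=
  match s return hom W W' -> hom (flat s W) (flat s W') with
  | Leaf X => fun w => idm X ⊗ w
  | Unit => id
  | Node s t => fun w => whisk s (whisk t w)
  end.

Lemma whiskM s (W W' W2 : C) (g : hom W' W2) (f : hom W W') :
  whisk s (g ∘ f) = whisk s g ∘ whisk s f.
Proof.
by elim: s W W' W2 g f => [X|//|s IHs t IHt] W W' W2 g f /=;
  [exact: tenslM | rewrite IHt IHs].
Qed.

Fixpoint nrm s (W : C) : hom (val s ⊗ W) (flat s W) :=
  match s with
  | Leaf X => idm _
  | Unit => lun W
  | Node s t => nrm s (flat t W) ∘ (idm (val s) ⊗ nrm t W) ∘ assoc (val s) (val t) W
  end.

Fixpoint nrmi s (W : C) : hom (flat s W) (val s ⊗ W) :=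
  match s with
  | Leaf X => idm _
  | Unit => luni W
  | Node s t => associ (val s) (val t) W ∘ (idm (val s) ⊗ nrmi t W)
                ∘ nrmi s (flat t W)
  end.

Lemma nrmV s W : inverses (nrm s W) (nrmi s W).
Proof.
elim: s W => [X|/=|s IHs t IHt] W; first exact: inverses_id.
  by split; rewrite ?lunK ?luniK.
apply: inverses_comp3 (IHs _); first exact: inverses_assoc.
exact: inverses_tens (inverses_id _) (IHt _).
Qed.

Lemma nrmK s W : nrmi s W ∘ nrm s W = idm _. Proof. exact: (nrmV s W).1. Qed.
Lemma nrmiK s W : nrm s W ∘ nrmi s W = idm _. Proof. exact: (nrmV s W).2. Qed.

Lemma nrm_nat s (W W' : C) (w : hom W W') :
  nrm s W' ∘ (idm (val s) ⊗ w) = whisk s w ∘ nrm s W.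
Proof.
elim: s W W' w => [X|/=|s IHs t IHt] W W' w /=.
- by rewrite mcomp1l mcomp1r.
- exact: lun_nat.
- rewrite -!mcompA -tensm1 assoc_nat !mcompA -IHs -!mcompA; congr (_ ∘ _).
  by rewrite !mcompA -!tenslM IHt.
Qed.

Lemma nrmi_nat s (W W' : C) (w : hom W W') :
  (idm (val s) ⊗ w) ∘ nrmi s W = nrmi s W' ∘ whisk s w.
Proof.
apply: (compIl (nrmK s W')); apply: (compIr (nrmiK s W)).
by rewrite -!mcompA nrmK mcomp1r nrm_nat !mcompA nrmiK mcomp1l.
Qed.

(** The strict form of f. It is locked so that rewriting treats it as an atom
    with no structure beyond naturality in the tail (op_nat). *)
Fact op_key : unit. Proof. by []. Qed.
Definition op s t (f : hom (val s) (val t)) (W : C) : hom (flat s W) (flat t W) :=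
  locked_with op_key (nrm t W ∘ (f ⊗ idm W) ∘ nrmi s W).
Arguments op : clear implicits.

Lemma opE s t f W : op s t f W = nrm t W ∘ (f ⊗ idm W) ∘ nrmi s W.
Proof. by rewrite /op unlock. Qed.

Lemma op_nat s t (f : hom (val s) (val t)) (W W' : C) (w : hom W W') :
  op s t f W' ∘ whisk s w = whisk t w ∘ op s t f W.
Proof.
rewrite !opE -!mcompA -nrmi_nat !mcompA -nrm_nat; congr (_ ∘ _).
by rewrite -!mcompA; congr (_ ∘ _); rewrite -!tensmM !mcomp1l !mcomp1r.
Qed.

(** The trailing h gives every strict composite the same right nested shape, with
    h at the end, so that a segment can be rewritten wherever it stands. *)
Lemma op_inj s t (f g : hom (val s) (val t)) :
  (forall W Z (h : hom Z (flat s W)), op s t f W ∘ h = op s t g W ∘ h) -> f = g.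
Proof.
move=> e; apply: tensr_inj; have /= := e one _ (nrm s one).
rewrite !opE -!mcompA nrmK !mcomp1r => /(congr1 (mcomp (nrmi t one))).
by rewrite !mcompA nrmK !mcomp1l.
Qed.

Lemma op_id s W : op s s (idm _) W = idm _.
Proof. by rewrite !opE tensm1 mcomp1r nrmiK. Qed.

Lemma op_comp s t u (g : hom (val t) (val u)) (f : hom (val s) (val t)) W :
  op s u (g ∘ f) W = op t u g W ∘ op s t f W.
Proof.
rewrite !opE tensrM -!mcompA; congr (_ ∘ (_ ∘ _)).
by rewrite !mcompA nrmK mcomp1l.
Qed.

Lemma op_tens s s' t t' (f : hom (val s) (val t)) (g : hom (val s') (val t')) W :
  op (Node s s') (Node t t') (f ⊗ g) W
  = op s t f (flat t' W) ∘ whisk s (op s' t' g W).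
Proof.
rewrite !opE /=.
transitivity (nrm t (flat t' W) ∘ (idm _ ⊗ nrm t' W) ∘ (f ⊗ (g ⊗ idm W))
  ∘ (idm _ ⊗ nrmi s' W) ∘ nrmi s (flat s' W)).
  rewrite -!mcompA (mcompA (assoc _ _ _)) assoc_nat.
  by rewrite -!mcompA (mcompA (assoc _ _ _)) associK mcomp1l.
rewrite -[RHS]mcompA -nrmi_nat !mcompA; congr (_ ∘ _).
by rewrite -!mcompA -!tensmM !mcomp1l !mcomp1r !mcompA.
Qed.

Lemma op_assoc s t u W :
  op (Node (Node s t) u) (Node s (Node t u)) (assoc _ _ _) W = idm _.
Proof.
rewrite !opE /= -(nrmiK (Node (Node s t) u) W) /=; congr (_ ∘ _).
rewrite -!mcompA; congr (_ ∘ _).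
rewrite tenslM [in RHS]mcompA [in RHS]mcompA -[in RHS](mcompA _ (assoc _ _ _)).
rewrite -tensm1 assoc_nat !tenslM -!mcompA; congr (_ ∘ (_ ∘ _)).
by rewrite mcompA pentagon.
Qed.

Lemma op_associ s t u W :
  op (Node s (Node t u)) (Node (Node s t) u) (associ _ _ _) W = idm _.
Proof.
rewrite -[LHS]mcomp1r -[X in _ ∘ X](op_assoc s t u W).
rewrite -(@op_comp (Node (Node s t) u) (Node s (Node t u)) (Node (Node s t) u)).
by rewrite assocK op_id.
Qed.

Lemma op_lun s W : op (Node Unit s) s (lun _) W = idm _.
Proof.
rewrite !opE /= -lun_tens -!mcompA (mcompA (assoc _ _ _)) associK mcomp1l.
by rewrite (mcompA (lun _)) lun_nat -mcompA luniK mcomp1r nrmiK.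
Qed.

Lemma op_luni s W : op s (Node Unit s) (luni _) W = idm _.
Proof.
rewrite -[LHS]mcomp1r -[X in _ ∘ X](op_lun s W).
rewrite -(@op_comp (Node Unit s) s (Node Unit s)).
by rewrite lunK op_id.
Qed.

Lemma op_run s W : op (Node s Unit) s (run _) W = idm _.
Proof.
rewrite !opE /= -triangle -!mcompA (mcompA (assoc _ _ _)) associK mcomp1l.
by rewrite (mcompA (idm _ ⊗ lun _)) -tensmM luniK mcomp1l tensm1 mcomp1l nrmiK.
Qed.

Lemma op_runi s W : op s (Node s Unit) (runi _) W = idm _.
Proof.
rewrite -[LHS]mcomp1r -[X in _ ∘ X](op_run s W).
rewrite -(@op_comp (Node s Unit) s (Node s Unit)).
by rewrite runK op_id.
Qed.

(** Syntax of composites. den interprets it in C; strict, which drops the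
    structure morphisms, in the flattened objects. *)
Inductive diag : word C -> word C -> Type :=
  | Gen s t of hom (val s) (val t) : diag s t
  | Id s : diag s s
  | Comp s t u of diag t u & diag s t : diag s u
  | Ten s s' t t' of diag s t & diag s' t' : diag (Node s s') (Node t t')
  | As s t u : diag (Node (Node s t) u) (Node s (Node t u))
  | Asi s t u : diag (Node s (Node t u)) (Node (Node s t) u)
  | Lu s : diag (Node Unit s) s
  | Lui s : diag s (Node Unit s)
  | Ru s : diag (Node s Unit) s
  | Rui s : diag s (Node s Unit).

Fixpoint den s t (m : diag s t) : hom (val s) (val t) :=
  match m with
  | Gen s t f => f
  | Id s => idm _
  | Comp s t u g f => den g ∘ den f
  | Ten s s' t t' f g => den f ⊗ den g
  | As s t u => assoc _ _ _
  | Asi s t u => associ _ _ _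
  | Lu s => lun _
  | Lui s => luni _
  | Ru s => run _
  | Rui s => runi _
  end.

Fixpoint strict s t (m : diag s t) (W : C) : hom (flat s W) (flat t W) :=
  match m with
  | Gen s t f => op s t f W
  | Id s => idm _
  | Comp s t u g f => strict g W ∘ strict f W
  | Ten s s' t t' f g => strict f (flat t' W) ∘ whisk s (strict g W)
  | As s t u => idm _
  | Asi s t u => idm _
  | Lu s => idm _
  | Lui s => idm _
  | Ru s => idm _
  | Rui s => idm _
  end.

Lemma op_den s t (m : diag s t) W : op s t (den m) W = strict m W.
Proof.
elim: m W => //= {s t} [s W|s t u g IHg f IHf W|s s' t t' f IHf g IHg W||||||].
- exact: op_id.
- by rewrite (@op_comp s t u) IHg IHf.
- by rewrite op_tens IHf IHg.
- exact: op_assoc.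
- exact: op_associ.
- exact: op_lun.
- exact: op_luni.
- exact: op_run.
- exact: op_runi.
Qed.

Lemma den_inj s t (m m' : diag s t) :
  (forall W Z (h : hom Z (flat s W)), strict m W ∘ h = strict m' W ∘ h) ->
  den m = den m'.
Proof. by move=> e; apply: op_inj => W Z h; rewrite !op_den. Qed.

Lemma strict_eq s t (m m' : diag s t) :
  den m = den m' -> forall W, strict m W = strict m' W.
Proof. by move=> e W; rewrite -!op_den e. Qed.

End Flat.
Arguments Unit {T}.
Arguments op {k C} s t f W.
Arguments whisk {k C} s {W W'} w.

(* Every object other than a product or the unit becomes a leaf. *)
Ltac reify_ob X :=
  lazymatch X with
  | @one ?k ?C => constr:(@Unit (@ob k (@mon_lin k C)))
  | tens ?a ?b => let s := reify_ob a in let t := reify_ob b in constr:(Node s t)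
  | ?a => constr:(Leaf a)
  end.

Ltac reify_mor f :=
  lazymatch f with
  | idm ?X => let s := reify_ob X in constr:(Id s)
  | mcomp ?g ?f => let g' := reify_mor g in let f' := reify_mor f in
      constr:(Comp g' f')
  | tensm ?f ?g => let f' := reify_mor f in let g' := reify_mor g in
      constr:(Ten f' g')
  | assoc ?X ?Y ?Z => let s := reify_ob X in let t := reify_ob Y in
      let u := reify_ob Z in constr:(As s t u)
  | associ ?X ?Y ?Z => let s := reify_ob X in let t := reify_ob Y in
      let u := reify_ob Z in constr:(Asi s t u)
  | lun ?X => let s := reify_ob X in constr:(Lu s)
  | luni ?X => let s := reify_ob X in constr:(Lui s)
  | run ?X => let s := reify_ob X in constr:(Ru s)
  | runi ?X => let s := reify_ob X in constr:(Rui s)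
  | _ => let T := type of f in lazymatch eval cbn [val wmap] in T with
    | Vector.sort (hom ?X ?Y) => let s := reify_ob X in let t := reify_ob Y in
        constr:(@Gen _ _ s t f)
    end
  end.

Ltac fnorm := cbn [strict whisk flat val];
  rewrite ?(mcomp1l, mcomp1r, tensm1, tenslM) -?mcompA.

(* Turns an equation into its strict form, with a universally quantified tail
   and end. *)
Ltac flatten :=
  lazymatch goal with |- ?f = ?g =>
    let f' := reify_mor f in let g' := reify_mor g in
    apply: (@den_inj _ _ _ _ f' g');
    let W := fresh "W" in let Z := fresh "Z" in let h := fresh "h" in
    intros W Z h; fnorm
  end.


Section Rewriting.
Variables (k : fieldType) (C : monCat k).
Implicit Types U V W : C.

(** The interchange law: what happens in the tail may be done earlier or later. *)
Lemma op_exchange (u s t : word C) (f : hom (val s) (val t)) W W' (w : hom W W')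
    Z (h : hom Z (flat u (flat s W))) :
  whisk u (op s t f W') ∘ (whisk u (whisk s w) ∘ h)
  = whisk u (whisk t w) ∘ (whisk u (op s t f W) ∘ h).
Proof. by rewrite !mcompA -!whiskM op_nat. Qed.

Lemma tr1 U V (a r : hom U V) Z (h : hom Z U) : a = r -> a ∘ h = r ∘ h.
Proof. by move->. Qed.
Lemma tr2 U V V1 (a : hom V1 V) (b : hom U V1) (r : hom U V) Z (h : hom Z U) :
  a ∘ b = r -> a ∘ (b ∘ h) = r ∘ h.
Proof. by move=> <-; rewrite !mcompA. Qed.
Lemma tr3 U V V1 V2 (a : hom V1 V) (b : hom V2 V1) (c : hom U V2) (r : hom U V)
    Z (h : hom Z U) :
  a ∘ (b ∘ c) = r -> a ∘ (b ∘ (c ∘ h)) = r ∘ h.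
Proof. by move=> <-; rewrite !mcompA. Qed.
Lemma tr4 U V V1 V2 V3 (a : hom V1 V) (b : hom V2 V1) (c : hom V3 V2)
    (d : hom U V3) (r : hom U V) Z (h : hom Z U) :
  a ∘ (b ∘ (c ∘ d)) = r -> a ∘ (b ∘ (c ∘ (d ∘ h))) = r ∘ h.
Proof. by move=> <-; rewrite !mcompA. Qed.

Lemma tr5 U V V1 V2 V3 V4 (a : hom V1 V) (b : hom V2 V1) (c : hom V3 V2)
    (d : hom V4 V3) (e : hom U V4) (r : hom U V) Z (h : hom Z U) :
  a ∘ (b ∘ (c ∘ (d ∘ e))) = r -> a ∘ (b ∘ (c ∘ (d ∘ (e ∘ h)))) = r ∘ h.
Proof. by move=> <-; rewrite !mcompA. Qed.

Lemma lw1 X U V (a r : hom U V) : a = r -> idm X ⊗ a = idm X ⊗ r.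
Proof. by move->. Qed.
Lemma lw2 X U V V1 (a : hom V1 V) (b : hom U V1) (r : hom U V) :
  a ∘ b = r -> (idm X ⊗ a) ∘ (idm X ⊗ b) = idm X ⊗ r.
Proof. by move=> <-; rewrite tenslM. Qed.
Lemma lw3 X U V V1 V2 (a : hom V1 V) (b : hom V2 V1) (c : hom U V2) (r : hom U V) :
  a ∘ (b ∘ c) = r ->
  (idm X ⊗ a) ∘ ((idm X ⊗ b) ∘ (idm X ⊗ c)) = idm X ⊗ r.
Proof. by move=> <-; rewrite !tenslM. Qed.
Lemma lw4 X U V V1 V2 V3 (a : hom V1 V) (b : hom V2 V1) (c : hom V3 V2)
    (d : hom U V3) (r : hom U V) :
  a ∘ (b ∘ (c ∘ d)) = r ->
  (idm X ⊗ a) ∘ ((idm X ⊗ b) ∘ ((idm X ⊗ c) ∘ (idm X ⊗ d))) = idm X ⊗ r.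
Proof. by move=> <-; rewrite !tenslM. Qed.
Lemma lw5 X U V V1 V2 V3 V4 (a : hom V1 V) (b : hom V2 V1) (c : hom V3 V2)
    (d : hom V4 V3) (e : hom U V4) (r : hom U V) :
  a ∘ (b ∘ (c ∘ (d ∘ e))) = r ->
  (idm X ⊗ a) ∘ ((idm X ⊗ b) ∘ ((idm X ⊗ c) ∘ ((idm X ⊗ d) ∘ (idm X ⊗ e))))
  = idm X ⊗ r.
Proof. by move=> <-; rewrite !tenslM. Qed.
End Rewriting.

Lemma trail (k : fieldType) (C : linCat k) (U V : C) (f g : hom U V) :
  (forall Z (h : hom Z U), f ∘ h = g ∘ h) -> f = g.
Proof. by move=> e; have := e _ (idm U); rewrite !mcomp1r. Qed.

(* frwN rewrites a segment of N factors with a strict equation, under up to four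
   left whiskerings. *)
Tactic Notation "frw5" constr(e) :=
  first [rewrite (tr5 _ e) | rewrite (tr5 _ (lw5 _ e))
    | rewrite (tr5 _ (lw5 _ (lw5 _ e)))
    | rewrite (tr5 _ (lw5 _ (lw5 _ (lw5 _ e))))
    | rewrite (tr5 _ (lw5 _ (lw5 _ (lw5 _ (lw5 _ e)))))]; fnorm.
Tactic Notation "frw4" constr(e) :=
  first [rewrite (tr4 _ e) | rewrite (tr4 _ (lw4 _ e))
    | rewrite (tr4 _ (lw4 _ (lw4 _ e)))
    | rewrite (tr4 _ (lw4 _ (lw4 _ (lw4 _ e))))
    | rewrite (tr4 _ (lw4 _ (lw4 _ (lw4 _ (lw4 _ e)))))]; fnorm.
Tactic Notation "frw1" constr(e) :=
  first [rewrite (tr1 _ e) | rewrite (tr1 _ (lw1 _ e))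
    | rewrite (tr1 _ (lw1 _ (lw1 _ e)))
    | rewrite (tr1 _ (lw1 _ (lw1 _ (lw1 _ e))))
    | rewrite (tr1 _ (lw1 _ (lw1 _ (lw1 _ (lw1 _ e)))))]; fnorm.
Tactic Notation "frw2" constr(e) :=
  first [rewrite (tr2 _ e) | rewrite (tr2 _ (lw2 _ e))
    | rewrite (tr2 _ (lw2 _ (lw2 _ e)))
    | rewrite (tr2 _ (lw2 _ (lw2 _ (lw2 _ e))))
    | rewrite (tr2 _ (lw2 _ (lw2 _ (lw2 _ (lw2 _ e)))))]; fnorm.
Tactic Notation "frw3" constr(e) :=
  first [rewrite (tr3 _ e) | rewrite (tr3 _ (lw3 _ e))
    | rewrite (tr3 _ (lw3 _ (lw3 _ e)))
    | rewrite (tr3 _ (lw3 _ (lw3 _ (lw3 _ e))))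
    | rewrite (tr3 _ (lw3 _ (lw3 _ (lw3 _ (lw3 _ e)))))]; fnorm.

(* Proves the strict form of e from e. *)
Ltac flat_by e W :=
  lazymatch type of e with ?f = ?g =>
    let f' := reify_mor f in let g' := reify_mor g in
    let E := fresh in
    pose proof (@strict_eq _ _ _ _ f' g' e W) as E;
    cbn [strict whisk flat val] in E;
    rewrite ?(mcomp1l, mcomp1r, tensm1, tenslM) -?mcompA in E;
    exact E
  end.

Ltac strip s x :=
  lazymatch s with
  | Leaf _ => lazymatch x with tensm (idm _) ?w => constr:(w) end
  | Unit => constr:(x)
  | Node ?s ?t => let y := strip s x in strip t y
  end.

(* u collects the factors to the left of the morphism g that is moved. *)
Ltac exchange_at u g x h :=
  lazymatch g with
  | tensm (idm ?A) ?g' => lazymatch x with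
    | tensm (idm _) ?x' => exchange_at (Node u (Leaf A)) g' x' h end
  | op ?s ?t ?f _ =>
    let w := strip s x in
    let e := constr:(@op_exchange _ _ u s t f _ _ w _ h) in
    let E := fresh in
    pose proof e as E; cbn [whisk flat val] in E; rewrite {}E
  end.

(* Normal form under the interchange law: of two morphisms on disjoint strands,
   the one on the left acts first. *)
Ltac exchange :=
  repeat (match goal with |- context [@mcomp ?k ?C _ _ _ ?g (mcomp ?x ?h)] =>
    exchange_at (@Unit (@ob k C)) g x h end; rewrite -?mcompA).

(* The words are read off from the type of f. *)
Notation "⟪ f ⟫ W" := (ltac:(
  let T := type of f in lazymatch eval cbn [val wmap] in T with Vector.sort (hom ?X ?Y) =>
    let s := reify_ob X in let t := reify_ob Y in exact (op s t f W) end))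
  (at level 0, f at level 99, W at level 0, only parsing) : mor_scope.

Notation "⟨ f ⟩ W" := (op _ _ f W) (at level 0, f at level 99, W at level 0, only printing) : mor_scope.

Section Exchange.
Variables (k : fieldType) (C : monCat k).
Implicit Types U V W : C.

Lemma exchange_leaf U V (f : hom U V) W W' (w : hom W W') Z (h : hom Z (U ⊗ W)) :
  (idm V ⊗ w) ∘ (⟪ f ⟫ W ∘ h) = ⟪ f ⟫ W' ∘ ((idm U ⊗ w) ∘ h).
Proof. by exchange. Qed.

Lemma exch1 U V (f : hom U V) W W' (w : hom W W') :
  (idm V ⊗ w) ∘ ⟪ f ⟫ W = ⟪ f ⟫ W' ∘ (idm U ⊗ w).
Proof. by apply: trail => Z h; fnorm; exchange. Qed.

Lemma exch_cap U V (b : hom (U ⊗ V) one) W W' (w : hom W W') :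
  w ∘ ⟪ b ⟫ W = ⟪ b ⟫ W' ∘ (idm U ⊗ (idm V ⊗ w)).
Proof. by apply: trail => Z h; fnorm; exchange. Qed.

Lemma exch22 U V U' V' (f : hom (U ⊗ V) (U' ⊗ V')) W W' (w : hom W W') :
  (idm U' ⊗ (idm V' ⊗ w)) ∘ ⟪ f ⟫ W = ⟪ f ⟫ W' ∘ (idm U ⊗ (idm V ⊗ w)).
Proof. by apply: trail => Z h; fnorm; exchange. Qed.

Lemma exch_cup U V (z : hom one (U ⊗ V)) W W' (w : hom W W') :
  (idm U ⊗ (idm V ⊗ w)) ∘ ⟪ z ⟫ W = ⟪ z ⟫ W' ∘ w.
Proof. by apply: trail => Z h; fnorm; exchange. Qed.

Lemma exchange_cap U V (b : hom (U ⊗ V) one) W W' (w : hom W W') Z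
    (h : hom Z (U ⊗ (V ⊗ W))) :
  w ∘ (⟪ b ⟫ W ∘ h) = ⟪ b ⟫ W' ∘ ((idm U ⊗ (idm V ⊗ w)) ∘ h).
Proof. by exchange. Qed.

Lemma exchange_cup U V (z : hom one (U ⊗ V)) W W' (w : hom W W') Z (h : hom Z W) :
  (idm U ⊗ (idm V ⊗ w)) ∘ (⟪ z ⟫ W ∘ h) = ⟪ z ⟫ W' ∘ (w ∘ h).
Proof. by exchange. Qed.
End Exchange.

(** * Ribbon categories *)

Section Ribbon.
Variables (k : fieldType) (C : ribCat k).
Implicit Types U V W X : C.

Lemma snake1 U W : (idm U ⊗ ⟪ ev U ⟫ W) ∘ ⟪ coev U ⟫ (U ⊗ W) = idm _.
Proof. flat_by (zigzag1 U) W. Qed.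

Lemma snake2 U W : ⟪ ev U ⟫ (U^∨ ⊗ W) ∘ (idm U^∨ ⊗ ⟪ coev U ⟫ W) = idm _.
Proof. flat_by (zigzag2 U) W. Qed.

Lemma braid_tensr U V X W :
  ⟪ braid U (V ⊗ X) ⟫ W = (idm V ⊗ ⟪ braid U X ⟫ W) ∘ ⟪ braid U V ⟫ (X ⊗ W).
Proof. flat_by (hexagon1 U V X) W. Qed.

Lemma braid_tensl U V X W :
  ⟪ braid (U ⊗ V) X ⟫ W = ⟪ braid U X ⟫ (V ⊗ W) ∘ (idm U ⊗ ⟪ braid V X ⟫ W).
Proof. flat_by (hexagon2 U V X) W. Qed.

Lemma braidKf U V W : ⟪ braidi U V ⟫ W ∘ ⟪ braid U V ⟫ W = idm _.
Proof. flat_by (braidK U V) W. Qed.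

Lemma braidiKf U V W : ⟪ braid U V ⟫ W ∘ ⟪ braidi U V ⟫ W = idm _.
Proof. flat_by (braidiK U V) W. Qed.

(** Braiding with 1 ⊗ 1 is braiding with 1 twice, and it is also braiding with 1
    once; an invertible idempotent is the identity. *)
Lemma braid_oner U W : ⟪ braid U one ⟫ W = idm _.
Proof.
have e : ⟪ braid U one ⟫ W = ⟪ braid U (one ⊗ one) ⟫ W.
  flat_by (braid_nat (idm U) (lun (one : C))) W.
have e2 : ⟪ braid U (one ⊗ one) ⟫ W = ⟪ braid U one ⟫ W ∘ ⟪ braid U one ⟫ W.
  flat_by (hexagon1 U one one) W.
have b : ⟪ braidi U one ⟫ W ∘ ⟪ braid U one ⟫ W = idm _ by flat_by (braidK U one) W.
by apply: (compIl b); rewrite mcomp1r {3}e.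
Qed.

Lemma braid_onel U W : ⟪ braid one U ⟫ W = idm _.
Proof.
have e : ⟪ braid one U ⟫ W = ⟪ braid (one ⊗ one) U ⟫ W.
  flat_by (braid_nat (lun (one : C)) (idm U)) W.
have e2 : ⟪ braid (one ⊗ one) U ⟫ W = ⟪ braid one U ⟫ W ∘ ⟪ braid one U ⟫ W.
  flat_by (hexagon2 one one U) W.
have b : ⟪ braidi one U ⟫ W ∘ ⟪ braid one U ⟫ W = idm _ by flat_by (braidK one U) W.
by apply: (compIl b); rewrite mcomp1r {3}e.
Qed.

(** As braid_onel with U = 1; the unit disappears from the flattened objects, so
    the strict form is a different one. *)
Lemma braid_one_one W : ⟪ braid one (one : C) ⟫ W = idm _.
Proof.
have e : ⟪ braid one (one : C) ⟫ W = ⟪ braid (one ⊗ one) (one : C) ⟫ W.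
  flat_by (braid_nat (lun (one : C)) (idm one)) W.
have e2 : ⟪ braid (one ⊗ one) (one : C) ⟫ W = ⟪ braid one (one : C) ⟫ W ∘ ⟪ braid one (one : C) ⟫ W.
  flat_by (hexagon2 one one (one : C)) W.
have b : ⟪ braidi one (one : C) ⟫ W ∘ ⟪ braid one (one : C) ⟫ W = idm _ by flat_by (braidK one (one : C)) W.
by apply: (compIl b); rewrite mcomp1r {3}e.
Qed.

Lemma twist_one : twist (one : C) = idm one.
Proof.
have e : twist (one : C) = twist one ∘ twist one.
  rewrite -[LHS]mcomp1r -(luniK one) mcompA twist_nat balancing.
  flatten; rewrite (tr1 _ (braid_one_one W)); fnorm.
  by rewrite (tr1 _ (braid_one_one W)); fnorm.
by apply: (compIl (twistK (one : C))); rewrite mcomp1r -e.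
Qed.

Lemma full_twist X Y (z : hom one (X ⊗ Y)) :
  braid Y X ∘ braid X Y ∘ (twist X ⊗ twist Y) ∘ z = z.
Proof. by rewrite -balancing twist_nat twist_one mcomp1r. Qed.

(** A strand passes freely over or under a cup or a cap, by naturality of the
    braiding and its triviality on the unit. *)
Lemma slide_r U X Y (z : hom one (X ⊗ Y)) W :
  (idm X ⊗ ⟪ braid U Y ⟫ W) ∘ (⟪ braid U X ⟫ (Y ⊗ W) ∘ (idm U ⊗ ⟪ z ⟫ W)) =
  ⟪ z ⟫ (U ⊗ W).
Proof.
rewrite mcompA -braid_tensr -[RHS]mcomp1r -(braid_oner U W).
flat_by (braid_nat (idm U) z) W.
Qed.

Lemma slide_l U X Y (z : hom one (X ⊗ Y)) W :
  ⟪ braid X U ⟫ (Y ⊗ W) ∘ ((idm X ⊗ ⟪ braid Y U ⟫ W) ∘ ⟪ z ⟫ (U ⊗ W))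
  = idm U ⊗ ⟪ z ⟫ W.
Proof.
rewrite mcompA -braid_tensl -[RHS]mcomp1r -(braid_onel U W).
flat_by (braid_nat z (idm U)) W.
Qed.

Lemma slide_capr U X Y (z : hom (X ⊗ Y) one) W :
  (idm U ⊗ ⟪ z ⟫ W) ∘ (⟪ braid X U ⟫ (Y ⊗ W) ∘ (idm X ⊗ ⟪ braid Y U ⟫ W))
  = ⟪ z ⟫ (U ⊗ W).
Proof.
rewrite -braid_tensl -[RHS]mcomp1l -(braid_onel U W).
apply: esym; flat_by (braid_nat z (idm U)) W.
Qed.

Lemma slide_capl U X Y (z : hom (X ⊗ Y) one) W :
  ⟪ z ⟫ (U ⊗ W) ∘ ((idm X ⊗ ⟪ braid U Y ⟫ W) ∘ ⟪ braid U X ⟫ (Y ⊗ W))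
  = idm U ⊗ ⟪ z ⟫ W.
Proof.
rewrite -braid_tensr -[RHS]mcomp1l -(braid_oner U W).
apply: esym; flat_by (braid_nat (idm U) z) W.
Qed.

Lemma ev'E U W :
  ⟪ ev' U ⟫ W = ⟪ ev U ⟫ W ∘ (⟪ braid U U^∨ ⟫ W ∘ ⟪ twist U ⟫ (U^∨ ⊗ W)).
Proof. flat_by (erefl : ev' U = ev U ∘ braid U U^∨ ∘ (twist U ⊗ idm U^∨)) W. Qed.

Lemma coev'E U W :
  ⟪ coev' U ⟫ W = (idm U^∨ ⊗ ⟪ twist U ⟫ W) ∘ (⟪ braid U U^∨ ⟫ W ∘ ⟪ coev U ⟫ W).
Proof.
flat_by (erefl : coev' U = (idm U^∨ ⊗ twist U) ∘ braid U U^∨ ∘ coev U) W.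
Qed.

(** full_twist for coev, with both twists on the same leg. *)
Lemma coev_full_twist U W :
  ⟪ braid U^∨ U ⟫ W ∘ (⟪ braid U U^∨ ⟫ W ∘
    (⟪ twist U ⟫ (U^∨ ⊗ W) ∘ (⟪ twist U ⟫ (U^∨ ⊗ W) ∘ ⟪ coev U ⟫ W)))
  = ⟪ coev U ⟫ W.
Proof.
have e : braid U^∨ U ∘ braid U U^∨ ∘ (twist U ⊗ idm U^∨) ∘ (twist U ⊗ idm U^∨)
    ∘ coev U = coev U.
  rewrite -[RHS]full_twist -!mcompA twist_dual [in LHS](mcompA (twist U ⊗ _)).
  by rewrite -tensmM mcomp1l mcomp1r.
flat_by e W.
Qed.

Lemma braid_twistl U V W :
  (idm V ⊗ ⟪ twist U ⟫ W) ∘ ⟪ braid U V ⟫ W = ⟪ braid U V ⟫ W ∘ ⟪ twist U ⟫ (V ⊗ W).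
Proof. flat_by (esym (braid_nat (twist U) (idm V))) W. Qed.

Lemma braid_twistr U V W :
  ⟪ twist V ⟫ (U ⊗ W) ∘ ⟪ braid U V ⟫ W = ⟪ braid U V ⟫ W ∘ (idm U ⊗ ⟪ twist V ⟫ W).
Proof. flat_by (esym (braid_nat (idm U) (twist V))) W. Qed.

Lemma yang_baxter U V X W :
  ⟪ braid V X ⟫ (U ⊗ W) ∘ ((idm V ⊗ ⟪ braid U X ⟫ W) ∘ ⟪ braid U V ⟫ (X ⊗ W))
  = (idm X ⊗ ⟪ braid U V ⟫ W) ∘ (⟪ braid U X ⟫ (V ⊗ W) ∘ (idm U ⊗ ⟪ braid V X ⟫ W)).
Proof.
rewrite -braid_tensl mcompA -braid_tensl.
flat_by (braid_nat (braid U V) (idm X)) W.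
Qed.

(** The twists in ev' and coev' undo the full twist that the two braidings form. *)
Lemma snake2' U W :
  (idm U^∨ ⊗ ⟪ ev' U ⟫ W) ∘ ⟪ coev' U ⟫ (U^∨ ⊗ W) = idm (U^∨ ⊗ W).
Proof.
rewrite ev'E coev'E; fnorm; apply: trail => Z h; fnorm.
frw2 (braid_twistl U U^∨ (U^∨ ⊗ W)); frw2 (braid_twistl U U^∨ (U^∨ ⊗ W)).
rewrite -(slide_capl U^∨ (ev U)); fnorm.
frw3 (yang_baxter U U^∨ U^∨ W).
rewrite exchange_leaf; frw2 (esym (braid_twistl U U^∨ (U^∨ ⊗ W))).
rewrite exchange_leaf; frw2 (esym (braid_twistl U U^∨ (U^∨ ⊗ W))).
frw3 (slide_l U^∨ (coev U) W); frw5 (coev_full_twist U W); frw2 (snake2 U W).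
by [].
Qed.

Lemma snake1' U W :
  ⟪ ev' U ⟫ (U ⊗ W) ∘ (idm U ⊗ ⟪ coev' U ⟫ W) = idm (U ⊗ W).
Proof.
pose E := lun U ∘ (ev U ⊗ idm U) ∘ (braid U U^∨ ⊗ idm U) ∘ associ _ _ _
  ∘ (idm U ⊗ (braid U U^∨ ∘ coev U)) ∘ runi U.
have full : twist U ∘ E ∘ twist U
   = lun U ∘ (ev' U ⊗ idm U) ∘ associ _ _ _ ∘ (idm U ⊗ coev' U) ∘ runi U.
  by rewrite /E; flatten; frw1 (ev'E U (U ⊗ W0)); frw1 (coev'E U W0); exchange.
have unwound : twist U ∘ twist U ∘ E = idm U.
  rewrite /E; flatten.
  rewrite -(slide_capr U (ev U)); fnorm.
  frw3 (esym (yang_baxter U U U^∨ W0)); frw3 (slide_r U (coev U) W0).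
  exchange.
  frw2 (braid_twistr U^∨ U (U ⊗ W0)); frw2 (braid_twistr U^∨ U (U ⊗ W0)).
  frw2 (braid_twistl U U^∨ (U ⊗ W0)); frw2 (braid_twistl U U^∨ (U ⊗ W0)).
  by frw5 (coev_full_twist U (U ⊗ W0)); frw2 (snake1 U W0).
by move: full; rewrite -mcompA -twist_nat mcompA unwound => /esym full; flat_by full W.
Qed.

Lemma form_of_map_inj X Y (s t : hom X Y^∨) :
  ev Y ∘ (s ⊗ idm Y) = ev Y ∘ (t ⊗ idm Y) -> s = t.
Proof.
have E (r : hom X Y^∨) : r = lun _ ∘ ((ev Y ∘ (r ⊗ idm Y)) ⊗ idm _) ∘ associ _ _ _
    ∘ (idm X ⊗ coev Y) ∘ runi X.
  flatten; exchange.
  frw2 (snake2 Y W).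
  by [].
by move=> e; rewrite [s]E [t]E e.
Qed.

Lemma slide_over_cup U X Y (z : hom one (X ⊗ Y)) W :
  ⟪ braid U X ⟫ (Y ⊗ W) ∘ (idm U ⊗ ⟪ z ⟫ W)
  = (idm X ⊗ ⟪ braidi U Y ⟫ W) ∘ ⟪ z ⟫ (U ⊗ W).
Proof.
rewrite -(slide_r U z); apply: trail => Z h; fnorm.
by frw2 (braidKf U Y W).
Qed.

Lemma slide_under_cup U X Y (z : hom one (X ⊗ Y)) W :
  (idm X ⊗ ⟪ braid Y U ⟫ W) ∘ ⟪ z ⟫ (U ⊗ W)
  = ⟪ braidi X U ⟫ (Y ⊗ W) ∘ (idm U ⊗ ⟪ z ⟫ W).
Proof.
rewrite -(slide_l U z); apply: trail => Z h; fnorm.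
by frw2 (braidKf X U (Y ⊗ W)).
Qed.

Lemma slide_under_cap U X Y (z : hom (X ⊗ Y) one) W :
  (idm U ⊗ ⟪ z ⟫ W) ∘ ⟪ braid X U ⟫ (Y ⊗ W)
  = ⟪ z ⟫ (U ⊗ W) ∘ (idm X ⊗ ⟪ braidi Y U ⟫ W).
Proof.
rewrite -(slide_capr U z); apply: trail => Z h; fnorm.
by frw2 (braidiKf Y U W).
Qed.

Lemma slide_over_cap U X Y (z : hom (X ⊗ Y) one) W :
  (idm U ⊗ ⟪ z ⟫ W) ∘ ⟪ braidi U X ⟫ (Y ⊗ W)
  = ⟪ z ⟫ (U ⊗ W) ∘ (idm X ⊗ ⟪ braid U Y ⟫ W).
Proof.
rewrite -(slide_capl U z); apply: trail => Z h; fnorm.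
by frw2 (braidiKf U X (Y ⊗ W)).
Qed.

(** Cyclic rotation of an invariant. The leg may be carried round on either side
    of the other one, with the twist on either leg (rot_right, rot_inv). *)
Definition rot X Y (z : hom one (X ⊗ Y)) : hom one (Y ⊗ X) :=
  locked_with op_key ((twist Y ⊗ idm X) ∘ braid X Y ∘ z).

Lemma rot_left X Y (z : hom one (X ⊗ Y)) :
  rot z = (twist Y ⊗ idm X) ∘ braid X Y ∘ z.
Proof. by rewrite /rot unlock. Qed.

Definition symmetric_form (A : C) (b : hom (A ⊗ A) one) :=
  b ∘ ((twist A ⊗ idm A) ∘ braid A A) = b.

(** Both sides of the symmetry condition are maps to the dual; composed with ev
    they are the form and the rotated form. *)
Lemma symmetric_frobE (A : frobData C) :
  symmetric_frob A <-> symmetric_form (fcounit A ∘ fmul A).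
Proof.
rewrite /symmetric_frob /symmetric_form; move: (fcounit A ∘ fmul A) => b.
set s := (X in X = _); set t := (X in _ = X).
have es : ev A ∘ (s ⊗ idm A) = b.
  by rewrite /s; flatten; rewrite exchange_cap; frw2 (snake1 A W).
have et : ev A ∘ (t ⊗ idm A) = b ∘ ((twist A ⊗ idm A) ∘ braid A A).
  rewrite /t; flatten; frw1 (coev'E A (A ⊗ (A ⊗ W))).
  pose q := b ∘ (twist A ⊗ idm A).
  have eq W' : ⟪ q ⟫ W' = ⟪ b ⟫ W' ∘ ⟪ twist A ⟫ (A ⊗ W').
    by flat_by (erefl : q = b ∘ (twist A ⊗ idm A)) W'.
  frw2 (esym (eq (A ⊗ W)%ob)); frw2 (slide_under_cap A^∨ q (A ⊗ W)).
  rewrite exchange_cap; frw2 (slide_over_cap A (ev A) W); rewrite exchange_cup; frw2 (snake1 A (A ⊗ W)).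
  by frw1 (eq W).
split=> [e|e]; first by rewrite -et -e.
by apply: form_of_map_inj; rewrite es et e.
Qed.

Lemma rot_nat X Y X' Y' (f : hom X X') (g : hom Y Y') (z : hom one (X ⊗ Y)) :
  rot ((f ⊗ g) ∘ z) = (g ⊗ f) ∘ rot z.
Proof.
rewrite !rot_left -!mcompA (mcompA (braid _ _)) braid_nat !mcompA -!tensmM.
by rewrite mcomp1l mcomp1r twist_nat.
Qed.

Lemma rotK X Y (z : hom one (X ⊗ Y)) : rot (rot z) = z.
Proof.
rewrite -[RHS]full_twist !rot_left -!mcompA (mcompA (braid Y X)) braid_nat !mcompA.
rewrite -tensmM mcomp1l mcomp1r -[in RHS](mcompA (braid Y X)) !braid_nat.
by rewrite mcompA braid_nat.
Qed.

Lemma rot_inv X Y (z : hom one (X ⊗ Y)) :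
  rot z = (idm Y ⊗ twisti X) ∘ braidi Y X ∘ z.
Proof.
rewrite -[in RHS](full_twist z) -!mcompA (mcompA (braidi _ _)) braidK mcomp1l.
rewrite (mcompA (braid _ _)) braid_nat !mcompA -tensmM.
by rewrite twistK mcomp1l rot_left.
Qed.

(** Any invariant is obtained from coev by a map on the second leg, so
    twist_dual extends to all invariants. *)
Lemma twisted_cup_sym X Y (z : hom one (X ⊗ Y)) :
  (twist X ⊗ idm Y) ∘ z = (idm X ⊗ twist Y) ∘ z.
Proof.
have E : z = (idm X ⊗ (lun _ ∘ (ev X ⊗ idm Y) ∘ associ _ _ _ ∘ (idm X^∨ ⊗ z) ∘ runi _))
    ∘ coev X.
  flatten; rewrite !exchange_cup.
  by frw2 (snake1 X (Y ⊗ W)).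
rewrite E; set g := (G in idm X ⊗ G); rewrite !mcompA -!tensmM mcomp1l mcomp1r.
rewrite twist_nat -(tensm_rl (twist X) g) -mcompA twist_dual mcompA.
by rewrite -tensmM !mcomp1l.
Qed.

Lemma rot_right X Y (z : hom one (X ⊗ Y)) :
  rot z = (idm Y ⊗ twist X) ∘ braid X Y ∘ z.
Proof.
rewrite !rot_left -!braid_nat -mcompA -[RHS]mcompA twisted_cup_sym.
by [].
Qed.

Lemma rot_tens X X' Y (z : hom one ((X ⊗ X') ⊗ Y)) :
  rot z = assoc _ _ _ ∘ rot (assoc _ _ _ ∘ rot (assoc _ _ _ ∘ z)).
Proof.
rewrite !rot_right balancing; flatten.
frw1 (braid_tensl X X' Y W).
frw1 (braid_tensr X X' Y W).
frw1 (braid_tensr X' Y X W).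
exchange.
frw2 (esym (braid_twistr X X' W)); frw2 (esym (braid_twistl X' X W)).
frw2 (esym (braid_twistl X X' W)); do 2!frw2 (esym (braid_twistr X' X W)).
by frw3 (esym (yang_baxter X X' Y W)).
Qed.
End Ribbon.

(** * Schur's lemma and traces *)

Section Linear.
Variables (k : fieldType) (C : linCat k).
Implicit Types U V W : C.

Lemma mcompZl U V W a (g : hom V W) (f : hom U V) : (a *: g)%R ∘ f = (a *: (g ∘ f))%R.
Proof. by rewrite -[(a *: g)%R]addr0 mcompDl mcomp0l addr0. Qed.

Lemma mcompZr U V W a (g : hom V W) (f : hom U V) : g ∘ (a *: f)%R = (a *: (g ∘ f))%R.
Proof. by rewrite -[(a *: f)%R]addr0 mcompDr mcomp0r addr0. Qed.

Lemma mcompBr U V W (g : hom V W) (f f' : hom U V) :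
  g ∘ (f - f')%R = (g ∘ f - g ∘ f')%R.
Proof. by rewrite addrC -scaleN1r mcompDr scaleN1r addrC. Qed.

Lemma mcompBl U V W (g g' : hom V W) (f : hom U V) :
  (g - g')%R ∘ f = (g ∘ f - g' ∘ f)%R.
Proof. by rewrite addrC -scaleN1r mcompDl scaleN1r addrC. Qed.

Lemma schur U V (f : hom U V) :
  abelian C -> is_simple U -> is_simple V -> f <> 0 -> is_iso f.
Proof.
move=> abC [nU sU] [nV sV] nf; have [K [i [fi0 iU]]] := has_kernels abC f.
have mi : is_mono i.
  move=> W g h e.
  have /iU[x [_ ux]] : f ∘ (i ∘ g) = 0 by rewrite mcompA fi0 mcomp0l.
  by rewrite -(ux g) // -(ux h).
have [i0|[j [_ ij]]] := sU _ i mi; last first.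
  by case: nf; rewrite -[f]mcomp1r -ij mcompA fi0 mcomp0l.
have mf : is_mono f.
  move=> W g h e; have /iU[x [ex _]] : f ∘ (g - h)%R = 0 by rewrite mcompBr e subrr.
  by apply/eqP; rewrite -subr_eq0 -ex i0 mcomp0l.
by case: (sV _ f mf).
Qed.
End Linear.

Section MonLinear.
Variables (k : fieldType) (C : monCat k).
Implicit Types U V W : C.

Lemma tensmZl U U' V V' a (f : hom U U') (g : hom V V') :
  (a *: f)%R ⊗ g = (a *: (f ⊗ g))%R.
Proof.
by rewrite -[(a *: f)%R]addr0 (tensm_bilinear _ _ _ _).1 tensm0l addr0.
Qed.

Lemma tensmZr U U' V V' a (f : hom U U') (g : hom V V') :
  f ⊗ (a *: g)%R = (a *: (f ⊗ g))%R.
Proof.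
by rewrite -[(a *: g)%R]addr0 (tensm_bilinear _ _ _ _).2 tensm0r addr0.
Qed.
End MonLinear.

Section Traces.
Variables (k : fieldType) (C : ribCat k).
Implicit Types U V W X Y : C.

(** Traces can be taken with any b and e that satisfy this one identity; the
    result does not depend on them, by tr_cyclic. *)
Definition snake X Y (b : hom one (X ⊗ Y)) (e : hom (Y ⊗ X) one) :=
  run X ∘ (idm X ⊗ e) ∘ assoc X Y X ∘ (b ⊗ idm X) ∘ luni X = idm X.

Lemma snakeP X Y (b : hom one (X ⊗ Y)) (e : hom (Y ⊗ X) one) W :
  snake b e -> (idm X ⊗ ⟪ e ⟫ W) ∘ ⟪ b ⟫ (X ⊗ W) = idm (X ⊗ W).
Proof. by rewrite /snake => s; flat_by s W. Qed.

Definition tr X Y (b : hom one (X ⊗ Y)) (e : hom (Y ⊗ X) one) (f : hom X X) :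
    hom (one : C) one :=
  e ∘ rot ((f ⊗ idm Y) ∘ b).

Lemma tr_cyclic X Y X2 Y2 (b : hom one (X ⊗ Y)) (e : hom (Y ⊗ X) one)
    (b2 : hom one (X2 ⊗ Y2)) (e2 : hom (Y2 ⊗ X2) one) (f : hom X X2) (g : hom X2 X) :
  snake b e -> snake b2 e2 -> tr b e (g ∘ f) = tr b2 e2 (f ∘ g).
Proof.
move=> s s2.
pose f' := lun Y ∘ (e2 ⊗ idm Y) ∘ associ _ _ _ ∘ (idm Y2 ⊗ ((f ⊗ idm Y) ∘ b)) ∘ runi Y2.
have fb : (f ⊗ idm Y) ∘ b = (idm X2 ⊗ f') ∘ b2.
  rewrite /f'; flatten; rewrite !exchange_cup.
  by frw2 (snakeP (Y ⊗ W) s2).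
have fe : e2 ∘ (idm Y2 ⊗ f) = e ∘ (f' ⊗ idm X).
  rewrite /f'; flatten; rewrite exchange_cap.
  by frw2 (exch1 f (⟪ e ⟫ W)); frw2 (snakeP W s).
rewrite /tr tensrM -mcompA fb mcompA -tensmM mcomp1l mcomp1r !rot_nat.
by rewrite tenslM !mcompA fe -[in RHS](mcompA e) tensm_lr.
Qed.

Lemma tr1E U : ev U ∘ coev' U = tr (coev U) (ev U) (idm U).
Proof. by rewrite /tr tensm1 mcomp1l rot_right. Qed.

Lemma tr_sum X Y (b : hom one (X ⊗ Y)) (e : hom (Y ⊗ X) one) (I : finType)
    (F : I -> hom X X) :
  tr b e (\sum_i F i)%R = (\sum_i tr b e (F i))%R.
Proof.
rewrite /tr tensm_suml mcomp_suml rot_left mcomp_sumr mcomp_sumr.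
by apply: eq_bigr => i _; rewrite rot_left.
Qed.

Lemma snake_coev U : snake (coev U) (ev U).
Proof. exact: zigzag1. Qed.

Lemma snake_coev' U : snake (coev' U) (ev' U).
Proof. by rewrite /snake; flatten; frw2 (snake2' U W). Qed.

Lemma rot_coev U : rot (coev U) = coev' U.
Proof. by rewrite rot_right. Qed.

(** A duality for U ⊗ V whose trace is visibly the product of the two traces. *)
Definition nest_coev U V := associ U V (V^∨ ⊗ U^∨)
  ∘ (idm U ⊗ (assoc _ _ _ ∘ (coev V ⊗ idm U^∨) ∘ luni U^∨)) ∘ coev U.
Definition nest_ev U V := ev V
  ∘ (idm V^∨ ⊗ (lun V ∘ (ev U ⊗ idm V) ∘ associ _ _ _)) ∘ assoc V^∨ U^∨ (U ⊗ V).

Lemma snake_nest U V : snake (nest_coev U V) (nest_ev U V).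
Proof.
rewrite /snake /nest_coev /nest_ev; flatten; exchange.
frw2 (exch_cup (coev V) (⟪ ev U ⟫ (V ⊗ W))); frw2 (snake1 V W).
by frw2 (snake1 U (V ⊗ W)).
Qed.

Lemma rot_nest U V : rot (nest_coev U V) =
   assoc _ _ _ ∘ ((associ _ _ _ ∘ (idm V^∨ ⊗ coev' U) ∘ runi V^∨) ⊗ idm V) ∘ coev' V.
Proof.
pose g := assoc _ _ _ ∘ (coev V ⊗ idm U^∨) ∘ luni U^∨.
pose g' := associ _ _ _ ∘ (idm V^∨ ⊗ coev' U) ∘ runi V^∨.
have e : assoc _ _ _ ∘ nest_coev U V = (idm U ⊗ g) ∘ coev U.
  by rewrite /nest_coev !mcompA associK mcomp1l.
have e' : assoc _ _ _ ∘ ((g ⊗ idm U) ∘ coev' U) = (idm V ⊗ g') ∘ coev V.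
  by rewrite /g /g'; flatten; exchange.
by rewrite rot_tens e rot_nat rot_coev e' rot_nat rot_coev mcompA.
Qed.

Lemma tr_nest U V : tr (nest_coev U V) (nest_ev U V) (idm (U ⊗ V))
  = ev V ∘ (idm V^∨ ⊗ (lun V ∘ ((ev U ∘ coev' U) ⊗ idm V) ∘ luni V)) ∘ coev' V.
Proof.
rewrite /tr tensm1 mcomp1l rot_nest /nest_ev; flatten; exchange; by [].
Qed.

(** Rotating coev' back into coev shows that the trace over U^∨ closes up the same
    loop as that over U. *)
Lemma tr_dual U : ev U^∨ ∘ coev' U^∨ = ev U ∘ coev' U.
Proof.
rewrite !tr1E.
transitivity (tr (coev' U) (ev' U) (idm U^∨)).
  have := tr_cyclic (idm U^∨) (idm U^∨) (@snake_coev U^∨) (@snake_coev' U).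
  by rewrite mcomp1l.
rewrite -!tr1E /tr tensm1 mcomp1l -rot_coev rotK rot_coev /ev' /coev'.
by rewrite -!mcompA; congr (_ ∘ _); rewrite !mcompA braid_nat.
Qed.

End Traces.

(** * Dimensions in a modular category *)

Section Modular.
Variables (k : fieldType) (C : modularCat k) (B : dualBases C).
Implicit Types U V W X : C.
Local Notation "'n" := (nsimple C).

Lemma bup_neq0 V i a : tnth (bup B V i) a <> 0.
Proof.
move=> e; have /basis_free/free_not0 := bup_basis B V i.
by move/(_ (tnth (bup B V i) a) (mem_tnth _ _)); rewrite e eqxx.
Qed.

Lemma blo_neq0 V i a : tnth (blo B V i) a <> 0.
Proof.
move=> e; have /basis_free/free_not0 := blo_basis B V i.
by move/(_ (tnth (blo B V i) a) (mem_tnth _ _)); rewrite e eqxx.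
Qed.

Lemma bup_span V i (f : hom V (smp i)) :
  exists c : 'I_(\dim {:hom V (smp i)}) -> k, f = (\sum_a c a *: tnth (bup B V i) a)%R.
Proof.
exists (fun a => coord (bup B V i) a f).
rewrite {1}(coord_basis (bup_basis B V i) (memvf f)).
by apply: eq_bigr => a _; rewrite (tnth_nth 0).
Qed.

Lemma blo_span V i (f : hom (smp i) V) :
  exists c : 'I_(\dim {:hom V (smp i)}) -> k, f = (\sum_a c a *: tnth (blo B V i) a)%R.
Proof.
exists (fun a => coord (blo B V i) a f).
rewrite {1}(coord_basis (blo_basis B V i) (memvf f)).
by apply: eq_bigr => a _; rewrite (tnth_nth 0).
Qed.

Lemma smp_schur i j (f : hom (smp i : C) (smp j)) : f <> 0 -> is_iso f.
Proof. by apply: schur; [exact: mod_abelian | exact: smp_simple | exact: smp_simple]. Qed.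

Lemma hom_smp0 i j (f : hom (smp i : C) (smp j)) : i != j -> f = 0.
Proof.
move=> nij; have [//|/eqP nf] := eqVneq f 0.
by case/eqP: nij; apply: smp_inj; exists f; exact: smp_schur.
Qed.

(** In the division algebra End U_i the products of the basis with its dual
    basis vanish off the diagonal, so the basis has a single element. *)
Lemma dim_end_smp i : \dim {:hom (smp i : C) (smp i)} = 1%N.
Proof.
case E : (\dim {:hom (smp i : C) (smp i)}) => [|[|m]] //.
  move/eqP: E; rewrite dimv_eq0 => /eqP E.
  case: (smp_simple i) => ni _; case: ni.
  by apply/eqP; rewrite -memv0 -E memvf.
have lt0 : (0 < \dim {:hom (smp i : C) (smp i)})%N by rewrite E.
have lt1 : (1 < \dim {:hom (smp i : C) (smp i)})%N by rewrite E.
have := bup_blo B (V := smp i) (i := i) (Ordinal lt0) (Ordinal lt1).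
rewrite scale0r => e0; exfalso.
have [g [gf fg]] := smp_schur (bup_neq0 (V := smp i) (i := i) (a := Ordinal lt0)).
by apply: (@blo_neq0 (smp i) i (Ordinal lt1)); rewrite -[LHS]mcomp1l -gf -mcompA e0 mcomp0r.
Qed.

Lemma end_smp i (f : hom (smp i : C) (smp i)) : exists c : k, f = (c *: idm _)%R.
Proof.
have d1 : \dim <[idm (smp i : C)]> = 1%N.
  by rewrite dim_vline; case: (smp_simple i) => /eqP ->.
have e : <[idm (smp i : C)]>%VS = fullv.
  by apply/eqP; rewrite eqEdim subvf d1 dim_end_smp.
have : f \in <[idm (smp i : C)]>%VS by rewrite e memvf.
by case/vlineP => c ->; exists c.
Qed.

Lemma unit_smp : exists (i : 'I_'n) (f : hom one (smp i)), is_iso f.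
Proof. by have [i [f If]] := smp_surj (mod_one_simple C); exists i, f. Qed.

Lemma end_one (f : hom (one : C) one) : exists c : k, f = (c *: idm one)%R.
Proof.
have [i [g [g' [gK g'K]]]] := unit_smp.
have [c e] := end_smp (g ∘ f ∘ g'); exists c.
rewrite -[f]mcomp1l -gK -[f]mcomp1r -[idm one in LHS]gK.
have -> : g' ∘ g ∘ (f ∘ (g' ∘ g)) = g' ∘ (g ∘ f ∘ g') ∘ g by rewrite !mcompA.
by rewrite e mcompZr mcomp1r mcompZl.
Qed.

Lemma scalar_ofZ (c : k) : scalar_of (c *: idm (one : C))%R = c.
Proof.
rewrite /scalar_of linearZ /= (coord_free 0 ord0) /= ?mulr1 //.
by rewrite /free /= span_seq1 dim_vline; case: (mod_one_simple C) => /eqP ->.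
Qed.

Lemma scalar_ofE (f : hom (one : C) one) : f = (scalar_of f *: idm one)%R.
Proof. by have [c ->] := end_one f; rewrite scalar_ofZ. Qed.

Lemma scaler_one_inj (a b : k) : (a *: idm (one : C) = b *: idm one)%R -> a = b.
Proof. by move/(congr1 (@scalar_of _ _)); rewrite !scalar_ofZ. Qed.

(** By semisimplicity it is enough to compose with morphisms from simple objects,
    which are combinations of the dual basis. *)
Lemma complete V : (\sum_i \sum_a tnth (blo B V i) a ∘ tnth (bup B V i) a)%R = idm V.
Proof.
set e := (LHS).
have eb i b : e ∘ tnth (blo B V i) b = tnth (blo B V i) b.
  have e0 j : j != i -> (\sum_a tnth (blo B V j) a ∘ tnth (bup B V j) a)%R
      ∘ tnth (blo B V i) b = 0.
    move=> nji; rewrite mcomp_suml big1 // => a _.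
    by rewrite -mcompA (hom_smp0 (_ ∘ _)) ?mcomp0r // eq_sym.
  rewrite /e mcomp_suml (bigD1 i) //= [X in (_ + X)%R]big1 // addr0 mcomp_suml.
  rewrite (bigD1 b) //= -mcompA bup_blo eqxx scale1r mcomp1r big1 ?addr0 // => a nab.
  by rewrite -mcompA bup_blo (negPf nab) scale0r mcomp0r.
have ef i (f : hom (smp i) V) : e ∘ f = f.
  have [c ->] := blo_span f; rewrite mcomp_sumr; apply: eq_bigr => a _.
  by rewrite mcompZr eb.
have es X (f : hom X V) : is_simple X -> e ∘ f = f.
  case/smp_surj => i [g [g' [gK _]]].
  by rewrite -[f]mcomp1r -gK (mcompA f) mcompA ef.
have [J [X [sX [f [f' [fK f'K]]]]]] := mod_semisimple V.
suff: e ∘ (f' ∘ f) = f' ∘ f by rewrite fK mcomp1r.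
rewrite -(mcomp1l f) -(dsum_id (mod_sums C) X) mcomp_suml !mcomp_sumr.
apply: eq_bigr => j _.
by rewrite -(mcompA (dinj _ _ _)) (mcompA f') (mcompA e) es.
Qed.

(** By complete only the simple summands of V matter; f vanishes on those not
    isomorphic to the unit by Schur's lemma, and the others are invariants. *)
Lemma one_faithful V (f : hom V one) : (forall x : hom one V, f ∘ x = 0) -> f = 0.
Proof.
move=> f0; rewrite -[f]mcomp1r -complete mcomp_sumr big1 // => i _.
rewrite mcomp_sumr big1 // => a _; rewrite mcompA.
suff f0i (b : hom (smp i) V) : f ∘ b = 0 by rewrite f0i mcomp0l.
have [i0 [g [g' [gK g'K]]]] := unit_smp.
have [ei|ni] := eqVneq i0 i.
  by subst i0; rewrite -[b]mcomp1r -g'K (mcompA _ g) (mcompA f) f0 !mcomp0l.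
rewrite -[LHS]mcomp1l -gK -mcompA (hom_smp0 (g ∘ _)) ?mcomp0r //.
by rewrite eq_sym.
Qed.

(** Hom(X^∨ ⊗ X, 1) is a line when X is simple, being isomorphic to End X. If
    ev ∘ coev' were zero, all its elements would kill coev'; then coev' = 0 by
    complete, and X would be zero. *)
Lemma ev_coev'_neq0 i : ev (smp i : C) ∘ coev' (smp i) <> 0.
Proof.
move=> e0; set X := smp i in e0 *.
have evs (f : hom (X^∨ ⊗ X)%ob one) : f ∘ coev' X = 0.
  have [c ec] := end_smp (run X ∘ (idm X ⊗ f) ∘ assoc _ _ _ ∘ (coev X ⊗ idm X) ∘ luni X).
  suff -> : f = (c *: ev X)%R by rewrite mcompZl e0 scaler0.
  have <- : ev X ∘ (idm X^∨ ⊗ (c *: idm X)%R) = (c *: ev X)%R.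
    by rewrite tensmZr tensm1 mcompZr mcomp1r.
  rewrite -ec; flatten; rewrite -exchange_cap.
  by frw2 (snake2 X (X ⊗ W)).
have c0 : coev' X = 0.
  rewrite -[coev' X]mcomp1l -complete mcomp_suml big1 // => j _.
  rewrite mcomp_suml big1 // => a _; rewrite -mcompA.
  suff u0 (u : hom (X^∨ ⊗ X)%ob (smp j)) : u ∘ coev' X = 0 by rewrite u0 mcomp0r.
  have [i0 [g [g' [gK g'K]]]] := unit_smp.
  have [ei|ni] := eqVneq i0 j.
    by subst i0; rewrite -[u]mcomp1l -g'K -!mcompA (mcompA g') evs mcomp0r.
  by rewrite -[u ∘ _]mcomp1r -gK (mcompA _ g') (hom_smp0 (_ ∘ g')) ?mcomp0l.
have := snake_coev' X; rewrite /snake c0 tensm0l mcomp0r mcomp0l => iv0.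
have evX0 : ev X = 0 by rewrite -[ev X]mcomp1r -tensm1 -iv0 tensm0l mcomp0r.
case: (smp_simple i) => nX _; case: nX; rewrite -/X -(zigzag1 X) evX0.
by rewrite tensm0r mcomp0r !mcomp0l.
Qed.

Lemma qdimE U : ev U ∘ coev' U = (qdim U *: idm (one : C))%R.
Proof. exact: scalar_ofE. Qed.

Lemma qdim_smp_neq0 i : qdim (smp i : C) != 0.
Proof. by apply/eqP => e; case: (@ev_coev'_neq0 i); rewrite qdimE e scale0r. Qed.

Lemma qdim'E U : ev' U ∘ coev U = (qdim U *: idm (one : C))%R.
Proof.
rewrite -qdimE /ev' /coev' -!mcompA; congr (_ ∘ _).
by rewrite !mcompA braid_nat.
Qed.

Lemma qdim_dual U : qdim U^∨ = qdim U.
Proof. by apply: scaler_one_inj; rewrite -!qdimE tr_dual. Qed.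

(** By cyclicity each summand of the decomposition of id_V contributes dim U_i. *)
Lemma tr1_decomp V Y (b : hom one (V ⊗ Y)) (e : hom (Y ⊗ V) one) : snake b e ->
  tr b e (idm V) = (\sum_i (\dim {:hom V (smp i)})%:R * qdim (smp i : C) *: idm one)%R.
Proof.
move=> s; rewrite -complete tr_sum; apply: eq_bigr => i _; rewrite tr_sum.
have t1 a : tr b e (tnth (blo B V i) a ∘ tnth (bup B V i) a) = (qdim (smp i : C) *: idm one)%R.
  rewrite (tr_cyclic _ _ s (@snake_coev _ _ (smp i))) bup_blo eqxx scale1r.
  by rewrite -tr1E qdimE.
rewrite (eq_bigr _ (fun a _ => t1 a)) sumr_const card_ord.
by rewrite -scaler_nat scalerA.
Qed.

Lemma qdim_decomp V : qdim V = (\sum_i (\dim {:hom V (smp i)})%:R * qdim (smp i : C))%R.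
Proof.
apply: scaler_one_inj; rewrite -qdimE tr1E (tr1_decomp (@snake_coev _ _ V)).
by rewrite scaler_suml.
Qed.

Lemma qdim_tens U V : qdim (U ⊗ V)%ob = (qdim U * qdim V)%R.
Proof.
apply: scaler_one_inj; rewrite -qdimE tr1E (tr1_decomp (@snake_coev _ _ (U ⊗ V)%ob)).
rewrite -(tr1_decomp (@snake_nest _ _ U V)) tr_nest qdimE tensmZl tensm1.
by rewrite mcompZr mcomp1r mcompZl luniK tensmZr tensm1 mcompZr mcomp1r mcompZl qdimE scalerA.
Qed.

Lemma dim_hom_smp V i : \dim {:hom (smp i) V} = \dim {:hom V (smp i)}.
Proof. by rewrite (size_basis (blo_basis B V i)). Qed.

End Modular.

Lemma linfunE (k : fieldType) (V W : vectType k) (f : V -> W) :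
  linear f -> linfun f =1 f.
Proof.
move=> lf v; pose F : {linear V -> W} := HB.pack f (GRing.isLinear.Build k V W *:%R f lf).
exact: (lfunE F).
Qed.

Lemma dim_leq_inj (k : fieldType) (V W : vectType k) (f : V -> W) :
  linear f -> injective f -> (\dim {:V} <= \dim {:W})%N.
Proof.
move=> lf fi; have /lker0P/eqP ker0 : injective (linfun f).
  by move=> u v; rewrite !linfunE // => /fi.
have := @limg_dim_eq _ _ _ (linfun f) fullv; rewrite ker0 capv0 => /(_ erefl) <-.
exact/dimvS/subvf.
Qed.

Section Reality.
Variables (k : fieldType) (C : modularCat k) (B : dualBases C).
Implicit Types U V W X : C.
Local Notation "'n" := (nsimple C).
Local Notation d i := (qdim (smp i : C)).

Definition fusion i j l := \dim {:hom (smp i ⊗ smp j)%ob (smp l : C)}.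

Lemma qdim_fusion i j : (d i * d j = \sum_l (fusion i j l)%:R * d l)%R.
Proof. by rewrite -(qdim_tens B) (qdim_decomp B). Qed.

Lemma dim_frobenius_reciprocity X V W :
  \dim {:hom (X^∨ ⊗ V)%ob W} = \dim {:hom V (X ⊗ W)%ob}.
Proof.
pose f (u : hom (X^∨ ⊗ V)%ob W) : hom V (X ⊗ W)%ob :=
  (idm X ⊗ u) ∘ assoc _ _ _ ∘ (coev X ⊗ idm V) ∘ luni V.
pose g (u : hom V (X ⊗ W)%ob) : hom (X^∨ ⊗ V)%ob W :=
  lun W ∘ (ev X ⊗ idm W) ∘ associ _ _ _ ∘ (idm X^∨ ⊗ u).
have fK u : g (f u) = u.
  rewrite /f /g; flatten; rewrite -exchange_cap.
  by frw2 (snake2 X (V ⊗ W0)).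
have gK u : f (g u) = u.
  rewrite /f /g; flatten; rewrite exchange_cup.
  by frw2 (snake1 X (W ⊗ W0)).
have lf : linear f by move=> a u v; rewrite /f (tensm_bilinear _ _ _ _).2 !mcompDl.
have lg : linear g by move=> a u v; rewrite /g (tensm_bilinear _ _ _ _).2 !mcompDr.
apply/eqP; rewrite eqn_leq (dim_leq_inj lf (can_inj fK)).
exact: dim_leq_inj lg (can_inj gK).
Qed.

(** Computing dim (U_i^∨ ⊗ U_j) = d_i d_j, where Hom(U_i^∨ ⊗ U_j, U_l) is
    Hom(U_j, U_i ⊗ U_l): the multiplicities are the transposed ones. *)
Lemma qdim_fusion_dual i j : (d i * d j = \sum_l (fusion i l j)%:R * d l)%R.
Proof.
rewrite -(qdim_dual B) -(qdim_tens B) (qdim_decomp B); apply: eq_bigr => l _.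
by rewrite dim_frobenius_reciprocity /fusion -(dim_hom_smp B).
Qed.
End Reality.

Section ComplexDim.
Import Num.Theory.
Variables (k : numClosedFieldType) (C : modularCat k) (B : dualBases C).
Local Notation d i := (qdim (smp i : C)).
Local Open Scope ring_scope.

(** The fusion matrix of U_i is real with transpose that of its dual, and the
    vector of dimensions is an eigenvector of both for the eigenvalue d i;
    hence d i is its own conjugate. *)
Lemma qdim_real i : (d i)^* = d i.
Proof.
pose n2 := \sum_j (d j)^* * d j.
have n2_neq0 : n2 != 0.
  rewrite psumr_neq0 => [|j _]; last by rewrite mulrC mul_conjC_ge0.
  by apply/hasP; exists i; rewrite ?mem_index_enum //= mulrC mul_conjC_gt0 (qdim_smp_neq0 B).
apply: (mulIf n2_neq0).
transitivity (\sum_l \sum_j (fusion i j l)%:R * ((d j)^* * d l)).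
  rewrite mulr_sumr; apply: eq_bigr => l _.
  rewrite mulrA -rmorphM (qdim_fusion_dual B) rmorph_sum mulr_suml.
  by apply: eq_bigr => j _; rewrite rmorphM rmorph_nat mulrA.
rewrite exchange_big mulr_sumr; apply: eq_bigr => j _ /=.
rewrite mulrCA (qdim_fusion B) mulr_sumr.
by apply: eq_bigr => l _; rewrite mulrCA.
Qed.

Lemma Dim_neq0 : Dim C != 0.
Proof.
have [i _] := unit_smp C.
rewrite /Dim psumr_neq0 => [|j _].
  by apply/hasP; exists i; rewrite ?mem_index_enum //= expr2 -{2}qdim_real mul_conjC_gt0 (qdim_smp_neq0 B).
by rewrite expr2 -{2}qdim_real mul_conjC_ge0.
Qed.
End ComplexDim.

(** * Frobenius algebras and nondegenerate forms *)

(** The mirror image of snake. *)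
Definition snake_r (k : fieldType) (C : monCat k) (X Y : C) (b : hom one (X ⊗ Y)%ob)
    (e : hom (Y ⊗ X)%ob one) :=
  lun Y ∘ (e ⊗ idm Y) ∘ associ Y X Y ∘ (idm Y ⊗ b) ∘ runi Y = idm Y.

Lemma exch2 (k : fieldType) (C : monCat k) (U V X : C) (f : hom (U ⊗ V)%ob X) W W' (w : hom W W') :
  (idm X ⊗ w) ∘ ⟪ f ⟫ W = ⟪ f ⟫ W' ∘ (idm U ⊗ (idm V ⊗ w)).
Proof. by apply: trail => Z h; fnorm; exchange. Qed.

Section Copairing.
Variables (k : fieldType) (C : monCat k) (A : frobData C) (b : hom one (A ⊗ A)%ob).
Implicit Types W : C.

Hypothesis mulA : fmul A ∘ (fmul A ⊗ idm A) = fmul A ∘ (idm A ⊗ fmul A) ∘ assoc A A A.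
Hypothesis mul1l : fmul A ∘ (funit A ⊗ idm A) = lun A.
Hypothesis mul1r : fmul A ∘ (idm A ⊗ funit A) = run A.
Hypothesis b_l : run A ∘ (idm A ⊗ (fcounit A ∘ fmul A)) ∘ assoc A A A ∘ (b ⊗ idm A) ∘ luni A = idm A.
Hypothesis b_r : snake_r b (fcounit A ∘ fmul A).
Hypothesis comulE : fcomul A = (fmul A ⊗ idm A) ∘ associ A A A ∘ (idm A ⊗ b) ∘ runi A.

Let mulAf W : ⟪ fmul A ⟫ W ∘ ⟪ fmul A ⟫ (A ⊗ W) = ⟪ fmul A ⟫ W ∘ (idm A ⊗ ⟪ fmul A ⟫ W).
Proof. flat_by mulA W. Qed.
Let b_lf W : (idm A ⊗ ⟪ fcounit A ⟫ W) ∘ ((idm A ⊗ ⟪ fmul A ⟫ W) ∘ ⟪ b ⟫ (A ⊗ W)) = idm _.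
Proof. flat_by b_l W. Qed.
Let b_rf W : ⟪ fcounit A ⟫ (A ⊗ W) ∘ (⟪ fmul A ⟫ (A ⊗ W) ∘ (idm A ⊗ ⟪ b ⟫ W)) = idm _.
Proof. have := b_r; rewrite /snake_r => s; flat_by s W. Qed.
Let comul_l W : ⟪ fcomul A ⟫ W = ⟪ fmul A ⟫ (A ⊗ W) ∘ (idm A ⊗ ⟪ b ⟫ W).
Proof. flat_by comulE W. Qed.

(** In elements, with κ = ε m and two copies b1' ⊗ b1'', b2' ⊗ b2'' of the
    copairing: x b2' ⊗ b2'' = b1' κ(b1'', x b2') ⊗ b2''
    = b1' κ(b1'' x, b2') ⊗ b2'' = b1' ⊗ b1'' x. *)
Let comul_r W : ⟪ fcomul A ⟫ W = (idm A ⊗ ⟪ fmul A ⟫ W) ∘ ⟪ b ⟫ (A ⊗ W).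
Proof.
rewrite comul_l; apply: trail => Z h; fnorm.
rewrite -[LHS]mcomp1l -(b_lf (A ⊗ W)); fnorm; rewrite -2!(exchange_cup b).
frw2 (esym (mulAf (A ⊗ W))).
frw2 (esym (exch2 (fmul A) (⟪ b ⟫ W))); frw3 (b_rf W).
by [].
Qed.

(** Multiplying the copairing on the left or on the right gives the same coproduct
    (comul_r); in each axiom one of the two forms of the coproduct lets the
    product slide past. *)
Lemma frobenius_of_copairing : is_frobenius A.
Proof.
split=> //.
- flatten; rewrite [in LHS](tr1 _ (comul_l W)) [in RHS](tr1 _ (comul_r W)); fnorm.
  frw1 (comul_r (A ⊗ W)%ob); frw1 (comul_l W); exchange.
  by frw2 (esym (mulAf (A ⊗ W)%ob)); exchange.
- by flatten; frw1 (comul_l W); frw3 (b_rf W).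
- by flatten; frw1 (comul_r W); frw3 (b_lf W).
- flatten; frw1 (comul_r W); frw1 (comul_r (A ⊗ W)%ob).
  by exchange; frw2 (mulAf W).
- flatten; do 2!frw1 (comul_l W).
  by frw2 (exch2 (fmul A) (⟪ b ⟫ W)); frw2 (mulAf (A ⊗ W)%ob).
Qed.
End Copairing.

Section FrobeniusForm.
Variables (k : fieldType) (C : monCat k) (A : frobData C).
Hypothesis frobA : is_frobenius A.
Implicit Types W X Y : C.
Local Notation form := (fcounit A ∘ fmul A).
Local Notation copair := (fcomul A ∘ funit A).

Lemma form_snake :
  run A ∘ (idm A ⊗ form) ∘ assoc A A A ∘ (copair ⊗ idm A) ∘ luni A = idm A.
Proof.
have [_ m1 _ _ _ c1 f _] := frobA.
have fW W : (idm A ⊗ ⟪ fmul A ⟫ W) ∘ ⟪ fcomul A ⟫ (A ⊗ W) = ⟪ fcomul A ⟫ W ∘ ⟪ fmul A ⟫ W.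
  flat_by f W.
have m1W W : ⟪ fmul A ⟫ W ∘ ⟪ funit A ⟫ (A ⊗ W) = idm _ by flat_by m1 W.
have c1W W : (idm A ⊗ ⟪ fcounit A ⟫ W) ∘ ⟪ fcomul A ⟫ W = idm _ by flat_by c1 W.
by flatten; frw2 (fW W); frw2 (m1W W); frw2 (c1W W).
Qed.

Lemma form_snake_r : snake_r copair form.
Proof.
have [_ _ m1 _ c1 _ _ f] := frobA.
have fW W : ⟪ fcomul A ⟫ W ∘ ⟪ fmul A ⟫ W = ⟪ fmul A ⟫ (A ⊗ W)%ob ∘ (idm A ⊗ ⟪ fcomul A ⟫ W).
  flat_by f W.
have m1W W : ⟪ fmul A ⟫ W ∘ (idm A ⊗ ⟪ funit A ⟫ W) = idm _ by flat_by m1 W.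
have c1W W : ⟪ fcounit A ⟫ (A ⊗ W)%ob ∘ ⟪ fcomul A ⟫ W = idm _ by flat_by c1 W.
by rewrite /snake_r; flatten; frw2 (esym (fW W)); frw2 (m1W W); frw2 (c1W W).
Qed.

(** The comultiplication is determined by the form: in elements,
    κ(x', z) κ(x'', y) = ε(x y z). *)
Lemma form_comul W :
  ⟪ fcounit A ⟫ W ∘ (⟪ fmul A ⟫ W ∘ ((idm A ⊗ ⟪ fcounit A ⟫ (A ⊗ W)%ob)
    ∘ ((idm A ⊗ ⟪ fmul A ⟫ (A ⊗ W)%ob) ∘ ⟪ fcomul A ⟫ (A ⊗ (A ⊗ W))%ob)))
  = ⟪ fcounit A ⟫ W ∘ (⟪ fmul A ⟫ W ∘ ⟪ fmul A ⟫ (A ⊗ W)%ob).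
Proof.
have [_ _ _ _ _ c1 f _] := frobA.
have fW W' : (idm A ⊗ ⟪ fmul A ⟫ W') ∘ ⟪ fcomul A ⟫ (A ⊗ W')%ob = ⟪ fcomul A ⟫ W' ∘ ⟪ fmul A ⟫ W'.
  flat_by f W'.
have c1W W' : (idm A ⊗ ⟪ fcounit A ⟫ W') ∘ ⟪ fcomul A ⟫ W' = idm _ by flat_by c1 W'.
apply: trail => Z h; fnorm.
by frw2 (fW (A ⊗ W)%ob); frw2 (c1W (A ⊗ W)%ob).
Qed.
End FrobeniusForm.

(** * Strong monoidal functors *)

(** The structure isomorphisms come with their inverses, since both directions
    occur in the image of a morphism between products. *)
Record monFunctor (k : fieldType) (D C : monCat k) := MonFunctor {
  fun_ob :> D -> C;
  fun_mor : forall M N : D, hom M N -> hom (fun_ob M) (fun_ob N);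
  fun_linear : forall M N, linear (@fun_mor M N);
  fun_id : forall M, fun_mor (idm M) = idm (fun_ob M);
  funM : forall (M N P : D) (g : hom N P) (f : hom M N),
    fun_mor (g ∘ f) = fun_mor g ∘ fun_mor f;
  fun_phi : forall M N, hom (fun_ob M ⊗ fun_ob N) (fun_ob (M ⊗ N)%ob);
  fun_psi : forall M N, hom (fun_ob (M ⊗ N)%ob) (fun_ob M ⊗ fun_ob N);
  fun_phiV : forall M N, inverses (fun_phi M N) (fun_psi M N);
  fun_phi_nat : forall (M N M' N' : D) (f : hom M M') (g : hom N N'),
    fun_mor (f ⊗ g) ∘ fun_phi M N = fun_phi M' N' ∘ (fun_mor f ⊗ fun_mor g);
  fun_phi0 : hom one (fun_ob one);
  fun_psi0 : hom (fun_ob one) one;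
  fun_phi0V : inverses fun_phi0 fun_psi0;
  fun_assoc : forall M N P,
    fun_mor (assoc M N P) ∘ (fun_phi (M ⊗ N)%ob P ∘ (fun_phi M N ⊗ idm (fun_ob P)))
    = fun_phi M (N ⊗ P)%ob ∘ (idm (fun_ob M) ⊗ fun_phi N P) ∘ assoc _ _ _;
  fun_lun : forall M, fun_mor (lun M) ∘ (fun_phi one M ∘ (fun_phi0 ⊗ idm (fun_ob M))) = lun _;
  fun_run : forall M, fun_mor (run M) ∘ (fun_phi M one ∘ (idm (fun_ob M) ⊗ fun_phi0)) = run _
}.

Section Lift.
Variables (k : fieldType) (D C : monCat k) (T : monFunctor D C).
Implicit Types s t u : word D.
Local Notation F := (wmap T).

Fixpoint gather s : hom (val (F s)) (T (val s)) :=
  match s with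
  | Leaf X => idm _
  | Unit => fun_phi0 T
  | Node s t => fun_phi T _ _ ∘ (gather s ⊗ gather t)
  end.

Fixpoint scatter s : hom (T (val s)) (val (F s)) :=
  match s with
  | Leaf X => idm _
  | Unit => fun_psi0 T
  | Node s t => (scatter s ⊗ scatter t) ∘ fun_psi T _ _
  end.

Lemma gatherV s : inverses (gather s) (scatter s).
Proof.
elim: s => [X|/=|s IHs t IHt] /=; first exact: inverses_id.
  exact: fun_phi0V.
by apply: inverses_comp; [apply: inverses_tens | apply: fun_phiV].
Qed.

Lemma gatherK s : scatter s ∘ gather s = idm _. Proof. exact: (gatherV s).1. Qed.
Lemma scatterK s : gather s ∘ scatter s = idm _. Proof. exact: (gatherV s).2. Qed.

(** T f between the products of the images of the factors. Like op it is
    locked, so as to appear as a generator in diagrams of C. *)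
Definition lift s t (f : hom (val s) (val t)) : hom (val (F s)) (val (F t)) :=
  locked_with op_key (scatter t ∘ (fun_mor T f ∘ gather s)).
Arguments lift : clear implicits.

Lemma liftE s t f : lift s t f = scatter t ∘ (fun_mor T f ∘ gather s).
Proof. by rewrite /lift unlock. Qed.

Lemma gather_lift s t f : gather t ∘ lift s t f = fun_mor T f ∘ gather s.
Proof. by rewrite liftE mcompA scatterK mcomp1l. Qed.

Lemma lift_id s : lift s s (idm _) = idm _.
Proof. by rewrite liftE fun_id mcomp1l gatherK. Qed.

Lemma lift_comp s t u (g : hom (val t) (val u)) (f : hom (val s) (val t)) :
  lift s u (g ∘ f) = lift t u g ∘ lift s t f.
Proof. by rewrite [lift t u g]liftE -!mcompA gather_lift liftE funM -!mcompA. Qed.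

Lemma lift_uniq s t f (g : hom (val (F s)) (val (F t))) :
  fun_mor T f ∘ gather s = gather t ∘ g -> lift s t f = g.
Proof. by move=> e; rewrite liftE e mcompA gatherK mcomp1l. Qed.

Lemma lift_tens s s' t t' (f : hom (val s) (val t)) (g : hom (val s') (val t')) :
  lift (Node s s') (Node t t') (f ⊗ g) = lift s t f ⊗ lift s' t' g.
Proof.
apply: lift_uniq => /=; rewrite mcompA fun_phi_nat -!mcompA -!tensmM.
by rewrite !gather_lift.
Qed.

Lemma lift_assoc s t u :
  lift (Node (Node s t) u) (Node s (Node t u)) (assoc _ _ _) = assoc _ _ _.
Proof.
apply: lift_uniq => /=.
rewrite -[gather u in LHS]mcomp1l tensmM !mcompA -(mcompA (fun_mor T _)) fun_assoc.
by rewrite -!mcompA assoc_nat (mcompA (idm _ ⊗ _)) -tensmM mcomp1l.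
Qed.

Lemma lift_inv s t (f : hom (val s) (val t)) g f' :
  g ∘ f = idm _ -> f' ∘ lift t s g = idm _ -> lift s t f = f'.
Proof.
move=> gf e; rewrite -[LHS]mcomp1l -e -mcompA -lift_comp gf lift_id.
by rewrite mcomp1r.
Qed.

Lemma lift_associ s t u :
  lift (Node s (Node t u)) (Node (Node s t) u) (associ _ _ _) = associ _ _ _.
Proof. by apply: lift_inv; [exact: associK | rewrite lift_assoc assocK]. Qed.

Lemma lift_lun s : lift (Node Unit s) s (lun _) = lun _.
Proof.
apply: lift_uniq => /=; rewrite -(tensm_lr (fun_phi0 T)).
by rewrite !mcompA -(mcompA (fun_mor T _)) fun_lun lun_nat.
Qed.

Lemma lift_luni s : lift s (Node Unit s) (luni _) = luni _.
Proof. by apply: lift_inv; [exact: luniK | rewrite lift_lun lunK]. Qed.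

Lemma lift_run s : lift (Node s Unit) s (run _) = run _.
Proof.
apply: lift_uniq => /=; rewrite -(tensm_rl (gather s)).
by rewrite !mcompA -(mcompA (fun_mor T _)) fun_run run_nat.
Qed.

Lemma lift_runi s : lift s (Node s Unit) (runi _) = runi _.
Proof. by apply: lift_inv; [exact: runiK | rewrite lift_run runK]. Qed.

Fixpoint liftd s t (m : diag s t) : diag (F s) (F t) :=
  match m with
  | Gen s t f => Gen (lift s t f)
  | Id s => Id _
  | Comp s t u g f => Comp (liftd g) (liftd f)
  | Ten s s' t t' f g => Ten (liftd f) (liftd g)
  | As s t u => As _ _ _
  | Asi s t u => Asi _ _ _
  | Lu s => Lu _
  | Lui s => Lui _
  | Ru s => Ru _
  | Rui s => Rui _
  end.

(** T preserves composites, products and structure morphisms, so it carries a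
    diagram to the same diagram of images. *)
Lemma lift_den s t (m : diag s t) : lift s t (den m) = den (liftd m).
Proof.
elim: m => //= {s t} [s|s t u g IHg f IHf|s s' t t' f IHf g IHg||||||].
- exact: lift_id.
- by rewrite (@lift_comp s t u) IHg IHf.
- by rewrite lift_tens IHf IHg.
- exact: lift_assoc.
- exact: lift_associ.
- exact: lift_lun.
- exact: lift_luni.
- exact: lift_run.
- exact: lift_runi.
Qed.
End Lift.
Arguments lift {k D C} T s t f.

Ltac composite f :=
  lazymatch f with
  | mcomp _ _ => idtac | tensm _ _ => idtac | idm _ => idtac
  | assoc _ _ _ => idtac | associ _ _ _ => idtac | lun _ => idtac
  | luni _ => idtac | run _ => idtac | runi _ => idtac
  end.

(* Pushes lift to the generators of a composite. *)
Ltac unlift :=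
  repeat match goal with |- context [lift ?T ?s ?t ?f] =>
    composite f;
    let f' := reify_mor f in
    let E := fresh in
    pose proof (lift_den T f') as E; cbn [den liftd wmap val] in E; rewrite {}E
  end.

Lemma exch0 (k : fieldType) (C : monCat k) (U : C) (z : hom one U) W W' (w : hom W W') :
  (idm U ⊗ w) ∘ ⟪ z ⟫ W = ⟪ z ⟫ W' ∘ w.
Proof. by apply: trail => Z h; fnorm; exchange. Qed.

Lemma exch1_0 (k : fieldType) (C : monCat k) (U : C) (z : hom U one) W W' (w : hom W W') :
  w ∘ ⟪ z ⟫ W = ⟪ z ⟫ W' ∘ (idm U ⊗ w).
Proof. by apply: trail => Z h; fnorm; exchange. Qed.

(** * Transfer of Frobenius structures *)

(** S stands for R(A), rho for the counit of the adjunction between T and R, chk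
    for the transpose of the other adjunction, and dc for the morphism A -> T S
    that chk sends to the identity. *)
Section Transfer.
Variables (k : fieldType) (D C : ribCat k) (T : monFunctor D C).
Variables (A : frobData C) (frobA : is_frobenius A).
Variables (S : frobData D) (rho : hom (T S) A).
Implicit Types M N : D.

Hypothesis hat_surj : forall M (f : hom (T M) A),
  exists h : hom M S, rho ∘ fun_mor T h = f.
Hypothesis hat_inj : forall M (h h' : hom M S),
  rho ∘ fun_mor T h = rho ∘ fun_mor T h' -> h = h'.
Local Notation L := (Leaf (fob_ S)).
Local Notation LL := (Node L L).
Local Notation mS := (lift T LL L (fmul S)).
Hypothesis mulS : rho ∘ lift T LL L (fmul S) = fmul A ∘ (rho ⊗ rho).
Hypothesis unitS : rho ∘ lift T Unit L (funit S) = funit A.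

Variables (chk : forall M, hom A (T M) -> hom S M) (dim : k) (dc : hom A (T S)).
Hypothesis dim_neq0 : dim != 0.
Hypothesis chk_star : forall M N (g : hom A (T M)) (y : hom one (S ⊗ N)%ob) (c : hom (M ⊗ N)%ob one),
  lift T (Node (Leaf M) (Leaf N)) Unit c ∘ ((fun_mor T (chk g) ⊗ idm (T N)) ∘ lift T Unit (Node L (Leaf N)) y)
  = (dim *: (lift T (Node (Leaf M) (Leaf N)) Unit c ∘ (((g ∘ rho) ⊗ idm (T N)) ∘ lift T Unit (Node L (Leaf N)) y)))%R.
Hypothesis chk_dc : chk dc = idm S.
Hypothesis rho_dc : rho ∘ dc = idm A.
Hypothesis counitS : fcounit S = chk (fun_phi0 T ∘ fcounit A).
Hypothesis comulS : fcomul S = chk (gather T LL ∘ ((dc ⊗ dc) ∘ fcomul A)).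

Hypothesis lift_one_inj : forall f g : hom (one : D) one, lift T Unit Unit f = lift T Unit Unit g -> f = g.
Hypothesis one_faithC : forall (V : C) (f g : hom V one), (forall x : hom one V, f ∘ x = g ∘ x) -> f = g.
Hypothesis one_faithD : forall (V : D) (f g : hom V one), (forall x : hom one V, f ∘ x = g ∘ x) -> f = g.

(** chk_star for products M and N, read on their factors. *)
Lemma star (m n : word D) (g : hom A (val (wmap T m))) (y : hom one (S ⊗ val n)%ob)
    (c : hom (val m ⊗ val n)%ob one) :
  lift T (Node m n) Unit c ∘ ((lift T L m (chk (gather T m ∘ g)) ⊗ idm _) ∘ lift T Unit (Node L n) y)
  = (dim *: (lift T (Node m n) Unit c ∘ (((g ∘ rho) ⊗ idm _) ∘ lift T Unit (Node L n) y)))%R.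
Proof.
have e1 : lift T (Node m n) Unit c = lift T (Node (Leaf (val m)) (Leaf (val n))) Unit c
   ∘ (gather T m ⊗ gather T n).
  rewrite !liftE /= tensm1 !mcomp1r -!mcompA. by [].
have e2 : lift T Unit (Node L (Leaf (val n))) y = (idm _ ⊗ gather T n) ∘ lift T Unit (Node L n) y.
  rewrite !liftE /= tensm1 !mcomp1l !mcompA; congr (_ ∘ _ ∘ _).
  by rewrite -tensmM mcomp1l scatterK tensm1 mcomp1l.
have := chk_star (gather T m ∘ g) y c; rewrite e2 => E.
have e3 X (a : hom _ X) b : a ∘ ((gather T m ⊗ gather T n) ∘ ((b ⊗ idm _) ∘ lift T Unit (Node L n) y))
    = a ∘ (((gather T m ∘ b) ⊗ idm _) ∘ ((idm _ ⊗ gather T n) ∘ lift T Unit (Node L n) y)).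
  by rewrite !(mcompA (_ ⊗ _)) -!tensmM !(mcomp1l, mcomp1r).
rewrite e1 -!mcompA !e3. rewrite (@gather_lift _ _ _ T L m) /= mcomp1r E; congr (_ *: (_ ∘ (_ ∘ _)))%R.
by rewrite !mcompA.
Qed.

(** Invariants separate forms in D, and T is injective on scalars. *)
Lemma form_eq s (f g : hom (val s) (one : D)) :
  (forall y : hom one (val s), lift T s Unit f ∘ lift T Unit s y = lift T s Unit g ∘ lift T Unit s y) -> f = g.
Proof.
move=> e; apply: one_faithD => x; apply: lift_one_inj.
by rewrite !(@lift_comp _ _ _ T Unit s Unit) e.
Qed.

Lemma counit_star (y : hom one (S : D)) :
  lift T Unit Unit (fcounit S ∘ y) = (dim *: (fcounit A ∘ (rho ∘ lift T Unit L y)))%R.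
Proof.
have := star (m := Unit) (n := Unit) (fcounit A) (runi (S : D) ∘ y) (lun one).
rewrite /= -counitS.
rewrite (lift_comp T (t := L)); unlift; rewrite !lun_one.
rewrite !(mcompA (run _)) !run_nat -!mcompA !(mcompA (run _)) !runiK !mcomp1l.
by [].
Qed.

Lemma lift_snake (X Y : D) (b : hom one (X ⊗ Y)%ob) (e : hom (Y ⊗ X)%ob one) :
  snake b e -> snake (lift T Unit (Node (Leaf X) (Leaf Y)) b) (lift T (Node (Leaf Y) (Leaf X)) Unit e).
Proof.
rewrite /snake => s; have := congr1 (lift T (Leaf X) (Leaf X)) s.
by unlift.
Qed.

Lemma lift_snake_r (X Y : D) (b : hom one (X ⊗ Y)%ob) (e : hom (Y ⊗ X)%ob one) :
  snake_r b e -> snake_r (lift T Unit (Node (Leaf X) (Leaf Y)) b) (lift T (Node (Leaf Y) (Leaf X)) Unit e).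
Proof.
rewrite /snake_r => s; have := congr1 (lift T (Leaf Y) (Leaf Y)) s.
by unlift.
Qed.

Lemma snake_rP (E : monCat k) (X Y : E) (b : hom one (X ⊗ Y)%ob) (e : hom (Y ⊗ X)%ob one) W :
  snake_r b e -> ⟪ e ⟫ (Y ⊗ W)%ob ∘ (idm Y ⊗ ⟪ b ⟫ W) = idm (Y ⊗ W)%ob.
Proof. by rewrite /snake_r => s; flat_by s W. Qed.

Lemma hat_leaf M (h : hom M (S : D)) : lift T (Leaf M) L h = fun_mor T h.
Proof. by rewrite liftE /= mcomp1l mcomp1r. Qed.

(** Projection formula: Hom(1, S ⊗ N) = Hom(N^∨, S) = Hom(T N^∨, A)
    = Hom(1, A ⊗ T N). *)
Lemma rho_surj_l N (w : hom one (A ⊗ T N)%ob) :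
  exists y : hom one (S ⊗ N)%ob, (rho ⊗ idm (T N)) ∘ lift T Unit (Node L (Leaf N)) y = w.
Proof.
have sN : snake_r (coev' N) (ev' N) by rewrite /snake_r; flatten; frw2 (snake1' N W).
have [h eh] := hat_surj (run A ∘ (idm A ⊗ lift T (Node (Leaf N) (Leaf N^∨%ob)) Unit (ev' N))
  ∘ assoc _ _ _ ∘ (w ⊗ idm (T N^∨%ob)) ∘ luni _).
exists ((h ⊗ idm N) ∘ coev' N); unlift; rewrite mcompA -tensmM hat_leaf eh mcomp1l.
flatten; rewrite -(exchange_cup w).
by frw2 (snake_rP W (lift_snake_r sN)).
Qed.

Lemma rho_surj_r N (w : hom one (T N ⊗ A)%ob) :
  exists y : hom one (N ⊗ S)%ob, (idm (T N) ⊗ rho) ∘ lift T Unit (Node (Leaf N) L) y = w.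
Proof.
have sN : snake (coev N) (ev N) := @snake_coev _ _ N.
have [h eh] := hat_surj (lun A ∘ (lift T (Node (Leaf N^∨%ob) (Leaf N)) Unit (ev N) ⊗ idm A)
  ∘ associ _ _ _ ∘ (idm (T N^∨%ob) ⊗ w) ∘ runi _).
exists ((idm N ⊗ h) ∘ coev N); unlift; rewrite mcompA -tensmM hat_leaf eh mcomp1l.
flatten; rewrite exchange_cup.
by frw2 (snakeP (A ⊗ W)%ob (lift_snake sN)).
Qed.

Lemma scale_dim_inj (V W : C) (f g : hom V W) : (dim *: f = dim *: g)%R -> f = g.
Proof. by move/(scalerI dim_neq0). Qed.

Lemma mul_star (y : hom one (S ⊗ S)%ob) :
  lift T Unit Unit (fcounit S ∘ (fmul S ∘ y))
  = (dim *: (fcounit A ∘ (fmul A ∘ ((rho ⊗ rho) ∘ lift T Unit LL y))))%R.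
Proof.
by rewrite counit_star (lift_comp T (t := LL)) (mcompA rho) mulS -!mcompA.
Qed.

(** chk_star recovers the pairing of g with every invariant (rho ⊗ 1) ∘ T y, and
    these are all the invariants. *)
Lemma chk_inj M (g g' : hom A (T M)) : chk g = chk g' -> g = g'.
Proof.
move=> e; set c := lift T (Node (Leaf M) (Leaf M^∨%ob)) Unit (ev' M).
have ec : c ∘ (g ⊗ idm (T M^∨%ob)) = c ∘ (g' ⊗ idm (T M^∨%ob)).
  apply: one_faithC => w; have [y <-] := rho_surj_l w.
  rewrite -!mcompA !(mcompA (_ ⊗ _)) -!tensmM !mcomp1l.
  by apply: scale_dim_inj; rewrite -!chk_star e.
have sM : snake_r (coev' M) (ev' M) by rewrite /snake_r; flatten; frw2 (snake1' M W).
have E (f : hom A (T M)) : f = lun _ ∘ ((c ∘ (f ⊗ idm (T M^∨%ob))) ⊗ idm (T M)) ∘ associ _ _ _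
    ∘ (idm A ⊗ lift T Unit (Node (Leaf M^∨%ob) (Leaf M)) (coev' M)) ∘ runi A.
  rewrite /c; flatten; exchange.
  by frw2 (snake_rP W (lift_snake_r sM)).
by rewrite [g]E [g']E ec.
Qed.

(** Apply chk_star to g = dc: since chk dc = 1, it compares the form of S with
    that of A through dc on one side and rho on the other. *)
Lemma form_dc :
  lift T L Unit (fcounit S) ∘ (mS ∘ (dc ⊗ idm (T S))) = fcounit A ∘ (fmul A ∘ (idm A ⊗ rho)).
Proof.
apply: one_faithC => w; have [y <-] := rho_surj_l w.
apply: scale_dim_inj; rewrite -!mcompA !(mcompA (_ ⊗ _)) -!tensmM !(mcomp1l, mcomp1r).
rewrite -mul_star (lift_comp T (t := L)) (lift_comp T (t := LL)).
have := chk_star dc y (fcounit S ∘ fmul S); rewrite chk_dc fun_id tensm1 mcomp1l.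
by rewrite (lift_comp T (t := L)) -!mcompA => ->.
Qed.

Lemma form_dcf W :
  ⟪ lift T L Unit (fcounit S) ⟫ W ∘ (⟪ mS ⟫ W ∘ ⟪ dc ⟫ (T S ⊗ W)%ob)
  = ⟪ fcounit A ⟫ W ∘ (⟪ fmul A ⟫ W ∘ (idm A ⊗ ⟪ rho ⟫ W)).
Proof. flat_by form_dc W. Qed.

Let mulSf W : ⟪ rho ⟫ W ∘ ⟪ mS ⟫ W = ⟪ fmul A ⟫ W ∘ (⟪ rho ⟫ (A ⊗ W)%ob ∘ (idm (T S) ⊗ ⟪ rho ⟫ W)).
Proof. flat_by mulS W. Qed.

(** This makes fcomul S the adjoint of fmul S. By chk_star it may be replaced by
    dim times (dc ⊗ dc) ∘ fcomul A ∘ rho; form_dc removes both copies of dc, and what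
    remains is the adjointness form_comul for A. *)
Lemma form_comulS :
  fcounit S ∘ (fmul S ∘ ((idm S ⊗ (lun S ∘ ((fcounit S ∘ fmul S) ⊗ idm S) ∘ associ S S S))
    ∘ (assoc S S (S ⊗ S)%ob ∘ (fcomul S ⊗ idm (S ⊗ S)%ob))))
  = fcounit S ∘ (fmul S ∘ ((fmul S ⊗ idm S) ∘ associ S S S)).
Proof.
apply: (@form_eq (Node L LL)) => y.
set c := fcounit S ∘ (fmul S ∘ ((idm S ⊗ (lun S ∘ ((fcounit S ∘ fmul S) ⊗ idm S) ∘ associ S S S)) ∘ assoc S S (S ⊗ S)%ob)).
have -> : fcounit S ∘ (fmul S ∘ ((idm S ⊗ (lun S ∘ ((fcounit S ∘ fmul S) ⊗ idm S) ∘ associ S S S))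
    ∘ (assoc S S (S ⊗ S)%ob ∘ (fcomul S ⊗ idm (S ⊗ S)%ob)))) = c ∘ (fcomul S ⊗ idm (S ⊗ S)%ob).
  by rewrite /c -!mcompA.
have := star (m := LL) (n := LL) ((dc ⊗ dc) ∘ fcomul A) y c; rewrite -comulS => E.
rewrite (lift_comp T (t := Node LL LL)) (lift_tens T (t' := LL)) (lift_id T LL) -mcompA E.
rewrite -(@lift_comp _ _ _ T Unit (Node L LL) Unit) -!mcompA mul_star.
congr (_ *: _)%R; rewrite /c; unlift; flatten.
rewrite 2!(exchange_leaf dc); frw3 (form_dcf (T S ⊗ W)%ob); frw3 (form_dcf W).
frw2 (exch2 mS (⟪ rho ⟫ W)); frw2 (mulSf (A ⊗ W)%ob).
frw3 (esym (form_comul frobA W)); exchange.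
by [].
Qed.

Lemma form_comulSf W :
  ⟪ fcounit S ⟫ W ∘ (⟪ fmul S ⟫ W ∘ ((idm S ⊗ ⟪ fcounit S ⟫ (S ⊗ W)%ob)
    ∘ ((idm S ⊗ ⟪ fmul S ⟫ (S ⊗ W)%ob) ∘ ⟪ fcomul S ⟫ (S ⊗ (S ⊗ W))%ob)))
  = ⟪ fcounit S ⟫ W ∘ (⟪ fmul S ⟫ W ∘ ⟪ fmul S ⟫ (S ⊗ W)%ob).
Proof. flat_by form_comulS W. Qed.

(** The copairing of A recovers p from the form. *)
Lemma form_inj_A (V : C) (p q : hom V A) :
  fcounit A ∘ (fmul A ∘ (p ⊗ idm A)) = fcounit A ∘ (fmul A ∘ (q ⊗ idm A)) -> p = q.
Proof.
have E (r : hom V A) : r = lun A ∘ ((fcounit A ∘ (fmul A ∘ (r ⊗ idm A))) ⊗ idm A)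
    ∘ associ _ _ _ ∘ (idm V ⊗ (fcomul A ∘ funit A)) ∘ runi V.
  have e W' : ⟪ fcounit A ⟫ (A ⊗ W')%ob ∘ (⟪ fmul A ⟫ (A ⊗ W')%ob
      ∘ ((idm A ⊗ ⟪ fcomul A ⟫ W') ∘ (idm A ⊗ ⟪ funit A ⟫ W'))) = idm _.
    have := form_snake_r frobA; rewrite /snake_r => s; flat_by s W'.
  flatten; exchange; frw4 (e W).
  by [].
by move=> e; rewrite [p]E [q]E e.
Qed.

(** The form of S is nondegenerate, because that of A is. *)
Lemma form_inj_S M (p q : hom M (S : D)) :
  fcounit S ∘ (fmul S ∘ (p ⊗ idm S)) = fcounit S ∘ (fmul S ∘ (q ⊗ idm S)) -> p = q.
Proof.
move=> e; apply: hat_inj; apply: form_inj_A; apply: one_faithC => w.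
have [y <-] := rho_surj_r w; apply: scale_dim_inj.
have E (r : hom M (S : D)) : (dim *: (fcounit A ∘ (fmul A ∘ ((rho ∘ fun_mor T r) ⊗ idm A)) ∘
    ((idm (T M) ⊗ rho) ∘ lift T Unit (Node (Leaf M) L) y))
    = lift T Unit Unit (fcounit S ∘ (fmul S ∘ ((r ⊗ idm S) ∘ y))))%R.
  rewrite mul_star; unlift; congr (_ *: _)%R.
  rewrite -!mcompA; congr (_ ∘ (_ ∘ _)).
  by rewrite hat_leaf !mcompA -!tensmM !(mcomp1l, mcomp1r).
by rewrite !E; have := congr1 (fun x => lift T Unit Unit (x ∘ y)) e; rewrite -!mcompA.
Qed.

Lemma rho_lift_inj s (f g : hom (val s) (S : D)) :
  rho ∘ lift T s L f = rho ∘ lift T s L g -> f = g.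
Proof.
rewrite !liftE (_ : scatter T L = idm (T S)) // !mcomp1l => e; apply: hat_inj.
have := congr1 (fun x => x ∘ scatter T s) e.
by rewrite -!mcompA !scatterK !mcomp1r.
Qed.

Lemma assocS : fmul S ∘ (fmul S ⊗ idm S) = fmul S ∘ (idm S ⊗ fmul S) ∘ assoc S S S.
Proof.
have [mA _ _ _ _ _ _ _] := frobA.
have mAf W : ⟪ fmul A ⟫ W ∘ ⟪ fmul A ⟫ (A ⊗ W)%ob = ⟪ fmul A ⟫ W ∘ (idm A ⊗ ⟪ fmul A ⟫ W).
  flat_by mA W.
apply: (@rho_lift_inj (Node LL L)); unlift; flatten.
do 2!frw2 (mulSf W); frw2 (exch2 mS (⟪ rho ⟫ W)); frw2 (mulSf (A ⊗ W)%ob).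
by frw2 (mulSf W); frw2 (mAf W); exchange.
Qed.

Lemma unitlS : fmul S ∘ (funit S ⊗ idm S) = lun S.
Proof.
have [_ m1 _ _ _ _ _ _] := frobA.
have m1f W : ⟪ fmul A ⟫ W ∘ ⟪ funit A ⟫ (A ⊗ W)%ob = idm _ by flat_by m1 W.
have uf W : ⟪ rho ⟫ W ∘ ⟪ lift T Unit L (funit S) ⟫ W = ⟪ funit A ⟫ W by flat_by unitS W.
apply: (@rho_lift_inj (Node Unit L)); unlift; flatten.
by frw2 (mulSf W); frw2 (exch0 (lift T Unit L (funit S)) (⟪ rho ⟫ W)); frw2 (uf (A ⊗ W)%ob); frw2 (m1f W).
Qed.

Lemma unitrS : fmul S ∘ (idm S ⊗ funit S) = run S.
Proof.
have [_ _ m1 _ _ _ _ _] := frobA.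
have m1f W : ⟪ fmul A ⟫ W ∘ (idm A ⊗ ⟪ funit A ⟫ W) = idm _ by flat_by m1 W.
have uf W : ⟪ rho ⟫ W ∘ ⟪ lift T Unit L (funit S) ⟫ W = ⟪ funit A ⟫ W by flat_by unitS W.
apply: (@rho_lift_inj (Node L Unit)); unlift; flatten.
by frw2 (mulSf W); frw2 (uf W); exchange; frw2 (m1f W).
Qed.

Let unitlSf W : ⟪ fmul S ⟫ W ∘ ⟪ funit S ⟫ (S ⊗ W)%ob = idm _.
Proof. flat_by unitlS W. Qed.

Local Notation bS := (fcomul S ∘ funit S).
Local Notation formS := (fcounit S ∘ fmul S).

(** Tested against the form, the adjointness form_comulSf reduces this to the unit
    law. *)
Lemma snakeS : run S ∘ (idm S ⊗ formS) ∘ assoc S S S ∘ (bS ⊗ idm S) ∘ luni S = idm S.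
Proof.
apply: form_inj_S; flatten.
by frw5 (form_comulSf W); frw2 (unitlSf (S ⊗ W)%ob).
Qed.

Let snakeSf W : (idm S ⊗ ⟪ fcounit S ⟫ W) ∘ ((idm S ⊗ ⟪ fmul S ⟫ W)
  ∘ (⟪ fcomul S ⟫ (S ⊗ W)%ob ∘ ⟪ funit S ⟫ (S ⊗ W)%ob)) = idm _.
Proof. flat_by snakeS W. Qed.

Lemma snakeS_r : snake_r bS formS.
Proof.
apply: form_inj_S; flatten.
frw2 (exch1_0 (fcounit S) (⟪ fmul S ⟫ W)); frw2 (exch1_0 (fcounit S) (⟪ fcounit S ⟫ W)).
frw2 (exch2 (fmul S) (⟪ fmul S ⟫ W)); frw2 (exch2 (fmul S) (⟪ fcounit S ⟫ W)).
by frw4 (snakeSf W).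
Qed.

Let snakeS_rf W : ⟪ fcounit S ⟫ (S ⊗ W)%ob ∘ (⟪ fmul S ⟫ (S ⊗ W)%ob
  ∘ ((idm S ⊗ ⟪ fcomul S ⟫ W) ∘ (idm S ⊗ ⟪ funit S ⟫ W))) = idm _.
Proof. have := snakeS_r; rewrite /snake_r => s; flat_by s W. Qed.

(** The nested form on S ⊗ S is nondegenerate, since two copies of the copairing
    undo it. *)
Lemma form2_inj_S M (f g : hom M (S ⊗ S)%ob) :
  (forall W Z (h : hom Z (M ⊗ (S ⊗ (S ⊗ W)))%ob),
    ⟪ fcounit S ⟫ W ∘ (⟪ fmul S ⟫ W ∘ ((idm S ⊗ ⟪ fcounit S ⟫ (S ⊗ W)%ob)
      ∘ ((idm S ⊗ ⟪ fmul S ⟫ (S ⊗ W)%ob) ∘ (⟪ f ⟫ (S ⊗ (S ⊗ W))%ob ∘ h))))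
    = ⟪ fcounit S ⟫ W ∘ (⟪ fmul S ⟫ W ∘ ((idm S ⊗ ⟪ fcounit S ⟫ (S ⊗ W)%ob)
      ∘ ((idm S ⊗ ⟪ fmul S ⟫ (S ⊗ W)%ob) ∘ (⟪ g ⟫ (S ⊗ (S ⊗ W))%ob ∘ h))))) ->
  f = g.
Proof.
have E (r : hom M (S ⊗ S)%ob) W Z (h : hom Z (M ⊗ W)%ob) :
    ⟪ r ⟫ W ∘ h = ⟪ fcounit S ⟫ (S ⊗ (S ⊗ W))%ob ∘ (⟪ fmul S ⟫ (S ⊗ (S ⊗ W))%ob
      ∘ ((idm S ⊗ ⟪ fcounit S ⟫ (S ⊗ (S ⊗ (S ⊗ W)))%ob)
      ∘ ((idm S ⊗ ⟪ fmul S ⟫ (S ⊗ (S ⊗ (S ⊗ W)))%ob)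
      ∘ (⟪ r ⟫ (S ⊗ (S ⊗ (S ⊗ (S ⊗ W))))%ob
      ∘ ((idm M ⊗ (idm S ⊗ ⟪ fcomul S ⟫ (S ⊗ W)%ob))
      ∘ ((idm M ⊗ (idm S ⊗ ⟪ funit S ⟫ (S ⊗ W)%ob))
      ∘ ((idm M ⊗ ⟪ fcomul S ⟫ W) ∘ ((idm M ⊗ ⟪ funit S ⟫ W) ∘ h)))))))).
  by exchange; frw4 (snakeS_rf W); frw4 (snakeS_rf (S ⊗ W)%ob).
by move=> e; flatten; rewrite E e -E.
Qed.

(** Both sides are adjoint to the product of S for the nondegenerate form. *)
Lemma comulSE : fcomul S = (fmul S ⊗ idm S) ∘ associ S S S ∘ (idm S ⊗ bS) ∘ runi S.
Proof.
pose d := (fmul S ⊗ idm S) ∘ associ S S S ∘ (idm S ⊗ bS) ∘ runi S.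
have dE W : ⟪ d ⟫ W = ⟪ fmul S ⟫ (S ⊗ W)%ob ∘ ((idm S ⊗ ⟪ fcomul S ⟫ W) ∘ (idm S ⊗ ⟪ funit S ⟫ W)).
  flat_by (erefl : d = (fmul S ⊗ idm S) ∘ associ S S S ∘ (idm S ⊗ bS) ∘ runi S) W.
rewrite -[RHS]/d; apply: form2_inj_S => W Z h; frw5 (form_comulSf W).
frw1 (dE (S ⊗ (S ⊗ W))%ob); frw2 (exch2 (fmul S) (⟪ fmul S ⟫ (S ⊗ W)%ob)).
frw2 (exch2 (fmul S) (⟪ fcounit S ⟫ (S ⊗ W)%ob)).
by frw4 (snakeSf (S ⊗ W)%ob).
Qed.

Theorem transfer_frobenius : is_frobenius S.
Proof. exact: frobenius_of_copairing assocS unitlS unitrS snakeS snakeS_r comulSE. Qed.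

(** Insert the snake identity of A on the first leg; form_dc turns the form of A
    into that of S, whose snake identity then removes the copairing of S. *)
Lemma rho_copair : (rho ⊗ idm (T S)) ∘ lift T Unit LL bS = (idm A ⊗ dc) ∘ (fcomul A ∘ funit A).
Proof.
have sA W : (idm A ⊗ ⟪ fcounit A ⟫ W) ∘ ((idm A ⊗ ⟪ fmul A ⟫ W)
    ∘ (⟪ fcomul A ⟫ (A ⊗ W)%ob ∘ ⟪ funit A ⟫ (A ⊗ W)%ob)) = idm _.
  flat_by (form_snake frobA) W.
have sS W : ⟪ lift T L Unit (fcounit S) ⟫ (T S ⊗ W)%ob ∘ (⟪ mS ⟫ (T S ⊗ W)%ob
    ∘ ((idm (T S) ⊗ ⟪ lift T L LL (fcomul S) ⟫ W) ∘ (idm (T S) ⊗ ⟪ lift T Unit L (funit S) ⟫ W))) = idm _.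
  have := lift_snake_r snakeS_r; rewrite /snake_r; unlift => s; flat_by s W.
rewrite (lift_comp T (t := L)); flatten; rewrite -[LHS]mcomp1l -(sA (T S ⊗ W)%ob); fnorm.
exchange; frw3 (esym (form_dcf (T S ⊗ W)%ob)); exchange.
by frw4 (sS W).
Qed.

(** m Δ is multiplication by the element m Δ η. *)
Lemma handle_eq (E : monCat k) (F : frobData E) (z : k) : is_frobenius F ->
  (fmul F ∘ fcomul F = (z *: idm F)%R <-> fmul F ∘ (fcomul F ∘ funit F) = (z *: funit F)%R).
Proof.
move=> [mA m1 _ _ _ _ f _]; split=> [e|e]; first by rewrite mcompA e mcompZl mcomp1l.
have fW W : (idm F ⊗ ⟪ fmul F ⟫ W) ∘ ⟪ fcomul F ⟫ (F ⊗ W)%ob = ⟪ fcomul F ⟫ W ∘ ⟪ fmul F ⟫ W.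
  flat_by f W.
have m1W W : ⟪ fmul F ⟫ W ∘ ⟪ funit F ⟫ (F ⊗ W)%ob = idm _ by flat_by m1 W.
have mAW W : ⟪ fmul F ⟫ W ∘ ⟪ fmul F ⟫ (F ⊗ W)%ob = ⟪ fmul F ⟫ W ∘ (idm F ⊗ ⟪ fmul F ⟫ W).
  flat_by mA W.
have e1 : fmul F ∘ fcomul F = fmul F ∘ ((fmul F ∘ (fcomul F ∘ funit F)) ⊗ idm F) ∘ luni F.
  flatten; frw2 (mAW W); frw2 (fW W).
  by frw2 (m1W W).
by rewrite e1 e tensmZl mcompZr m1 mcompZl luniK.
Qed.

Lemma lift_scale s t a (f : hom (val s) (val t)) : lift T s t (a *: f)%R = (a *: lift T s t f)%R.
Proof.
have e0 : fun_mor T (0 : hom (val s) (val t)) = 0.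
  by have := @fun_linear _ _ _ T _ _ (-1) (0 : hom (val s) (val t)) 0; rewrite scaleN1r oppr0 addr0 scaleN1r addNr.
have eZ : fun_mor T (a *: f)%R = (a *: fun_mor T f)%R.
  by have := @fun_linear _ _ _ T _ _ a f 0; rewrite e0 !addr0.
by rewrite !liftE eZ mcompZl mcompZr.
Qed.

(** rho maps the element m Δ η of S to that of A, and T carries ε η of S to dim
    times that of A. *)
Theorem transfer_special_with z :
  special_with A z <-> special_with S z.
Proof.
have hS := transfer_frobenius.
have handle : fmul A ∘ fcomul A = (z *: idm A)%R <-> fmul S ∘ fcomul S = (z *: idm S)%R.
  rewrite (handle_eq _ frobA) (handle_eq _ hS).
  have e : rho ∘ lift T Unit L (fmul S ∘ bS) = fmul A ∘ (fcomul A ∘ funit A).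
    rewrite (lift_comp T (t := LL)) (mcompA rho) mulS -(tensm_rl rho) -!mcompA rho_copair.
    by rewrite (mcompA (idm A ⊗ rho)) -tensmM rho_dc mcomp1l tensm1 mcomp1l.
  have e' : rho ∘ lift T Unit L (z *: funit S)%R = (z *: funit A)%R.
    by rewrite lift_scale mcompZr unitS.
  split=> [E|E]; last by rewrite -e -e' E.
  by apply: (@rho_lift_inj Unit); rewrite e e' E.
have unit_eq : lift T Unit Unit (fcounit S ∘ funit S) = (dim *: (fcounit A ∘ funit A))%R.
  by rewrite counit_star unitS.
have units : (exists2 x : k, x != 0 & fcounit A ∘ funit A = (x *: idm one)%R)
    <-> (exists2 x : k, x != 0 & fcounit S ∘ funit S = (x *: idm one)%R).
  split=> [[x nx e]|[x nx e]].
    exists (dim * x)%R; first by rewrite mulf_neq0.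
    by apply: lift_one_inj; rewrite unit_eq e lift_scale (lift_id T Unit) scalerA.
  exists (dim^-1 * x)%R; first by rewrite mulf_neq0 ?invr_eq0.
  apply: scale_dim_inj; rewrite -unit_eq e lift_scale (lift_id T Unit) scalerA mulrA.
  by rewrite divff // mul1r.
rewrite /special_with; split=> -[nz h u]; split=> //; try exact/handle; exact/units.
Qed.

Hypothesis lift_rot : forall (M N : D) (y : hom one (M ⊗ N)%ob),
  lift T Unit (Node (Leaf N) (Leaf M)) (rot y) = rot (lift T Unit (Node (Leaf M) (Leaf N)) y).

(** Symmetry says that the form is invariant under rot, which T respects. The
    invariants (rho ⊗ rho) ∘ T y exhaust those of A ⊗ A, because dc is a section
    of rho. *)
Theorem transfer_symmetric : symmetric_frob A <-> symmetric_frob S.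
Proof.
rewrite !symmetric_frobE /symmetric_form.
have eS : (formS ∘ (twist S ⊗ idm S ∘ braid S S) = formS)
   <-> forall y : hom one (S ⊗ S)%ob, formS ∘ rot y = formS ∘ y.
  split=> [e y|e]; first by rewrite rot_left mcompA e.
  by apply: one_faithD => y; rewrite -mcompA -rot_left e.
have eA : (fcounit A ∘ fmul A ∘ (twist A ⊗ idm A ∘ braid A A) = fcounit A ∘ fmul A)
   <-> forall y : hom one (A ⊗ A)%ob, fcounit A ∘ fmul A ∘ rot y = fcounit A ∘ fmul A ∘ y.
  split=> [e y|e]; first by rewrite rot_left mcompA e.
  by apply: one_faithC => y; rewrite -mcompA -rot_left e.
rewrite eS eA.
have E (y : hom one (S ⊗ S)%ob) : lift T Unit Unit (formS ∘ y)
   = (dim *: (fcounit A ∘ fmul A ∘ ((rho ⊗ rho) ∘ lift T Unit LL y)))%R.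
  by rewrite -mcompA mul_star !mcompA.
split=> e y.
  by apply: lift_one_inj; rewrite !E lift_rot -rot_nat e.
have [y1 e1] := rho_surj_l ((idm A ⊗ dc) ∘ y).
have <- : (rho ⊗ rho) ∘ lift T Unit LL y1 = y.
  rewrite -(tensm_rl rho) -mcompA e1 mcompA -tensmM rho_dc.
  by rewrite mcomp1l tensm1 mcomp1l.
by apply: scale_dim_inj; rewrite rot_nat -lift_rot -!E e.
Qed.
End Transfer.

(** * The functor T *)

Section Coherence.
Variables (k : fieldType) (C : modularCat k).
Implicit Types a b c d e f : C.

(** The hexagon axioms split the braidings with a product; the rest is
    interchange. *)
Lemma mid4_assoc a b c d e f :
  (assoc a c e ⊗ assoc b d f) ∘ (mid4 (a ⊗ c)%ob f (braidi e (b ⊗ d)%ob)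
    ∘ (mid4 a d (braidi c b) ⊗ idm (e ⊗ f)%ob))
  = mid4 a (d ⊗ f)%ob (braidi (c ⊗ e)%ob b) ∘ (idm (a ⊗ b)%ob ⊗ mid4 c f (braidi e d))
    ∘ assoc (a ⊗ b)%ob (c ⊗ d)%ob (e ⊗ f)%ob.
Proof.
rewrite /mid4; flatten.
have h1 : ⟪ braidi e (b ⊗ d)%ob ⟫ (f ⊗ W)%ob = ⟪ braidi e b ⟫ (d ⊗ (f ⊗ W))%ob ∘ (idm b ⊗ ⟪ braidi e d ⟫ (f ⊗ W)%ob).
  flat_by (rev_hexagon2 b d e) (f ⊗ W)%ob.
have h2 : ⟪ braidi (c ⊗ e)%ob b ⟫ (d ⊗ (f ⊗ W))%ob = (idm c ⊗ ⟪ braidi e b ⟫ (d ⊗ (f ⊗ W))%ob) ∘ ⟪ braidi c b ⟫ (e ⊗ (d ⊗ (f ⊗ W)))%ob.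
  flat_by (rev_hexagon1 b c e) (d ⊗ (f ⊗ W))%ob.
by frw1 h1; frw1 h2; exchange.
Qed.

Lemma mid4_lun c d :
  (lun c ⊗ lun d) ∘ (mid4 one d (braidi c one) ∘ (luni one ⊗ idm (c ⊗ d)%ob)) = lun (c ⊗ d)%ob.
Proof.
rewrite /mid4; flatten.
have e : ⟪ braidi c one ⟫ (d ⊗ W)%ob = idm _ by exact: (braid_onel (C := rev C) c (d ⊗ W)%ob).
by frw1 e.
Qed.

Lemma mid4_run a b :
  (run a ⊗ run b) ∘ (mid4 a one (braidi one b) ∘ (idm (a ⊗ b)%ob ⊗ luni one)) = run (a ⊗ b)%ob.
Proof.
rewrite /mid4; flatten.
have e : ⟪ braidi one b ⟫ W = idm _ by exact: (braid_oner (C := rev C) b W).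
by frw1 e.
Qed.

End Coherence.

Section Functor.
Variables (k : fieldType) (C : modularCat k).
Local Notation P := (pairs C (rev C)).
Local Notation D := (C2 C).
Local Notation inj := (dinj (mod_sums C)).
Local Notation prj := (dprj (mod_sums C)).
Implicit Types (X Y Z : (C * C)%type) (M N : D).

(** T on morphisms between single pairs. *)
Definition tau X Y (t : tensor (hom X.1 Y.1) (hom X.2 Y.2)) :
    hom (X.1 ⊗ X.2)%ob (Y.1 ⊗ Y.2)%ob :=
  tlift (@tensm k C X.1 Y.1 X.2 Y.2) t.

Lemma tau_pure X Y (f : hom X.1 Y.1) (g : hom X.2 Y.2) : tau (pure f g) = f ⊗ g.
Proof. exact: tlift_pure (tensm_bilinear _ _ _ _). Qed.

Lemma tau_linear X Y : linear (@tau X Y).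
Proof. exact: tlift_linear. Qed.

Lemma tauM X Y Z (g : pair_hom (D := rev C) Y Z) (f : pair_hom (D := rev C) X Y) :
  tau (pair_comp g f) = tau g ∘ tau f.
Proof.
elim/tensor_ind: g => [a s t es et|g1 g2].
  by rewrite (pair_comp_bilinear _ _ _).1 !tau_linear es et mcompDl.
elim/tensor_ind: f => [a s t es et|f1 f2].
  by rewrite (pair_comp_bilinear _ _ _).2 !tau_linear es et mcompDr.
by rewrite pair_comp_pure !tau_pure tensmM.
Qed.

Lemma linear_fun0 (V W : vectType k) (f : V -> W) : linear f -> f 0 = 0.
Proof. by move=> lf; have := lf (-1) 0 0; rewrite scaler0 addr0 scaleN1r addNr. Qed.

Lemma linearZ_fun (V W : vectType k) (f : V -> W) a v : linear f -> f (a *: v)%R = (a *: f v)%R.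
Proof. by move=> lf; have := lf a v 0; rewrite (linear_fun0 lf) !addr0. Qed.

Lemma linear_sum_fun (V W : vectType k) (f : V -> W) (I : finType) (F : I -> V) :
  linear f -> f (\sum_i F i) = \sum_i f (F i).
Proof.
move=> lf; elim/big_ind2: _ => [|x y x' y' <- <-|//]; first exact: linear_fun0.
by have := lf 1 y y'; rewrite !scale1r.
Qed.

Lemma tauZ X Y a t : @tau X Y (a *: t)%R = (a *: tau t)%R.
Proof. exact: linearZ_fun (@tau_linear X Y). Qed.

Lemma pureZl (U V : vectType k) c (u : U) (v : V) : pure (c *: u)%R v = (c *: pure u v)%R.
Proof. exact: (linearZ_fun _ _ (fun e x y => (pure_bilinear U V).1 v e x y)). Qed.

Lemma pureZr (U V : vectType k) c (u : U) (v : V) : pure u (c *: v)%R = (c *: pure u v)%R.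
Proof. exact: (linearZ_fun _ _ (fun e x y => (pure_bilinear U V).2 u e x y)). Qed.

Lemma pure0l (U V : vectType k) (v : V) : pure (0 : U) v = 0.
Proof. exact: (linear_fun0 (fun e x y => (pure_bilinear U V).1 v e x y)). Qed.

Lemma pure_sumr (U V : vectType k) (I : finType) (u : U) (F : I -> V) :
  pure u (\sum_i F i) = \sum_i pure u (F i).
Proof. exact: (linear_sum_fun _ (fun e x y => (pure_bilinear U V).2 u e x y)). Qed.

Definition T_mor M N (F : hom M N) : hom (T_ob M) (T_ob N) :=
  (\sum_m \sum_n inj (@T_fam _ C N) n ∘ tau (entry F m n) ∘ prj (@T_fam _ C M) m)%R.

Section Blocks.
Variables (I : finType) (X : I -> C).

Lemma blocks_in (W : C) (f g : hom (dsum (mod_sums C) X) W) :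
  (forall i, f ∘ inj X i = g ∘ inj X i) -> f = g.
Proof.
move=> e; rewrite -[f]mcomp1r -[g]mcomp1r -dsum_id !mcomp_sumr.
by apply: eq_bigr => i _; rewrite !mcompA e.
Qed.

Lemma blocks_out (W : C) (f g : hom W (dsum (mod_sums C) X)) :
  (forall i, prj X i ∘ f = prj X i ∘ g) -> f = g.
Proof.
move=> e; rewrite -[f]mcomp1l -[g]mcomp1l -dsum_id !mcomp_suml.
by apply: eq_bigr => i _; rewrite -!mcompA e.
Qed.

End Blocks.

Lemma T_mor_inj M N (F : hom M N) m :
  T_mor F ∘ inj (@T_fam _ C M) m = (\sum_n inj (@T_fam _ C N) n ∘ tau (entry F m n))%R.
Proof.
rewrite /T_mor mcomp_suml (bigD1 m) //= [X in (_ + X)%R]big1 ?addr0; last first.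
  move=> m' nm; rewrite mcomp_suml big1 // => n _.
  by rewrite -!mcompA dprj_inj0 // !mcomp0r.
rewrite mcomp_suml; apply: eq_bigr => n _.
by rewrite -!mcompA dprj_inj mcomp1r.
Qed.

Lemma prj_T_mor M N (F : hom M N) n :
  prj (@T_fam _ C N) n ∘ T_mor F = (\sum_m tau (entry F m n) ∘ prj (@T_fam _ C M) m)%R.
Proof.
rewrite /T_mor mcomp_sumr; apply: eq_bigr => m _.
rewrite mcomp_sumr (bigD1 n) //= [X in (_ + X)%R]big1 ?addr0; last first.
  by move=> n' nn; rewrite !mcompA dprj_inj0 1?eq_sym // !mcomp0l.
by rewrite !mcompA dprj_inj mcomp1l.
Qed.

Lemma prj_T_mor_inj M N (F : hom M N) m n :
  prj (@T_fam _ C N) n ∘ T_mor F ∘ inj (@T_fam _ C M) m = tau (entry F m n).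
Proof.
rewrite prj_T_mor mcomp_suml (bigD1 m) //= [X in (_ + X)%R]big1 ?addr0; last first.
  by move=> i ni; rewrite -!mcompA dprj_inj0 ?mcomp0r.
by rewrite -!mcompA dprj_inj mcomp1r.
Qed.

Lemma T_mor_linear M N : linear (@T_mor M N).
Proof.
move=> a F G; apply: blocks_in => m; apply: blocks_out => n.
rewrite mcompA prj_T_mor_inj mcompDl mcompDr !mcompA !prj_T_mor_inj.
by rewrite entry_lin tau_linear.
Qed.

Lemma T_mor_along M N s (h : forall j, hom (M j : P) (N (s j))) m :
  T_mor (along (E := P) (X := M) (Y := N) h : hom (M : D) N) ∘ inj (@T_fam _ C M) m
  = inj (@T_fam _ C N) (s m) ∘ tau (h m).
Proof.
rewrite T_mor_inj (bigD1 (s m)) //= entryE kron_id [X in (_ + X)%R]big1 ?addr0 // => n ns.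
by rewrite entryE kron_neq 1?eq_sym // linear_fun0 ?mcomp0r //; exact: tau_linear.
Qed.

Lemma T_mor_id M : T_mor (idm M) = idm (T_ob M).
Proof.
apply: blocks_in => m; rewrite (T_mor_along (N := M) (s := id)) /= tau_pure tensm1 mcomp1l.
by rewrite mcomp1r.
Qed.

Lemma T_morM M N (O : D) (G : hom N O) (F : hom M N) : T_mor (G ∘ F) = T_mor G ∘ T_mor F.
Proof.
apply: blocks_in => m; apply: blocks_out => o.
rewrite mcompA prj_T_mor_inj -[in RHS]mcompA T_mor_inj !mcomp_sumr.
rewrite entryE linear_sum_fun; last exact: tau_linear.
by apply: eq_bigr => n _; rewrite !mcompA prj_T_mor_inj; exact: tauM.
Qed.

Local Notation phi := (@phiT2 k C).
Local Notation psi := (@psiT2 k C).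
Local Notation mid m n M N := (mid4 (M m).1 (N n).2 (braidi (N n).1 (M m).2)).
Local Notation mid' m n M N := (mid4 (M m).1 (N n).2 (braid (N n).1 (M m).2)).

Section Blocks2.
Variables (I J : finType) (X : I -> C) (Y : J -> C) (W : C).

Lemma sum_prj2 (G : forall i j, hom (X i ⊗ Y j)%ob W) i j :
  (\sum_i \sum_j G i j ∘ (prj X i ⊗ prj Y j))%R ∘ (inj X i ⊗ inj Y j) = G i j.
Proof.
rewrite mcomp_suml (bigD1 i) //= [X in (_ + X)%R]big1 ?addr0; last first.
  move=> i' ni; rewrite mcomp_suml big1 // => j' _.
  by rewrite -!mcompA -tensmM dprj_inj0 // tensm0l !mcomp0r.
rewrite mcomp_suml (bigD1 j) //= [X in (_ + X)%R]big1 ?addr0; last first.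
  by move=> j' nj; rewrite -!mcompA -tensmM (dprj_inj0 _ _ nj) tensm0r !mcomp0r.
by rewrite -!mcompA -tensmM !dprj_inj tensm1 !mcomp1r.
Qed.

Lemma sum_inj2 (G : forall i j, hom W (X i ⊗ Y j)%ob) i j :
  (prj X i ⊗ prj Y j) ∘ (\sum_i \sum_j (inj X i ⊗ inj Y j) ∘ G i j)%R = G i j.
Proof.
rewrite mcomp_sumr (bigD1 i) //= [X in (_ + X)%R]big1 ?addr0; last first.
  move=> i' ni; rewrite mcomp_sumr big1 // => j' _.
  by rewrite !mcompA -tensmM dprj_inj0 1?eq_sym // tensm0l !mcomp0l.
rewrite mcomp_sumr (bigD1 j) //= [X in (_ + X)%R]big1 ?addr0; last first.
  move=> j' nj; have nj' : j != j' by rewrite eq_sym.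
  by rewrite !mcompA -tensmM (dprj_inj0 _ _ nj') tensm0r !mcomp0l.
by rewrite !mcompA -tensmM !dprj_inj tensm1 !mcomp1l.
Qed.
End Blocks2.

Lemma phi_inj M N m n :
  phi M N ∘ (inj (@T_fam _ C M) m ⊗ inj (@T_fam _ C N) n)
  = inj (@T_fam _ C (tens2 M N)) (m, n) ∘ mid m n M N.
Proof.
exact: (sum_prj2 (fun m n => inj (@T_fam _ C (tens2 M N)) (m, n) ∘ mid m n M N)).
Qed.

Lemma prj_psi M N m n :
  (prj (@T_fam _ C M) m ⊗ prj (@T_fam _ C N) n) ∘ psi M N
  = mid' m n M N ∘ prj (@T_fam _ C (tens2 M N)) (m, n).
Proof.
rewrite /psiT2.
under eq_bigr do under eq_bigr do rewrite -mcompA.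
exact: (sum_inj2 (fun m n => mid' m n M N ∘ prj (@T_fam _ C (tens2 M N)) (m, n))).
Qed.

Lemma blocks_in2 (I J : finType) (X : I -> C) (Y : J -> C) (W : C)
    (f g : hom (dsum (mod_sums C) X ⊗ dsum (mod_sums C) Y)%ob W) :
  (forall i j, f ∘ (inj X i ⊗ inj Y j) = g ∘ (inj X i ⊗ inj Y j)) -> f = g.
Proof.
move=> e; rewrite -[f]mcomp1r -[g]mcomp1r -tensm1 -!dsum_id tensm_suml !mcomp_sumr.
apply: eq_bigr => i _; rewrite tensm_sumr !mcomp_sumr; apply: eq_bigr => j _.
by rewrite tensmM !mcompA e.
Qed.

Lemma tau_tens X X' Y Y' (s : pair_hom (D := rev C) X X') (t : pair_hom (D := rev C) Y Y') :
  tau (pair_tensm s t) ∘ mid4 X.1 Y.2 (braidi Y.1 X.2)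
  = mid4 X'.1 Y'.2 (braidi Y'.1 X'.2) ∘ (tau s ⊗ tau t).
Proof.
elim/tensor_ind: s => [a s s' es es'|f f'].
  rewrite (pair_tensm_bilinear _ _ _ _).1 !tau_linear (tensm_bilinear _ _ _ _).1.
  by rewrite mcompDl mcompDr es es'.
elim/tensor_ind: t => [a t t' et et'|g g'].
  rewrite (pair_tensm_bilinear _ _ _ _).2 !tau_linear (tensm_bilinear _ _ _ _).2.
  by rewrite mcompDl mcompDr et et'.
rewrite pair_tensm_pure !tau_pure /mid4; flatten.
have n W' : (⟪ g ⟫ (X'.2 ⊗ W')%ob ∘ ((idm Y.1 ⊗ ⟪ f' ⟫ W') ∘ ⟪ braidi Y.1 X.2 ⟫ W')) =
   ⟪ braidi Y'.1 X'.2 ⟫ W' ∘ (⟪ f' ⟫ (Y'.1 ⊗ W')%ob ∘ (idm X.2 ⊗ ⟪ g ⟫ W')).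
  flat_by (esym (rev_nat (C := C) f' g)) W'.
frw2 (exch22 (braidi Y.1 X.2) (⟪ g' ⟫ W)); frw3 (n (Y'.2 ⊗ W)%ob); exchange.
by [].
Qed.

Lemma phi_nat M N M' N' (f : hom M M') (g : hom N N') :
  T_mor (f ⊗ g) ∘ phi M N = phi M' N' ∘ (T_mor f ⊗ T_mor g).
Proof.
apply: blocks_in2 => m n; rewrite -!mcompA phi_inj -tensmM !T_mor_inj.
rewrite mcompA T_mor_inj mcomp_suml tensm_suml mcomp_sumr.
under [RHS]eq_bigr do rewrite tensm_sumr mcomp_sumr.
rewrite pair_bigA /=; apply: eq_bigr => -[m' n'] _ /=.
rewrite tensmM mcompA phi_inj -mcompA -[in RHS](mcompA (inj _ _)); congr (_ ∘ _).
rewrite (entryE (X := sum_tens M N) (Y := sum_tens M' N')) /=.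
exact: tau_tens.
Qed.

Lemma psi_inj M N : inverses (phi M N) (psi M N).
Proof. exact: inverses_phiT2. Qed.

Lemma push4 (E : linCat k) (U V W X Y Z : E) (a : hom V Y) (b : hom U V)
    (c : hom X Y) (d : hom U X) (e : hom W U) (f : hom Z W) :
  a ∘ b = c ∘ d -> a ∘ ((b ∘ e) ∘ f) = c ∘ (d ∘ (e ∘ f)).
Proof. by move=> eq; rewrite -(mcompA b) mcompA eq !mcompA. Qed.

Lemma pull3 (E : linCat k) (U V W X Y Z : E) (a : hom V Y) (b : hom U V)
    (c : hom X Y) (d : hom U X) (e : hom W U) (f : hom Z W) :
  a ∘ b = c ∘ d -> ((a ∘ b) ∘ e) ∘ f = c ∘ ((d ∘ e) ∘ f).
Proof. by move=> ->; rewrite -!mcompA. Qed.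

Lemma T_assoc M N O :
  T_mor (assoc M N O) ∘ (phi (M ⊗ N)%ob O ∘ (phi M N ⊗ idm (T_ob O)))
  = phi M (N ⊗ O)%ob ∘ (idm (T_ob M) ⊗ phi N O) ∘ assoc _ _ _.
Proof.
have ext (W : C) (f g : hom ((T_ob M ⊗ T_ob N) ⊗ T_ob O)%ob W) :
    (forall m n o, f ∘ ((inj (@T_fam _ C M) m ⊗ inj (@T_fam _ C N) n) ⊗ inj (@T_fam _ C O) o)
     = g ∘ ((inj (@T_fam _ C M) m ⊗ inj (@T_fam _ C N) n) ⊗ inj (@T_fam _ C O) o)) -> f = g.
  move=> e; rewrite -[f]mcomp1r -[g]mcomp1r -!tensm1.
  have I (O' : D) : idm (T_ob O') = (\sum_o inj (@T_fam _ C O') o ∘ prj (@T_fam _ C O') o)%R by rewrite dsum_id.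
  rewrite !I !tensm_suml !mcomp_sumr.
  apply: eq_bigr => i _; rewrite tensm_sumr !mcomp_sumr; apply: eq_bigr => l _.
  rewrite tensm_sumr tensm_suml !mcomp_sumr; apply: eq_bigr => j _.
  by rewrite !tensmM !mcompA e.
apply: ext => m n o.
have A : T_mor (assoc M N O) ∘ inj (@T_fam _ C (tens2 (tens2 M N) O)) (m, n, o)
    = inj (@T_fam _ C (tens2 M (tens2 N O))) (m, (n, o))
      ∘ (assoc (M m).1 (N n).1 (O o).1 ⊗ assoc (M m).2 (N n).2 (O o).2).
  rewrite -(tau_pure (X := (((M m).1 ⊗ (N n).1) ⊗ (O o).1, ((M m).2 ⊗ (N n).2) ⊗ (O o).2)%ob)
    (Y := ((M m).1 ⊗ ((N n).1 ⊗ (O o).1), (M m).2 ⊗ ((N n).2 ⊗ (O o).2))%ob)).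
  exact: (T_mor_along (M := ((M ⊗ N) ⊗ O)%ob) (N := (M ⊗ (N ⊗ O))%ob)
    (s := fun p => (p.1.1, (p.1.2, p.2))) (fun p => assoc (M p.1.1 : P) (N p.1.2 : P) (O p.2 : P)) (m, n, o)).
rewrite -[in LHS]mcompA -[in LHS](mcompA (phi _ _)) -tensmM phi_inj mcomp1l.
rewrite -(mcomp1r (inj _ o)) tensmM (mcompA (phi _ _)) phi_inj mcomp1r.
apply: etrans (push4 _ _ A) _.
rewrite -[in RHS](mcompA _ (assoc _ _ _)) assoc_nat [in RHS]mcompA -[in RHS](mcompA (phi _ _)).
rewrite -tensmM mcomp1l phi_inj -[inj _ m](mcomp1r) tensmM (mcompA (phi _ _)).
apply: etrans _ (esym (pull3 _ _ (@phi_inj M (tens2 N O) m (n, o)))).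
by congr (_ ∘ _); exact: mid4_assoc.
Qed.

Lemma T_lun M : T_mor (lun M) ∘ (phi (one2 C) M ∘ (phiT0 C ⊗ idm (T_ob M))) = lun _.
Proof.
have ext (W : C) (f g : hom (one ⊗ T_ob M)%ob W) :
    (forall m, f ∘ (idm one ⊗ inj (@T_fam _ C M) m) = g ∘ (idm one ⊗ inj (@T_fam _ C M) m)) -> f = g.
  move=> e; rewrite -[f]mcomp1r -[g]mcomp1r -!tensm1.
  have -> : idm (T_ob M) = (\sum_o inj (@T_fam _ C M) o ∘ prj (@T_fam _ C M) o)%R by rewrite dsum_id.
  rewrite tensm_sumr !mcomp_sumr; apply: eq_bigr => j _.
  by rewrite tenslM !mcompA e.
apply: ext => m.
have A : T_mor (lun M) ∘ inj (@T_fam _ C (tens2 (one2 C) M)) (tt, m)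
    = inj (@T_fam _ C M) m ∘ (lun (M m).1 ⊗ lun (M m).2).
  rewrite -(tau_pure (X := (one ⊗ (M m).1, one ⊗ (M m).2)%ob) (Y := M m)).
  exact: (T_mor_along (M := (one ⊗ M)%ob) (N := M) (s := snd) (fun p => lun (M p.2 : P)) (tt, m)).
rewrite lun_nat -[in LHS]mcompA -[in LHS](mcompA (phi _ _)) -tensmM mcomp1l mcomp1r.
rewrite /phiT0 -(mcomp1r (inj (@T_fam _ C M) m)) tensmM (mcompA (phi _ _)).
apply: etrans (congr1 (fun x => T_mor (lun M) ∘ (x ∘ _)) (@phi_inj (one2 C) M tt m)) _.
apply: etrans (push4 _ _ A) _; rewrite mcomp1r; congr (_ ∘ _).
exact: mid4_lun.
Qed.

Lemma T_run M : T_mor (run M) ∘ (phi M (one2 C) ∘ (idm (T_ob M) ⊗ phiT0 C)) = run _.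
Proof.
have ext (W : C) (f g : hom (T_ob M ⊗ one)%ob W) :
    (forall m, f ∘ (inj (@T_fam _ C M) m ⊗ idm one) = g ∘ (inj (@T_fam _ C M) m ⊗ idm one)) -> f = g.
  move=> e; rewrite -[f]mcomp1r -[g]mcomp1r -!tensm1.
  have -> : idm (T_ob M) = (\sum_o inj (@T_fam _ C M) o ∘ prj (@T_fam _ C M) o)%R by rewrite dsum_id.
  rewrite tensm_suml !mcomp_sumr; apply: eq_bigr => j _.
  by rewrite tensrM !mcompA e.
apply: ext => m.
have A : T_mor (run M) ∘ inj (@T_fam _ C (tens2 M (one2 C))) (m, tt)
    = inj (@T_fam _ C M) m ∘ (run (M m).1 ⊗ run (M m).2).
  rewrite -(tau_pure (X := ((M m).1 ⊗ one, (M m).2 ⊗ one)%ob) (Y := M m)).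
  exact: (T_mor_along (M := (M ⊗ one)%ob) (N := M) (s := fst) (fun p => run (M p.1 : P)) (m, tt)).
rewrite run_nat -[in LHS]mcompA -[in LHS](mcompA (phi _ _)) -tensmM mcomp1l mcomp1r.
rewrite /phiT0 -(mcomp1r (inj (@T_fam _ C M) m)) tensmM (mcompA (phi _ _)).
apply: etrans (congr1 (fun x => T_mor (run M) ∘ (x ∘ _)) (@phi_inj M (one2 C) m tt)) _.
apply: etrans (push4 _ _ A) _; rewrite mcomp1r; congr (_ ∘ _).
exact: mid4_run.
Qed.

Definition T_fun : monFunctor D C := @MonFunctor k D C (@T_ob k C) T_mor T_mor_linear
  T_mor_id T_morM phi psi psi_inj phi_nat (phiT0 C) (psiT0 C) (inverses_phiT0 C)
  T_assoc T_lun T_run.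

End Functor.

(** * Invariants under T *)

Section Slides.
Variables (k : fieldType) (C : modularCat k).
Implicit Types a b c d u A : C.

Definition transpose u d (y : hom one (u ⊗ d)%ob) : hom u^∨ d :=
  lun d ∘ (ev u ⊗ idm d) ∘ associ _ _ _ ∘ (idm u^∨ ⊗ y) ∘ runi u^∨.

(** The strand c crosses the strands of the second components on one side only,
    so these can be pulled off it; they close up to a map b ⊗ u^∨ -> 1. *)
Lemma star_slide A u a b c d (G : hom A (a ⊗ b)%ob) (y1 : hom one ((A ⊗ u^∨) ⊗ c)%ob)
    (y2 : hom one (u ⊗ d)%ob) (k1 : hom (a ⊗ c)%ob one) (k2 : hom (b ⊗ d)%ob one) :
  lun one ∘ ((k1 ⊗ k2) ∘ mid4 a d (braidi c b))
    ∘ (((G ∘ (run A ∘ (idm A ⊗ ev u) ∘ assoc A u^∨ u)) ⊗ idm (c ⊗ d)%ob)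
    ∘ (mid4 (A ⊗ u^∨)%ob d (braid c u) ∘ ((y1 ⊗ y2) ∘ luni one)))
  = k1 ∘ (((run a ∘ (idm a ⊗ (k2 ∘ (idm b ⊗ transpose y2))) ∘ assoc a b u^∨ ∘ (G ⊗ idm u^∨))
      ⊗ idm c) ∘ y1).
Proof.
rewrite /mid4 /transpose; flatten.
frw2 (slide_over_cap c k2 W); exchange; frw2 (slide_over_cup c y2 W).
frw2 (esym (exch_cap (ev u) (⟪ braidi c d ⟫ W))); frw2 (braidiKf c d W).
by exchange.
Qed.

(** In the reversed category the leg is carried round on the other side, which
    makes no difference to rot. *)
Lemma rot_rev X Y (z : hom one (X ⊗ Y)%ob) : rot (C := rev C) z = rot (C := C) z.
Proof. by rewrite rot_right rot_inv. Qed.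

(** Carry the two strands of the last factor round one after the other
    (rot_tens); each one passes the other component by a slide. *)
Lemma rot_mid4 a b c d (z1 : hom one (a ⊗ c)%ob) (z2 : hom one (b ⊗ d)%ob) :
  mid4 c b (braid a d) ∘ ((rot z1 ⊗ rot z2) ∘ luni one)
  = rot (mid4 a d (braid c b) ∘ ((z1 ⊗ z2) ∘ luni one)).
Proof.
pose g := assoc b c d ∘ (braid c b ⊗ idm d) ∘ associ c b d ∘ (idm c ⊗ z2) ∘ runi c.
pose g' := associ c d a ∘ ((idm c ⊗ braid a d)) ∘ assoc c a d ∘ (rot z1 ⊗ idm d) ∘ luni d.
have e1 : assoc _ _ _ ∘ (mid4 a d (braid c b) ∘ ((z1 ⊗ z2) ∘ luni one)) = (idm a ⊗ g) ∘ z1.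
  by rewrite /g /mid4; flatten; exchange.
have e2 : assoc b (c ⊗ d)%ob a ∘ ((g ⊗ idm a) ∘ rot z1) = (idm b ⊗ g') ∘ z2.
  rewrite /g /g'; flatten.
  frw2 (slide_over_cup c z2 (a ⊗ W)%ob); frw2 (slide_under_cup d (rot z1) W).
  by exchange.
have e3 : assoc (c ⊗ d)%ob a b ∘ ((g' ⊗ idm b) ∘ rot z2)
   = mid4 c b (braid a d) ∘ ((rot z1 ⊗ rot z2) ∘ luni one).
  by rewrite /g' /mid4; flatten; exchange.
by rewrite rot_tens e1 rot_nat e2 rot_nat e3.
Qed.
End Slides.

(** * The right adjoint R *)

Section Concrete.
Variables (k : fieldType) (C : modularCat k) (B : dualBases C).
Local Notation P := (pairs C (rev C)).
Local Notation D := (C2 C).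
Local Notation inj := (dinj (mod_sums C)).
Local Notation prj := (dprj (mod_sums C)).
Local Notation d i := (qdim (smp i : C)).
Local Notation T := (T_fun C).
Implicit Types (M N : D) (A V : C).

(** Expand id_V over the simple objects. Only V -> U_i contributes, since a map
    U_j ⊗ U_i^∨ -> 1 amounts to one from U_j to U_i, hence vanishes or is a
    multiple of ev'. The multiple is found by closing up with coev, where ev'
    has the value d_i. *)
Lemma cap_expand i V (phi : hom (V ⊗ (smp i)^∨)%ob one) :
  phi = (\sum_a ((d i)^-1 * scalar_of (phi ∘ ((tnth (blo B V i) a ⊗ idm _) ∘ coev (smp i))))
    *: (ev' (smp i) ∘ (tnth (bup B V i) a ⊗ idm _)))%R.
Proof.
rewrite -[LHS]mcomp1r -tensm1 -(complete B V) tensm_suml mcomp_sumr (bigD1 i) //=.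
have cap j (psi : hom (smp j ⊗ (smp i)^∨)%ob one) :
    exists f : hom (smp j : C) (smp i), psi = ev' (smp i) ∘ (f ⊗ idm _).
  exists (lun (smp i) ∘ (psi ⊗ idm _) ∘ associ _ _ _ ∘ (idm _ ⊗ coev' (smp i)) ∘ runi (smp j)).
  flatten; rewrite exchange_cap. by frw2 (snakeP W (@snake_coev' _ _ (smp i))).
rewrite [X in (_ + X)%R]big1 ?addr0; last first.
  move=> j nj; rewrite tensm_suml mcomp_sumr big1 // => a _.
  rewrite tensrM mcompA; have [f ->] := cap j (phi ∘ (tnth (blo B V j) a ⊗ idm _)).
  by rewrite (hom_smp0 f nj) tensm0l mcomp0r mcomp0l.
rewrite tensm_suml mcomp_sumr; apply: eq_bigr => a _.
rewrite tensrM !mcompA; set psi := phi ∘ _.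
have [f ef] := cap i psi; have [c ec] := end_smp B f.
have -> : psi = (c *: ev' (smp i))%R by rewrite ef ec tensmZl tensm1 mcompZr mcomp1r.
by rewrite !mcompZl (qdim'E B) scalerA scalar_ofZ mulrC mulfK ?(qdim_smp_neq0 B).
Qed.


Lemma lift_form M N (c : hom (M ⊗ N)%ob one) m n :
  lift T (Node (Leaf M) (Leaf N)) Unit c ∘ (inj (@T_fam _ C M) m ⊗ inj (@T_fam _ C N) n)
  = lun one ∘ (tau (X := ((M m).1 ⊗ (N n).1, (M m).2 ⊗ (N n).2)%ob) (Y := (one, one))
        (entry (X := sum_tens M N) (Y := sum_one P) c (m, n) tt)
      ∘ mid4 (M m).1 (N n).2 (braidi (N n).1 (M m).2)).
Proof.
have -> : lift T (Node (Leaf M) (Leaf N)) Unit c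
    = (lun one ∘ prj (@T_fam _ C (one2 C)) tt) ∘ (T_mor c ∘ @phiT2 k C M N).
  by rewrite liftE /= tensm1 mcomp1r.
rewrite -!mcompA phi_inj (mcompA (T_mor c)) (mcompA (prj _ _)); congr (_ ∘ (_ ∘ _)).
rewrite mcompA; exact: (prj_T_mor_inj (M := tens2 M N) (N := one2 C)).
Qed.

Lemma lift_elt M N (y : hom one (M ⊗ N)%ob) m n :
  (prj (@T_fam _ C M) m ⊗ prj (@T_fam _ C N) n) ∘ lift T Unit (Node (Leaf M) (Leaf N)) y
  = mid4 (M m).1 (N n).2 (braid (N n).1 (M m).2)
    ∘ (tau (X := (one, one)) (Y := ((M m).1 ⊗ (N n).1, (M m).2 ⊗ (N n).2)%ob)
        (entry (X := sum_one P) (Y := sum_tens M N) y tt (m, n)) ∘ luni one).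
Proof.
have -> : lift T Unit (Node (Leaf M) (Leaf N)) y
    = @psiT2 k C M N ∘ (T_mor y ∘ (inj (@T_fam _ C (one2 C)) tt ∘ luni one)).
  by rewrite liftE /= tensm1 mcomp1l.
rewrite mcompA prj_psi -mcompA; congr (_ ∘ _).
rewrite !mcompA; congr (_ ∘ _).
exact: (@prj_T_mor_inj k C (one2 C) (tens2 M N) y tt (m, n)).
Qed.

Lemma idm_T M : idm (T_ob M) = (\sum_o inj (@T_fam _ C M) o ∘ prj (@T_fam _ C M) o)%R.
Proof. by rewrite dsum_id. Qed.

Lemma lift_blocks M M' N (c : hom (M' ⊗ N)%ob one) (X : hom (T_ob M) (T_ob M')) (y : hom one (M ⊗ N)%ob) :
  lift T (Node (Leaf M') (Leaf N)) Unit c ∘ ((X ⊗ idm (T_ob N))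
    ∘ lift T Unit (Node (Leaf M) (Leaf N)) y)
  = (\sum_m' \sum_m \sum_n
      (lift T (Node (Leaf M') (Leaf N)) Unit c ∘ (inj (@T_fam _ C M') m' ⊗ inj (@T_fam _ C N) n))
      ∘ (((prj (@T_fam _ C M') m' ∘ X ∘ inj (@T_fam _ C M) m) ⊗ idm (@T_fam _ C N n))
      ∘ ((prj (@T_fam _ C M) m ⊗ prj (@T_fam _ C N) n)
        ∘ lift T Unit (Node (Leaf M) (Leaf N)) y)))%R.
Proof.
rewrite -[X in LHS]mcomp1l -[X in LHS]mcomp1r !idm_T.
rewrite mcomp_suml tensm_suml mcomp_suml mcomp_sumr; apply: eq_bigr => m' _.
rewrite !mcomp_sumr tensm_suml mcomp_suml mcomp_sumr; apply: eq_bigr => m _.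
rewrite tensm_sumr mcomp_suml mcomp_sumr; apply: eq_bigr => n _.
have -> : (inj (@T_fam _ C M') m' ∘ prj (@T_fam _ C M') m' ∘ (X ∘ (inj (@T_fam _ C M) m ∘ prj (@T_fam _ C M) m)))
     ⊗ (inj (@T_fam _ C N) n ∘ prj (@T_fam _ C N) n)
   = (inj (@T_fam _ C M') m' ⊗ inj (@T_fam _ C N) n)
     ∘ (((prj (@T_fam _ C M') m' ∘ X ∘ inj (@T_fam _ C M) m) ⊗ idm (@T_fam _ C N n))
       ∘ (prj (@T_fam _ C M) m ⊗ prj (@T_fam _ C N) n)).
  by rewrite -!tensmM mcomp1l -!mcompA.
by rewrite -!mcompA.
Qed.

Lemma push_id (E : linCat k) (U V X Y Z O : E) (l : hom Y O) (a : hom V Y) (b : hom U V)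
    (c : hom X Y) (d : hom U X) (r : hom Z X) (e : hom X U) :
  a ∘ b = c ∘ d -> d ∘ e = idm X -> (l ∘ a) ∘ (b ∘ (e ∘ r)) = l ∘ (c ∘ r).
Proof. by move=> ab de; rewrite -!mcompA (mcompA a) ab -mcompA (mcompA d) de mcomp1l. Qed.

(** A pairing of products of morphisms is the product of the two pairings; the
    second one is a scalar. *)
Lemma split_forms a b a' b' c c' (k1 : hom (a ⊗ c)%ob one) (k2 : hom (b ⊗ c')%ob one)
    (y1 : hom one (a' ⊗ c)%ob) (y2 : hom one (b' ⊗ c')%ob) (f : hom a' a) (g : hom b' b) :
  lun (one : C) ∘ ((k1 ⊗ k2) ∘ mid4 a c' (braidi c b))
    ∘ (((f ⊗ g) ⊗ idm (c ⊗ c')%ob) ∘ (mid4 a' c' (braid c b') ∘ ((y1 ⊗ y2) ∘ luni one)))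
  = (scalar_of (k2 ∘ ((g ⊗ idm c') ∘ y2)) *: (k1 ∘ ((f ⊗ idm c) ∘ y1)))%R.
Proof.
have nat := tau_tens (X := (a', b')) (X' := (a, b)) (Y := (c, c')) (Y' := (c, c'))
  (pure f g) (pure (idm c) (idm c')).
rewrite pair_tensm_pure !tau_pure tensm1 /= in nat.
have [midK _] := inverses_mid4 a' c' (inverses_braid c b').
transitivity (lun (one : C) ∘ (((k1 ∘ ((f ⊗ idm c) ∘ y1)) ⊗ (k2 ∘ ((g ⊗ idm c') ∘ y2))) ∘ luni one)).
  rewrite !tensmM -!(mcompA (lun _)); congr (_ ∘ _).
  by apply: etrans (push_id _ _ (esym nat) midK) _; rewrite !mcompA.
rewrite (scalar_ofE B (k2 ∘ _)) tensmZr mcompZl mcompZr (scalar_ofZ C).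
by rewrite lun_one (mcompA (run _)) run_nat -(mcompA _ (run _)) -lun_one luniK mcomp1r.
Qed.

(** The component of rho at the i-th summand of R(A). *)
Definition counit_at A i : hom ((A ⊗ (smp i)^∨) ⊗ smp i)%ob A :=
  run A ∘ (idm A ⊗ ev (smp i)) ∘ assoc A (smp i)^∨ (smp i).

Definition partial_trace A a b i (G : hom A (a ⊗ b)%ob) (f : hom b (smp i)) :
    hom (A ⊗ (smp i)^∨)%ob a :=
  run a ∘ (idm a ⊗ ev' (smp i)) ∘ assoc a (smp i) (smp i)^∨
    ∘ ((idm a ⊗ f) ⊗ idm (smp i)^∨) ∘ (G ⊗ idm (smp i)^∨).

(** chi_check_star for morphisms that are pure tensors: after star_slide the
    second components form a map b ⊗ U_i^∨ -> 1, to which cap_expand applies. *)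
Lemma star_pure A i a b c c' (G : hom A (a ⊗ b)%ob) (y1 : hom one ((A ⊗ (smp i)^∨) ⊗ c)%ob)
    (y2 : hom one (smp i ⊗ c')%ob) (k1 : hom (a ⊗ c)%ob one) (k2 : hom (b ⊗ c')%ob one) :
  (\sum_al (d i)^-1 *: (lun one ∘ ((k1 ⊗ k2) ∘ mid4 a c' (braidi c b))
    ∘ (((partial_trace G (tnth (bup B b i) al) ⊗ tnth (blo B b i) al) ⊗ idm (c ⊗ c')%ob)
    ∘ (mid4 (A ⊗ (smp i)^∨)%ob c' (braid c (smp i)) ∘ ((y1 ⊗ y2) ∘ luni one)))))%R
  = lun one ∘ ((k1 ⊗ k2) ∘ mid4 a c' (braidi c b))
    ∘ (((G ∘ counit_at A i) ⊗ idm (c ⊗ c')%ob)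
    ∘ (mid4 (A ⊗ (smp i)^∨)%ob c' (braid c (smp i)) ∘ ((y1 ⊗ y2) ∘ luni one))).
Proof.
rewrite star_slide (cap_expand (k2 ∘ _)) tensm_sumr mcomp_sumr !mcomp_suml.
rewrite tensm_suml mcomp_suml mcomp_sumr; apply: eq_bigr => al _.
rewrite split_forms scalerA !tensmZr !mcompZr !mcompZl tensmZl mcompZl mcompZr.
have -> : k2 ∘ (idm b ⊗ transpose y2) ∘ ((tnth (blo B b i) al ⊗ idm (smp i)^∨) ∘ coev (smp i))
    = k2 ∘ ((tnth (blo B b i) al ⊗ idm c') ∘ y2).
  rewrite /transpose; flatten.
  rewrite 2!(exchange_leaf (tnth (blo B b i) al)) exchange_cup.
  by frw2 (snake1 (smp i : C) (c' ⊗ W)%ob).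
congr (_ *: (_ ∘ (_ ⊗ _ ∘ _)))%R; rewrite /partial_trace; congr (_ ∘ _).
by rewrite -[LHS]mcompA assoc_nat tenslM !mcompA.
Qed.

(** An explicit form of rho_hat (rho_hatE). *)
Definition rho0 A : hom (T_ob (R_ob A)) A :=
  (\sum_i counit_at A i ∘ prj (@T_fam _ C (R_ob A)) i)%R.

Lemma rho0_inj A i : rho0 A ∘ inj (@T_fam _ C (R_ob A)) i = counit_at A i.
Proof.
rewrite /rho0 mcomp_suml (bigD1 i) //= -mcompA dprj_inj mcomp1r big1 ?addr0 // => j nj.
by rewrite -mcompA dprj_inj0 ?mcomp0r.
Qed.

(** Everything is linear in the components, and on pure tensors the sum over the
    dual bases that defines chi_check is the one in star_pure. *)
Lemma chi_check_star A M N (g : hom A (T_ob M)) (y : hom one ((R_ob A : D) ⊗ N)%ob) (c : hom (M ⊗ N)%ob one) :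
  lift T (Node (Leaf M) (Leaf N)) Unit c ∘ ((T_mor (chi_check B g : hom (R_ob A : D) M) ⊗ idm (T_ob N))
    ∘ lift T Unit (Node (Leaf (R_ob A : D)) (Leaf N)) y)
  = (Dim C *: (lift T (Node (Leaf M) (Leaf N)) Unit c ∘ (((g ∘ rho0 A) ⊗ idm (T_ob N))
    ∘ lift T Unit (Node (Leaf (R_ob A : D)) (Leaf N)) y)))%R.
Proof.
rewrite !lift_blocks scaler_sumr; apply: eq_bigr => m _.
rewrite scaler_sumr; apply: eq_bigr => i _.
rewrite scaler_sumr; apply: eq_bigr => n _.
rewrite lift_form lift_elt prj_T_mor_inj -(mcompA (prj _ _)) -(mcompA g) rho0_inj.
rewrite [entry (chi_check B g) i m]entryE /=.
set F := tau (\sum_a _)%R; set G := prj _ m ∘ g; rewrite (mcompA (prj _ m) g) -/G.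
have {F}-> : F = (\sum_a (Dim C / d i) *:
    (partial_trace G (tnth (bup B (M m).2 i) a) ⊗ tnth (blo B (M m).2 i) a))%R.
  rewrite /F linear_sum_fun; last exact: tau_linear.
  by apply: eq_bigr => a _; rewrite tauZ tau_pure.
move: (entry c _ _) (entry y _ _) => tc ty.
elim/tensor_ind: tc => [x s t es et|k1 k2].
  rewrite tau_linear !(mcompDl, mcompDr) es et scalerDr !scalerA.
  by rewrite (mulrC x).
elim/tensor_ind: ty => [x s t es et|y1 y2].
  rewrite tau_linear !(mcompDl, mcompDr) es et scalerDr !scalerA.
  by rewrite (mulrC x).
rewrite !tau_pure -star_pure scaler_sumr tensm_suml mcomp_suml mcomp_sumr.
by apply: eq_bigr => a _; rewrite tensmZl mcompZl mcompZr scalerA.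
Qed.
Definition curry_dual A a i (q : hom (a ⊗ smp i)%ob A) : hom a (A ⊗ (smp i)^∨)%ob :=
  (q ⊗ idm (smp i)^∨) ∘ associ a (smp i) (smp i)^∨ ∘ (idm a ⊗ coev (smp i)) ∘ runi a.

Lemma curry_dual_linear A a i : linear (@curry_dual A a i).
Proof. by move=> c f g; rewrite /curry_dual (tensm_bilinear _ _ _ _).1 !mcompDl. Qed.

Lemma counit_curry_dual A a b i (q : hom (a ⊗ smp i)%ob A) (u : hom b (smp i)) :
  counit_at A i ∘ (curry_dual q ⊗ u) = q ∘ (idm a ⊗ u).
Proof.
rewrite /counit_at /curry_dual; flatten.
frw2 (exch2 q (⟪ ev (smp i) ⟫ W)).
by frw2 (snake1 (smp i : C) W).
Qed.

Lemma curry_dual_counit A a i (p : hom a (A ⊗ (smp i)^∨)%ob) :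
  curry_dual (counit_at A i ∘ (p ⊗ idm (smp i))) = p.
Proof.
rewrite /counit_at /curry_dual; flatten.
have e : ⟪ p ⟫ (smp i ⊗ ((smp i)^∨ ⊗ W))%ob ∘ (idm a ⊗ ⟪ coev (smp i) ⟫ W)
    = (idm A ⊗ (idm (smp i)^∨ ⊗ ⟪ coev (smp i) ⟫ W)) ∘ ⟪ p ⟫ W.
  by apply: trail => Z' h'; fnorm; exchange.
by frw2 e; frw2 (snake2 (smp i : C) W).
Qed.

(** The components of chi_hat (chi_hatE). *)
Definition hat_entry A a b i (f : hom (a ⊗ b)%ob A) :
    tensor (hom a (A ⊗ (smp i)^∨)%ob) (hom b (smp i)) :=
  \sum_al pure (curry_dual (f ∘ (idm a ⊗ tnth (blo B b i) al))) (tnth (bup B b i) al).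

Lemma chi_hatE M A (f : hom (T_ob M) A) n i :
  entry (chi_hat B f) n i = hat_entry i (f ∘ inj (@T_fam _ C M) n).
Proof. by rewrite entryE; apply: eq_bigr => a _; rewrite /curry_dual [in RHS]tensrM. Qed.

Lemma hat_entry_linear A a b i : linear (@hat_entry A a b i).
Proof.
move=> c f g; rewrite /hat_entry scaler_sumr -big_split; apply: eq_bigr => al _ /=.
by rewrite mcompDl curry_dual_linear (pure_bilinear _ _).1.
Qed.

Lemma counit_hat_entry A a b (f : hom (a ⊗ b)%ob A) :
  (\sum_i counit_at A i ∘ tau (X := (a, b)) (Y := (A ⊗ (smp i)^∨, smp i)%ob) (hat_entry i f))%R = f.
Proof.
rewrite -[RHS]mcomp1r -tensm1 -(complete B b) tensm_sumr mcomp_sumr; apply: eq_bigr => i _.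
rewrite (linear_sum_fun _ (@tau_linear k C (a, b) (A ⊗ (smp i)^∨, smp i)%ob)).
rewrite tensm_sumr !mcomp_sumr; apply: eq_bigr => al _.
by rewrite tau_pure counit_curry_dual -mcompA -tensmM mcomp1l.
Qed.

(** On a pure tensor with second factor q : b -> U_j, the composites of q with
    the dual basis U_i -> b vanish for j <> i by Schur's lemma; for j = i they
    are the identity times the coordinates of q. *)
Lemma hat_entry_counit A a b i j (t : tensor (hom a (A ⊗ (smp j)^∨)%ob) (hom b (smp j))) :
  hat_entry i (counit_at A j ∘ tau (X := (a, b)) (Y := (A ⊗ (smp j)^∨, smp j)%ob) t)
  = kron (P := fun i => tensor (hom a (A ⊗ (smp i)^∨)%ob) (hom b (smp i))) t i.
Proof.
have [ji|nji] := eqVneq j i; last first.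
  rewrite kron_neq //; elim/tensor_ind: t => [c s t es et|p q].
    by rewrite tau_linear mcompDr hat_entry_linear es et scaler0 addr0.
  rewrite tau_pure /hat_entry big1 // => al _.
  rewrite -mcompA -tensmM mcomp1r (hom_smp0 (q ∘ _)); last by rewrite eq_sym.
  rewrite tensm0r mcomp0r (linear_fun0 (@curry_dual_linear _ _ _)).
  exact: linear_fun0 (fun c u v => (pure_bilinear _ _).1 _ c u v).
subst i; rewrite kron_id; elim/tensor_ind: t => [c s t es et|p q].
  by rewrite tau_linear mcompDr hat_entry_linear es et.
have [c qE] := bup_span B q.
rewrite tau_pure [in RHS]qE /hat_entry.
have pl := linear_sum_fun _ (fun c u v => (pure_bilinear _ _).2 p c u v).
rewrite pl; apply: eq_bigr => al _.
rewrite -mcompA -tensmM mcomp1r.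
have -> : q ∘ tnth (blo B b j) al = (c al *: idm _)%R.
  rewrite [in LHS]qE mcomp_suml (bigD1 al) //= big1 ?addr0.
    by rewrite mcompZl bup_blo eqxx scale1r.
  by move=> be /negPf nb; rewrite mcompZl bup_blo nb scale0r scaler0.
have -> : p ⊗ (c al *: idm (smp j)) = (c al *: (p ⊗ idm (smp j)))%R.
  by rewrite tensmZr.
rewrite mcompZr (linearZ_fun _ _ (@curry_dual_linear _ _ _)) curry_dual_counit.
have zl (u : hom b (smp j)) := linearZ_fun (c al) p (fun e v w => (pure_bilinear _ _).1 u e v w).
have zr := linearZ_fun (c al) (tnth (bup B b j) al) (fun e v w => (pure_bilinear _ _).2 p e v w).
by rewrite zl -zr.
Qed.

Lemma rho0_T_mor A M (h : hom M (R_ob A : D)) m :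
  rho0 A ∘ T_mor h ∘ inj (@T_fam _ C M) m = (\sum_i counit_at A i ∘ tau (entry h m i))%R.
Proof.
rewrite -mcompA T_mor_inj mcomp_sumr; apply: eq_bigr => i _.
by rewrite mcompA rho0_inj.
Qed.

(** With rho0K, this is the universal property of rho. *)
Lemma chi_hatK M A (f : hom (T_ob M) A) : rho0 A ∘ T_mor (chi_hat B f) = f.
Proof.
apply: blocks_in => n; rewrite rho0_T_mor -[RHS](counit_hat_entry (f ∘ inj _ n)).
by apply: eq_bigr => i _; rewrite chi_hatE.
Qed.

Lemma rho0K M A (h : hom M (R_ob A : D)) : chi_hat B (rho0 A ∘ T_mor h) = h.
Proof.
apply/entryP => n i; rewrite chi_hatE rho0_T_mor.
rewrite (linear_sum_fun _ (@hat_entry_linear A (M n).1 (M n).2 i)).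
rewrite (eq_bigr (fun j => kron (P := fun i => tensor (hom (M n).1 (A ⊗ (smp i)^∨)%ob) (hom (M n).2 (smp i)))
  (entry h n j) i)); last by move=> j _; exact: hat_entry_counit.
rewrite (bigD1 i) //= kron_id big1 ?addr0 // => j nj.
exact: kron_neq.
Qed.

Lemma rho_hatE A : rho_hat B A = rho0 A.
Proof.
have -> : rho0 A = rho0 A ∘ T_mor (idm (R_ob A : D)) by rewrite T_mor_id mcomp1r.
rewrite /rho_hat /chi_hat_inv -{1}(rho0K (idm (R_ob A : D))).
rewrite -(linfunE (@chi_hat_linear k C B (R_ob A) A)) lker0_lfunK //.
apply/lker0P => f g; rewrite !(linfunE (@chi_hat_linear k C B (R_ob A) A)) => e.
by rewrite -[f]chi_hatK e chi_hatK.
Qed.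

Lemma rho0_surj A M (f : hom (T_ob M) A) :
  exists h : hom M (R_ob A : D), rho0 A ∘ T_mor h = f.
Proof. by exists (chi_hat B f); exact: chi_hatK. Qed.

Lemma rho0_faithful A M (h h' : hom M (R_ob A : D)) :
  rho0 A ∘ T_mor h = rho0 A ∘ T_mor h' -> h = h'.
Proof. by move=> e; rewrite -[h]rho0K e rho0K. Qed.

Lemma counit_at_nat A A' (f : hom A A') i :
  counit_at A' i ∘ ((f ⊗ idm (smp i)^∨) ⊗ idm (smp i)) = f ∘ counit_at A i.
Proof. by rewrite /counit_at; flatten; exchange. Qed.

Lemma rho0_nat A A' (f : hom A A') : rho0 A' ∘ T_mor (R_mor f) = f ∘ rho0 A.
Proof.
apply: blocks_in => i.
rewrite -[in LHS]mcompA.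
rewrite (T_mor_along (M := R_ob A) (N := R_ob A') (s := id)
  (fun i => pure (f ⊗ idm (smp i)^∨) (idm (smp i)))).
by rewrite tau_pure mcompA rho0_inj -[in RHS]mcompA rho0_inj; exact: counit_at_nat.
Qed.

Section Algebra.
Variable A : frobData C.
Local Notation S := (R_frob B A).
Local Notation L := (Leaf (fob_ S)).

Lemma rho0_mul : rho0 A ∘ lift T (Node L L) L (fmul S) = fmul A ∘ (rho0 A ⊗ rho0 A).
Proof.
rewrite liftE /= mcomp1l tensm1 mcomp1r.
rewrite /phiR2 rho_hatE !T_morM !mcompA rho0_nat -!mcompA; congr (_ ∘ _).
rewrite (mcompA (rho0 _)) rho0_nat -!mcompA.
rewrite (mcompA (rho0 _)) rho0_nat -!mcompA (mcompA (rho0 _)) chi_hatK mcomp1l.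
by rewrite (inverses_phiT2 _ _).1 mcomp1r.
Qed.

Lemma rho0_unit : rho0 A ∘ lift T Unit L (funit S) = funit A.
Proof.
rewrite liftE /= mcomp1l T_morM !mcompA rho0_nat -!mcompA (mcompA (rho0 _)) chi_hatK.
by rewrite (inverses_phiT0 C).1 mcomp1r.
Qed.
End Algebra.

Lemma partial_trace_linear A a b i (f : hom b (smp i)) : linear (fun G : hom A (a ⊗ b)%ob => partial_trace G f).
Proof. by move=> c G G'; rewrite /partial_trace (tensm_bilinear _ _ _ _).1 mcompDr. Qed.

Definition check_entry A a b i (G : hom A (a ⊗ b)%ob) :
    tensor (hom (A ⊗ (smp i)^∨)%ob a) (hom (smp i) b) :=
  \sum_al (Dim C / d i) *: pure (partial_trace G (tnth (bup B b i) al)) (tnth (blo B b i) al).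

Lemma chi_checkE A M (g : hom A (T_ob M)) i n :
  entry (chi_check B g) i n = check_entry i (prj (@T_fam _ C M) n ∘ g).
Proof. by rewrite entryE. Qed.

Lemma chi_check_nat A A' M (g : hom A' (T_ob M)) (f : hom A A') :
  (chi_check B g : hom (R_ob A' : D) M) ∘ R_mor f = chi_check B (g ∘ f).
Proof.
apply/entryP => i n; rewrite comp_along !chi_checkE /check_entry.
have lc := fun c u v => (@pair_comp_bilinear k C (rev C) (A ⊗ (smp i)^∨, smp i)%ob
  (A' ⊗ (smp i)^∨, smp i)%ob (M n)).1 (pure (f ⊗ idm (smp i)^∨) (idm (smp i))) c u v.
apply: etrans (linear_sum_fun _ lc) _; apply: eq_bigr => al _.
apply: etrans (linearZ_fun _ _ lc) _; congr (_ *: _)%R.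
apply: etrans (@pair_comp_pure k C (rev C) (A ⊗ (smp i)^∨, smp i)%ob
  (A' ⊗ (smp i)^∨, smp i)%ob (M n) _ _ _ _) _; rewrite mcomp1r; congr (pure _ _).
by rewrite -[LHS]mcompA -tensmM mcomp1l (mcompA (prj _ _)).
Qed.

Section Coalgebra.
Variable A : frobData C.
Local Notation S := (R_frob B A).
Local Notation L := (Leaf (fob_ S)).

Lemma counit_chi_check : fcounit S = chi_check B (phiT0 C ∘ fcounit A).
Proof. exact: chi_check_nat. Qed.

(** chi_check is natural (chi_check_nat), so the three factors of the coproduct
    combine into one transpose. *)
Lemma comul_chi_check : fcomul S = chi_check B (gather T (Node L L)
  ∘ ((delta_check B A ⊗ delta_check B A) ∘ fcomul A)).
Proof.
have e : psiR2 B A A = chi_check B (phiT2 (R_ob A : D) (R_ob A) ∘ (delta_check B A ⊗ delta_check B A)).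
  rewrite /psiR2 /rho_check -[phiT2 _ _ in RHS]mcomp1l -!chi_check_nat. by [].
rewrite /= tensm1 mcomp1r mcompA -chi_check_nat -e.
by [].
Qed.
End Coalgebra.

(** An explicit form of delta_check. The weight d_i / Dim C cancels the one in
    chi_check. *)
Definition dc0 A : hom A (T_ob (R_ob A)) :=
  (\sum_i (d i / Dim C) *: (inj (@T_fam _ C (R_ob A)) i
    ∘ (associ A (smp i)^∨ (smp i) ∘ (idm A ⊗ coev' (smp i)) ∘ runi A)))%R.

Lemma partial_trace_cup A i :
  partial_trace (associ A (smp i)^∨ (smp i) ∘ (idm A ⊗ coev' (smp i)) ∘ runi A) (idm (smp i : C))
  = idm (A ⊗ (smp i)^∨)%ob.
Proof.
rewrite /partial_trace; flatten.
by frw2 (snake2' (smp i : C) W).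
Qed.

Hypothesis dim_neq0 : Dim C != 0.

Lemma chi_check_dc0 A : chi_check B (dc0 A) = idm (R_ob A : D).
Proof.
apply/entryP => i j; rewrite chi_checkE entryE /check_entry.
have -> : prj (@T_fam _ C (R_ob A)) j ∘ dc0 A = ((d j / Dim C) *:
    (associ A (smp j)^∨ (smp j) ∘ (idm A ⊗ coev' (smp j)) ∘ runi A))%R.
  rewrite /dc0 mcomp_sumr (bigD1 j) //= big1 ?addr0; last first.
    by move=> l nl; rewrite mcompZr mcompA dprj_inj0 1?eq_sym // mcomp0l scaler0.
  by rewrite mcompZr mcompA dprj_inj mcomp1l.
have [ij|nij] := eqVneq i j; last first.
  rewrite kron_neq // big1 // => al _.
  rewrite (hom_smp0 (tnth (bup B (smp j) i) al)) 1?eq_sym //.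
  rewrite /partial_trace tensm0r tensm0l mcomp0r mcomp0l.
  by rewrite pure0l scaler0.
subst j; rewrite kron_id.
transitivity (pure (idm (A ⊗ (smp i)^∨)%ob) (\sum_al tnth (blo B (smp i) i) al ∘ tnth (bup B (smp i) i) al)%R).
  rewrite pure_sumr; apply: eq_bigr => al _.
  have [c ec] := end_smp B (tnth (bup B (smp i) i) al); rewrite ec.
  rewrite (linearZ_fun _ _ (partial_trace_linear _)).
  have -> : forall K : hom A ((A ⊗ (smp i)^∨) ⊗ smp i)%ob, partial_trace K (c *: idm (smp i))%R = (c *: partial_trace K (idm (smp i)))%R.
    by move=> K; rewrite /partial_trace tensmZr tensmZl mcompZr mcompZl.
  rewrite partial_trace_cup mcompZr mcomp1r pureZr !pureZl !scalerA mulrA.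
  by rewrite mulrA divfK ?(qdim_smp_neq0 B) // divff // mul1r.
congr (pure _ _); rewrite -(complete B (smp i)) (bigD1 i) //= [X in (_ + X)%R]big1 ?addr0 // => j nj.
by rewrite big1 // => al _; rewrite (hom_smp0 (tnth (blo B (smp i) j) al) nj) mcomp0l.
Qed.

(** Each summand contributes a loop d_i, and the sum of the d_i ^ 2 is Dim C. *)
Lemma rho0_dc0 A : rho0 A ∘ dc0 A = idm A.
Proof.
rewrite /dc0 mcomp_sumr (eq_bigr (fun i => (d i ^+ 2 / Dim C) *: idm A)%R).
  by rewrite -scaler_suml -mulr_suml divff // scale1r.
move=> i _; rewrite mcompZr mcompA rho0_inj.
have -> : counit_at A i ∘ (associ A (smp i)^∨ (smp i) ∘ (idm A ⊗ coev' (smp i)) ∘ runi A) = (d i *: idm A)%R.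
  rewrite /counit_at; transitivity (run A ∘ (idm A ⊗ (ev (smp i) ∘ coev' (smp i))) ∘ runi A).
    by flatten.
  by rewrite (scalar_ofE B (ev _ ∘ _)) tensmZr mcompZr mcompZl tensm1 mcomp1r runiK.
by rewrite scalerA expr2 mulrAC.
Qed.

Lemma chi_check_delta A : chi_check B (delta_check B A) = idm (R_ob A : D).
Proof.
have lc := @chi_check_linear k C B (R_ob A) A.
rewrite -(linfunE lc) /delta_check /chi_check_inv limg_lfunVK //.
by rewrite -(chi_check_dc0 A) -(linfunE lc) memv_img // memvf.
Qed.

Lemma scalar_pair (t : tensor (hom (one : C) one) (hom (one : C) one)) :
  exists c, t = (c *: pure (idm one) (idm one))%R.
Proof.
elim/tensor_ind: t => [a s t [c ->] [c' ->]|x y].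
  by exists (a * c + c'); rewrite scalerDl scalerA.
exists (scalar_of y * scalar_of x); rewrite {1}(scalar_ofE B x) {1}(scalar_ofE B y).
rewrite (linearZ_fun _ _ (fun e v w => (pure_bilinear _ _).1 _ e v w)).
by rewrite (linearZ_fun _ _ (fun e v w => (pure_bilinear _ _).2 _ e v w)) scalerA mulrC.
Qed.

Lemma T_scalar_inj (f g : hom (one : D) one) : lift T Unit Unit f = lift T Unit Unit g -> f = g.
Proof.
have E (h : hom (one : D) one) c : entry (h : hom (one2 C : D) (one2 C)) tt tt = (c *: pure (idm one) (idm one))%R ->
   lift T Unit Unit h = (c *: idm (one : C))%R.
  move=> eh; rewrite liftE /= /psiT0 /phiT0.
  transitivity (lun (one : C) ∘ (prj (@T_fam _ C (one2 C)) tt ∘ T_mor h ∘ inj (@T_fam _ C (one2 C)) tt) ∘ luni one).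
    by rewrite -!mcompA.
  rewrite prj_T_mor_inj eh (linearZ_fun _ _ (@tau_linear k C _ _)) tau_pure tensm1.
  by rewrite mcompZr mcomp1r mcompZl luniK.
have [c ec] := scalar_pair (entry f tt tt); have [c' ec'] := scalar_pair (entry g tt tt).
rewrite (E _ _ ec) (E _ _ ec') => /(scaler_one_inj (C := C)) ecc.
by apply/entryP => -[] []; rewrite ec ec' ecc.
Qed.

Lemma one_separating (V : C) (f g : hom V one) : (forall x : hom one V, f ∘ x = g ∘ x) -> f = g.
Proof.
move=> e; apply/eqP; rewrite -subr_eq0; apply/eqP; apply: (one_faithful B) => x.
by rewrite mcompBl e subrr.
Qed.

(** Write t with linearly independent first factors; composing with y leaves
    scalar coefficients, which vanish by independence for every y. *)
Lemma pair_separating (a b : C) (t : tensor (hom a one) (hom b one)) :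
  (forall (x : hom one a) (y : hom one b), tau (X := (a, b)) (Y := (one, one)) t ∘ (x ⊗ y) = 0) -> t = 0.
Proof.
move=> e; have fa := basis_free (vbasisP {:hom a one}); have fb := basis_free (vbasisP {:hom b one}).
pose g i : hom b one := (\sum_j t i j *: (vbasis {:hom b one})`_j)%R.
have g0 i : g i = 0.
  apply: (one_faithful B) => y.
  pose la i := scalar_of (g i ∘ y).
  suff : (\sum_i la i *: (vbasis {:hom a one})`_i)%R = 0.
    by move/freeP: fa => /[apply] /(_ i); rewrite (scalar_ofE B (g i ∘ y)) -/(la i) => ->; rewrite scale0r.
  apply: (one_faithful B) => x; set s := (\sum_i _)%R.
  suff z : (s ∘ x) ⊗ idm (one : C) = 0.
    by rewrite -[LHS]mcomp1r -(runiK one) mcompA -run_nat z mcomp0r mcomp0l.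
  rewrite -(e x y) [in RHS](tensor_expand t).
  rewrite (linear_sum_fun _ (@tau_linear k C (a, b) (one, one))) mcomp_suml /s mcomp_suml tensm_suml.
  apply: eq_bigr => l _.
  rewrite (linear_sum_fun _ (@tau_linear k C (a, b) (one, one))) mcomp_suml.
  rewrite mcompZl tensmZl -tensmZr -(scalar_ofE B (g l ∘ y)) tensmM tensm_sumr mcomp_suml.
  by apply: eq_bigr => j _; rewrite tensmZr (linearZ_fun _ _ (@tau_linear k C (a, b) (one, one))) tau_pure.
rewrite (tensor_expand t) big1 // => i _; rewrite big1 // => j _.
suff -> : t i j = 0 by rewrite scale0r.
by move/freeP: fb => /(_ (fun j => t i j) (g0 i) j).
Qed.

Lemma family_separating (V : D) (f g : hom V one) : (forall x : hom one V, f ∘ x = g ∘ x) -> f = g.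
Proof.
move=> e; apply/eqP; rewrite -subr_eq0; apply/eqP; move: e.
set h := (f - g)%R => e.
have {}e (x : hom (one : D) V) : h ∘ x = 0 by rewrite mcompBl e subrr.
apply/entryP => n [].
have -> : entry (0 : hom V (one : D)) n tt = 0 by rewrite /entry ffunE.
apply: pair_separating => x y.
pose z : hom (one : D) V := sum_of (E := P) (X := sum_one P) (Y := V)
  (fun _ => kron (P := fun l => hom (one : P) (V l)) (pure x y : hom (one : P) (V n))).
have := congr1 (fun F => entry (F : hom (one2 C : D) (one2 C)) tt tt) (e z).
have -> : entry (h ∘ z : hom (one2 C : D) (one2 C)) tt tt = (entry h n tt : hom (V n : P) one) ∘ (pure x y : hom (one : P) (V n)).
  rewrite entryE; under eq_bigr do rewrite entryE.
  rewrite (big_kron (P := fun l => hom (one : P) (V l)) (pure x y : hom (one : P) (V n))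
    (G := fun i u => (entry h i tt : hom (V i : P) one) ∘ u)) // => l; exact: mcomp0r.
have -> : entry (0 : hom (one2 C : D) (one2 C)) tt tt = 0 by rewrite /entry ffunE.
move/(congr1 (@tau k C (one, one) (one, one))).
rewrite (linear_fun0 (@tau_linear k C _ _)) => <-.
rewrite -(tau_pure (X := (one, one)) (Y := V n)); exact: (esym (@tauM k C (one, one) (V n) (one, one) (entry h n tt) (pure x y))).
Qed.
(** In a category of families rotation permutes the summands and rotates each of
    them. *)
Lemma entry_rot M N (y : hom one (M ⊗ N)%ob) m n :
  entry (X := sum_one P) (Y := sum_tens N M) (rot y) tt (n, m)
  = rot (C := P) (entry (X := sum_one P) (Y := sum_tens M N) y tt (m, n) : hom (one : P) ((M m : P) ⊗ N n)%ob).
Proof.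
have inj1 : injective (fun p : fidx N * fidx M => (p.1, p.2)) by move=> [u v] [u' v'] /= [-> ->].
have inj2 : injective (fun p : fidx M * fidx N => (p.2, p.1)) by move=> [u v] [u' v'] /= [-> ->].
have eT : (twist N ⊗ idm M : hom (N ⊗ M)%ob (N ⊗ M)%ob) = along (E := P) (X := sum_tens N M) (Y := sum_tens N M)
    (s := fun p => (p.1, p.2)) (fun p => twist (N p.1 : P) ⊗ idm (M p.2 : P)) by exact: along_tens.
rewrite rot_left eT -mcompA rot_left -mcompA.
apply: etrans (along_comp (E := P) (X := sum_one P) (Y := sum_tens N M) (Z := sum_tens N M) (s := fun p => (p.1, p.2))
  (fun p => twist (N p.1 : P) ⊗ idm (M p.2 : P)) _ tt (n, m) inj1) _; congr (_ ∘ _).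
exact: (along_comp (E := P) (X := sum_one P) (Y := sum_tens M N) (Z := sum_tens N M) (s := fun p => (p.2, p.1))
  (fun p => braid (M p.1 : P) (N p.2 : P)) y tt (m, n) inj2).
Qed.

Lemma rot_pure (a b c e : C) (y1 : hom one (a ⊗ c)%ob) (y2 : hom one (b ⊗ e)%ob) :
  rot (C := P) (X := (a, b)) (Y := (c, e)) (pure y1 y2) = pure (rot y1) (rot y2).
Proof.
rewrite -[in RHS](rot_rev y2) !rot_left -!mcompA.
have e1 : (twist ((c, e) : P) ⊗ idm ((a, b) : P)) = pure (twist c ⊗ idm a) (twist (e : rev C) ⊗ idm (b : rev C)).
  exact: (@pair_tensm_pure k C (rev C) (c, e) (c, e) (a, b) (a, b)).
have e2 : braid ((a, b) : P) (c, e) ∘ (pure y1 y2 : hom (one : P) (((a, b) : P) ⊗ ((c, e) : P))%ob)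
    = pure (braid a c ∘ y1) (braid (b : rev C) e ∘ y2).
  exact: (@pair_comp_pure k C (rev C) (one, one) (a ⊗ c, b ⊗ e)%ob (c ⊗ a, e ⊗ b)%ob).
rewrite e1 e2.
exact: (@pair_comp_pure k C (rev C) (one, one) (c ⊗ a, e ⊗ b)%ob (c ⊗ a, e ⊗ b)%ob).
Qed.

Lemma rotD (E : ribCat k) (X Y : E) a (y z : hom one (X ⊗ Y)%ob) : rot (a *: y + z)%R = (a *: rot y + rot z)%R.
Proof. by rewrite !rot_left mcompDr. Qed.

(** Linearity reduces this to pure tensors, where the second component is rotated
    in the reversed category; rot_rev and rot_mid4 conclude. *)
Lemma tau_rot (a b c e : C) (t : hom (one : P) (((a, b) : P) ⊗ ((c, e) : P))%ob) :
  mid4 c b (braid a e) ∘ (tau (X := (one, one)) (Y := (c ⊗ a, e ⊗ b)%ob) (rot t) ∘ luni one)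
  = rot (mid4 a e (braid c b) ∘ (tau (X := (one, one)) (Y := (a ⊗ c, b ⊗ e)%ob) t ∘ luni one)).
Proof.
elim/tensor_ind: t => [s t t' et et'|y1 y2].
  by rewrite rotD !tau_linear !(mcompDl, mcompDr) et et' rotD.
by rewrite rot_pure !tau_pure rot_mid4.
Qed.

Lemma T_rot M N (y : hom one (M ⊗ N)%ob) :
  lift T Unit (Node (Leaf N) (Leaf M)) (rot y) = rot (lift T Unit (Node (Leaf M) (Leaf N)) y).
Proof.
have ext (f g : hom one (T_ob N ⊗ T_ob M)%ob) :
    (forall n m, (prj (@T_fam _ C N) n ⊗ prj (@T_fam _ C M) m) ∘ f
      = (prj (@T_fam _ C N) n ⊗ prj (@T_fam _ C M) m) ∘ g) -> f = g.
  move=> e; rewrite -[f]mcomp1l -[g]mcomp1l -!tensm1 !idm_T tensm_suml !mcomp_suml.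
  apply: eq_bigr => n _; rewrite tensm_sumr !mcomp_suml; apply: eq_bigr => m _.
  by rewrite tensmM -!mcompA e.
apply: ext => n m; rewrite lift_elt entry_rot -rot_nat lift_elt.
exact: tau_rot.
Qed.
End Concrete.

(** * R(A) as a Frobenius algebra *)

Theorem proposition2p25 (R : realType) (C : modularCat (complex R))
    (B : dualBases C) (A : frobData C) (hA : is_frobenius A) :
  [/\ is_frobenius (R_frob B A),
      symmetric_frob A <-> symmetric_frob (R_frob B A),
      special A <-> special (R_frob B A)
    & normalised_special A <-> normalised_special (R_frob B A)].
Proof.
have nz : Dim C != 0 := Dim_neq0 B.
have surj := @rho0_surj _ _ B A; have faithful := @rho0_faithful _ _ B A.
have star := @chi_check_star _ _ B A; have sepC := one_separating B.
have sepD := family_separating B; have one_inj := @T_scalar_inj _ C B.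
have chkd := chi_check_delta B nz A.
have dE : delta_check B A = dc0 A.
  (* Both sides have the identity as transpose. *)
  apply: (chk_inj (T := T_fun C) (S := R_frob B A) surj nz star sepC).
  by rewrite chkd; exact: esym (chi_check_dc0 B nz A).
have rhod : rho0 A ∘ delta_check B A = idm A by rewrite dE; exact: rho0_dc0.
have mulE := rho0_mul B A; have unitE := rho0_unit B A.
have counitE := counit_chi_check B A; have comulE := comul_chi_check B A.
have frobS := transfer_frobenius (T := T_fun C) (S := R_frob B A) hA surj faithful mulE unitE
  nz star chkd counitE comulE one_inj sepC sepD.
have special_iff := transfer_special_with (T := T_fun C) (S := R_frob B A) hA surj faithful mulE unitE
  nz star chkd rhod counitE comulE one_inj sepC sepD.
split=> //.
- exact: (transfer_symmetric (T := T_fun C) (S := R_frob B A) surj mulE nz star rhod counitE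
    one_inj sepC sepD (@T_rot _ C)).
- by split=> -[z /special_iff]; exists z.
- exact: special_iff.
Qed.
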